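(* Let $0<T<\infty$, let $u_0\in\mathcal{P}(\mathbb{R}^d)$ and $v_T\in\mathcal{P}(\mathbb{R}^d)$, and let $\epsilon\ge 0$ be fixed. Let $u(x,t)=(G_t*u_0)(x)$ be the solution of the heat equation with initial datum $u_0$, let $s=\nabla\log u$ on $\mathbb{R}^d\times(0,T]$, and let $v$ be the solution of the backward Fokker--Planck equation $$\partial_t v+\epsilon\,\Delta v-(1+\epsilon)\,\mathrm{div}(s\,v)=0\quad\text{in }\mathbb{R}^d\times(0,T),\qquad v(\cdot,T)=v_T .$$ Then, for every $p\in[1,\infty)$ and every $t\in(0,T]$, $$\|v(t)\|_{L^p}\;\le\;\left(\frac{T}{t}\right)^{\frac{d(1+\epsilon)(p-1)}{2p}}\|v_T\|_{L^p}.$$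
   Context: $\mathcal{P}(\mathbb{R}^d)$ is the set of Borel probability measures on $\mathbb{R}^d$; measures with a density are identified with their density. $G_t(x)=(4\pi t)^{-d/2}\exp(-\|x\|^2/(4t))$ for $x\in\mathbb{R}^d$, $t>0$, is the heat kernel, and $u(x,t)=\int_{\mathbb{R}^d}G_t(x-y)\,du_0(y)$ solves $\partial_t u-\Delta u=0$ with $u(\cdot,0)=u_0$. Since $u$ is smooth and strictly positive for $t>0$, the score function $s=\nabla\log u=\nabla u/u$ is well defined and smooth on $\mathbb{R}^d\times(0,T]$. The equation for $v$ is solved backward in time from the terminal datum $v_T$ at time $T$; $v$ denotes its (unique, nonnegative) classical solution. $L^p=L^p(\mathbb{R}^d)$ with Lebesgue measure and $v(t)=v(\cdot,t)$; the estimate is understood to be nontrivial only when $v_T\in L^p(\mathbb{R}^d)$, the right-hand side being $+\infty$ otherwise. *)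

(* Defs.v *)
From HB Require Import structures.
From mathcomp Require Import all_boot all_order all_algebra.
From mathcomp Require Import all_classical all_reals all_analysis.
From mathcomp Require Import measurable_realfun.

Set Implicit Arguments.
Unset Strict Implicit.
Unset Printing Implicit Defensive.

Import Order.TTheory GRing.Theory Num.Theory.
Import numFieldNormedType.Exports.

Local Open Scope classical_set_scope.
Local Open Scope ring_scope.

Section borel_rV.
Context {R : realType} {d : nat}.
Let borel := <<s @open 'rV[R]_d >>.

Let borel0 : borel set0.
Proof. exact: sigma_algebra0. Qed.

Let borelC A : borel A -> borel (~` A).
Proof. by move=> ?; rewrite -setTD; exact: sigma_algebraCD. Qed.

Let borel_bigcup (F : (set 'rV[R]_d)^nat) :
  (forall i, borel (F i)) -> borel (\bigcup_i F i).
Proof. exact: sigma_algebra_bigcup. Qed.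

HB.instance Definition _ := @isMeasurable.Build (sigma_display (@open 'rV[R]_d))
  'rV[R]_d borel borel0 borelC borel_bigcup.

Lemma open_measurable_rV (U : set 'rV[R]_d) : open U -> measurable U.
Proof. exact: sub_sigma_algebra. Qed.

Lemma measurable_coord (i : 'I_d) :
  measurable_fun [set: 'rV[R]_d] (fun x : 'rV[R]_d => x ord0 i).
Proof.
apply: (measurability _ (RGenOpens.measurableE R)) => _ [_ [a [b ->]] <-].
rewrite setTI; apply: open_measurable_rV; apply: open_comp.
  by move=> x _; exact: coord_continuous.
exact: interval_open.
Qed.

Lemma open_bigcup_ratball (U : set 'rV[R]_d) : open U ->
  U = \bigcup_(q in [set q : 'rV[rat]_d * rat | 0 < (ratr q.2 : R) /\
                       ball (map_mx (@ratr R) q.1) (ratr q.2) `<=` U])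
        ball (map_mx (@ratr R) q.1) (ratr q.2).
Proof.
move=> oU; apply/seteqP; split=> [x Ux|x [q [_ qU] /qU]//].
have /nbhs_ballP[e /= e0 eU] : nbhs x U by exact: open_nbhs_nbhs.
have [r] := rat_in_itvoo (divr_gt0 e0 (ltr0n _ 2)).
rewrite in_itv /= => /andP[r0 re].
have qP i : exists q : rat, `|x ord0 i - ratr q| < ratr r.
  have [|q] := @rat_in_itvoo R (x ord0 i) (x ord0 i + ratr r).
    by rewrite ltrDl.
  rewrite in_itv /= => /andP[xq qx]; exists q.
  by rewrite distrC gtr0_norm ?subr_gt0// ltrBlDl.
pose q : 'rV[rat]_d := \row_i projT1 (cid (qP i)).
have xq : ball x (ratr r) (map_mx (@ratr R) q).
  by split=> // i j; rewrite (ord1 i) !mxE; case: cid.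
exists (q, r); last exact: ball_sym.
split=> //= y qy; apply: eU; rewrite [e]splitr.
apply: (@le_ball _ _ _ (ratr r + ratr r)); first by rewrite lerD ?ltW.
exact: ball_triangle xq qy.
Qed.

Lemma measurable_fun_rV d' (T : measurableType d') (f : T -> 'rV[R]_d) :
  (forall i, measurable_fun [set: T] (fun x => f x ord0 i)) ->
  measurable_fun [set: T] f.
Proof.
move=> mf; apply: (measurability (@open 'rV[R]_d) erefl) => _ [U oU <-].
rewrite setTI [U]open_bigcup_ratball// preimage_bigcup bigcup_mkcond.
apply: countable_bigcupT_measurable => [|-[q r] /=]; first exact: countableP.
case: ifPn => // /set_mem[/= r0 _].
have -> : f @^-1` ball (map_mx (@ratr R) q) (ratr r) =
    \bigcap_(i in [set: 'I_d]) ((fun x => f x ord0 i) @^-1`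
       ball (ratr (q ord0 i) : R) (ratr r)).
  apply/seteqP; split => [x [_ qx] i _|x qx].
    by have := qx ord0 i; rewrite mxE.
  by split=> // i j; rewrite (ord1 i) mxE; exact: qx.
apply: fin_bigcap_measurable => // i _.
by rewrite -[X in measurable X]setTI; apply: mf => //; exact: measurable_ball.
Qed.

End borel_rV.

Section lebesgue_rV.
Context {R : realType}.

Definition rV_cons d (z : 'rV[R]_d * measurableTypeR R) : 'rV[R]_d.+1 :=
  row_mx (z.2 : R)%:M z.1.

Lemma measurable_rV_cons d : measurable_fun [set: _] (@rV_cons d).
Proof.
apply: measurable_fun_rV => i.
have [j ij|j ij] := split_ordP (i : 'I_(1 + d)).
  rewrite [X in measurable_fun _ X](_ : _ = snd).
    exact: measurable_snd.
  apply/funext => z; rewrite ij.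
  by apply: etrans (row_mxEl _ _ _ _) _; rewrite (ord1 j) mxE.
rewrite [X in measurable_fun _ X](_ : _ = (fun x : 'rV[R]_d => x ord0 j) \o fst).
  by apply: measurableT_comp; [exact: measurable_coord|exact: measurable_fst].
by apply/funext => z; rewrite ij; exact: (row_mxEr ((z.2 : R)%:M : 'M[R]_1)).
Qed.

HB.instance Definition _ d :=
  isMeasurableFun.Build _ _ _ _ (@rV_cons d) (@measurable_rV_cons d).

Section lebesgue_rV_step.
Local Open Scope ereal_scope.
Context d (mu : {measure set 'rV[R]_d -> \bar R}).

Definition lebesgue_rV_step : set 'rV[R]_d.+1 -> \bar R :=
  pushforward (mu \x @lebesgue_measure R) (@rV_cons d).

Let step0 : lebesgue_rV_step set0 = 0.
Proof. exact: measure0. Qed.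

Let step_ge0 A : 0 <= lebesgue_rV_step A.
Proof. exact: measure_ge0. Qed.

Let step_sigma_additive : semi_sigma_additive lebesgue_rV_step.
Proof. exact: measure_semi_sigma_additive. Qed.

HB.instance Definition _ := isMeasure.Build _ _ _ lebesgue_rV_step
  step0 step_ge0 step_sigma_additive.

End lebesgue_rV_step.

Fixpoint lebesgue_rV d : {measure set 'rV[R]_d -> \bar R} :=
  if d is d'.+1 then lebesgue_rV_step (lebesgue_rV d') else \d_(0 : 'rV[R]_0).

End lebesgue_rV.

Section differential_operators.
Context {R : realType} {d : nat}.
Implicit Types (f : 'rV[R]_d -> R) (F : 'rV[R]_d -> 'rV[R]_d).

Definition unit_vec (i : 'I_d) : 'rV[R]_d := delta_mx ord0 i.

Definition partial (i : 'I_d) f : 'rV[R]_d -> R := 'D_(unit_vec i) f.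

Definition gradient f (x : 'rV[R]_d) : 'rV[R]_d := \row_i partial i f x.

Definition divergence F (x : 'rV[R]_d) : R :=
  \sum_i partial i (fun y => F y ord0 i) x.

Definition laplacian f (x : 'rV[R]_d) : R := \sum_i partial i (partial i f) x.

End differential_operators.

Section heat.
Context {R : realType} {d : nat}.

(* The library norm on 'rV[R]_d is the sup norm, hence the explicit sum. *)
Definition sqr_enorm (x : 'rV[R]_d) : R := \sum_i x ord0 i ^+ 2.

Definition heat_kernel (t : R) (x : 'rV[R]_d) : R :=
  (4 * pi * t) `^ (- (d%:R / 2)) * expR (- (sqr_enorm x / (4 * t))).

Definition heat_solution (u0 : probability 'rV[R]_d R) (x : 'rV[R]_d) (t : R)
    : R :=
  \int[u0]_y heat_kernel t (x - y).

Definition score (u : 'rV[R]_d -> R -> R) (x : 'rV[R]_d) (t : R) : 'rV[R]_d :=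
  gradient (fun y => ln (u y t)) x.

End heat.

Section densities.
Context {R : realType} {d : nat}.
Local Open Scope ereal_scope.

Definition has_density (mu : set 'rV[R]_d -> \bar R) (f : 'rV[R]_d -> R) :=
  [/\ measurable_fun [set: 'rV[R]_d] f, (forall x, 0 <= f x)%R &
      forall A, measurable A -> mu A = \int[lebesgue_rV d]_(x in A) (f x)%:E].

(* Densities of mu agree almost everywhere, so the infimum ranges over at most
   one value; it is +oo when mu has no density. *)
Definition measure_Lnorm (p : R) (mu : set 'rV[R]_d -> \bar R) : \bar R :=
  ereal_inf [set 'N[lebesgue_rV d]_p%:E [EFin \o f] | f in has_density mu].

End densities.

Section backward_fokker_planck.
Context {R : realType} {d : nat}.

Definition cont_at (f : 'rV[R]_d -> R -> R) (x : 'rV[R]_d) (t : R) :=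
  {for (x, t), continuous (fun z : 'rV[R]_d * R => f z.1 z.2)}.

Definition C1_on (T : R) (w : 'rV[R]_d -> R -> R) :=
  forall (x : 'rV[R]_d) (t : R), 0 < t < T ->
    [/\ derivable (w x) t 1,
        (forall i, derivable (w ^~ t) x (unit_vec i)),
        cont_at w x t,
        cont_at (fun y r => derive1 (w y) r) x t &
        forall i, cont_at (fun y r => partial i (w ^~ r) y) x t].

Definition C2_space_on (T : R) (w : 'rV[R]_d -> R -> R) :=
  forall (x : 'rV[R]_d) (t : R), 0 < t < T -> forall i j,
    derivable (partial i (w ^~ t)) x (unit_vec j) /\
    cont_at (fun y r => partial j (partial i (w ^~ r)) y) x t.

(* The solution is a curve of measures that has a classical density at times
   0 < t < T and reaches the terminal measure vT narrowly at t = T. Nothing is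
   assumed about the total mass of v t beyond what narrow continuity gives. For
   eps = 0 the equation is of first order and only C^1 regularity is required. *)
Record backward_FP_solution (eps T : R) (s : 'rV[R]_d -> R -> 'rV[R]_d)
    (vT : probability 'rV[R]_d R)
    (v : R -> {finite_measure set 'rV[R]_d -> \bar R}) : Prop := {
  bFP_classical : exists w : 'rV[R]_d -> R -> R,
    [/\ forall t : R, 0 < t < T -> has_density (v t) (w ^~ t),
        C1_on T w,
        (0 < eps -> C2_space_on T w) &
        forall (x : 'rV[R]_d) (t : R), 0 < t < T ->
          derive1 (w x) t + eps * laplacian (w ^~ t) x
            - (1 + eps) * divergence (fun y => w y t *: s y t) x = 0];
  bFP_narrow : forall phi : 'rV[R]_d -> R,
    continuous phi -> (exists M, forall x, `|phi x| <= M) ->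
    {within `]0, T], continuous (fun t => \int[v t]_x phi x)};
  bFP_terminal : forall A, measurable A -> v T A = vT A }.

End backward_fokker_planck.

(* Main.v *)
Require Import Defs.
From HB Require Import structures.
From mathcomp Require Import all_boot all_order all_algebra.
From mathcomp Require Import all_classical all_reals all_analysis.
From mathcomp Require Import measurable_realfun ring lra.

(**
Read backward in time the equation dissipates, so only the drift can spoil an
L^p norm, and it does so through its divergence alone. Formally, testing the
equation against [p v^(p-1)] and integrating by parts gives

  d/dr int v^p  >=  (1 + eps) (p - 1) int v^p div s ,

the diffusion contributing with the favourable sign. The one fact about the
heat flow that matters is the Li-Yau bound [div s >= - d / (2 r)]: the Jacobian
of [s] at time [r] is [- I / (2 r)] plus a multiple of a covariance matrix
([div_score_ge]). Hence [r^a int v^p] is nondecreasing in [r] for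
[a = (1 + eps) (p - 1) d / 2], and comparing [t] with [T] and taking the p-th
root is the claim.

A solution as given has no decay at infinity, only one derivative in space when
[eps = 0], and reaches its terminal datum merely in the narrow sense. Four
devices make the computation rigorous.

- The power is replaced by a convex function with bounded slope
  ([convex_profile], [trunc_pow]), whose integral the total mass controls.
- Integrals carry a cutoff that varies on a logarithmic scale ([cutoff]). The
  score grows at most linearly in x, uniformly away from time 0
  ([score_growth]), and such a drift crosses the cutoff at a cost of order
  [1 / N].
- The density is mollified in space at scale [dl]. A mollified density can be
  written as the integral of a bounded continuous function against the measure
  [v r], so narrow convergence gives its limit at [T], and Jensen's inequality
  compares that limit with the L^p norm of the terminal density
  ([energy_near_terminal]).
- Mollification does not commute with the drift. The error is the
  DiPerna-Lions commutator: it tends to 0 with [dl] locally uniformly before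
  [T] ([commutator_small]), and in L^1 it stays bounded up to [T]
  ([commutator_L1]), so a short time interval before [T] costs little.

The resulting inequality for the derivative in time of the mollified energy is
[energy_dt_ge]; integrated between [t] and a time close to [T] it gives
[energy_estimate]. Fatou's lemma then removes the cutoff and the truncation
([power_integral_le]).
*)

Set Implicit Arguments.
Unset Strict Implicit.
Unset Printing Implicit Defensive.

Import Order.TTheory GRing.Theory Num.Theory.
Import numFieldNormedType.Exports.

Local Open Scope classical_set_scope.
Local Open Scope ring_scope.

(** * Lebesgue measure on row vectors *)

Section lebesgue_affine.
Context {R : realType}.
Local Notation mu := (@lebesgue_measure R).

Lemma affine_preimage_ocitv (a b u v : R) : a != 0 ->
  (mu ((fun t : R => a * t + b)%R @^-1` `]u, v]) = (`|a|^-1)%:E * mu `]u, v])%E.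
Proof.
move=> a0.
have [ap|an|/eqP] := ltgtP 0 a; last by rewrite eq_sym (negbTE a0).
  have -> : (fun t : R => a * t + b) @^-1` `]u, v] = `](u - b) / a, (v - b) / a]%classic.
    apply/seteqP; split=> t /=; rewrite !in_itv /= ltr_pdivrMr// ler_pdivlMr//;
    by move=> /andP[? ?]; apply/andP; split; lra.
  rewrite !lebesgue_measure_itv/= !lte_fin ltr_pM2r ?invr_gt0// ltrD2r gtr0_norm//.
  case: ifPn => _; last by rewrite mule0.
  by rewrite -!EFinD -EFinM; congr EFin; field.
have -> : (fun t : R => a * t + b) @^-1` `]u, v] = `[(v - b) / a, (u - b) / a[%classic.
  apply/seteqP; split=> t /=; rewrite !in_itv /= ltr_ndivlMr// ler_ndivrMr//;
  by move=> /andP[? ?]; apply/andP; split; lra.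
rewrite !lebesgue_measure_itv/= !lte_fin ltr_nM2r ?invr_lt0// ltrD2r ltr0_norm//.
case: ifPn => _; last by rewrite mule0.
by rewrite -!EFinD -EFinM; congr EFin; field.
Qed.

(** A measure on the line is determined by its values on half-open intervals, so
Lebesgue measure is |a| times its image under t -> a t + b. *)
Lemma ge0_integral_affine1 (a b : R) (f : measurableTypeR R -> \bar R) : a != 0 ->
  measurable_fun setT f -> (forall x, 0 <= f x)%E ->
  (\int[mu]_t f (a * t + b)%R = (`|a|^-1)%:E * \int[mu]_t f t)%E.
Proof.
move=> a0 mf f0.
pose g (t : measurableTypeR R) : measurableTypeR R := a * t + b.
have mg : measurable_fun setT g.
  by apply: measurable_funD => //; exact: measurable_funM.
pose G : {mfun _ >-> _} := HB.pack g (isMeasurableFun.Build _ _ _ _ _ mg).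
have na0 : 0 <= `|a| by [].
have muE A : measurable A -> mu A = mscale (NngNum na0) (pushforward mu G) A.
  apply: lebesgue_measure_unique => X [[u v]] _ <-.
  have -> : (mu `]u, v] = `|a|%:E * (`|a|^-1%:E * mu `]u, v]))%E.
    by rewrite muleA -EFinM divff ?mul1e// normr_eq0.
  by rewrite -(affine_preimage_ocitv b u v a0).
rewrite [in RHS](eq_measure_integral (mscale (NngNum na0) (pushforward mu G))); last first.
  by move=> A mA _; exact: muE.
rewrite ge0_integral_mscale//= ge0_integral_pushforward//.
by rewrite muleA -EFinM mulVf ?mul1e ?normr_eq0.
Qed.

End lebesgue_affine.

Section lebesgue_rV_theory.
Context {R : realType}.
Local Notation mu := (@lebesgue_measure R).
Local Notation lam d := (@lebesgue_rV R d).

Lemma continuous_measurable_rV d (f : 'rV[R]_d -> R) :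
  continuous f -> measurable_fun [set: 'rV[R]_d] f.
Proof.
move=> cf; apply: (measurability _ (RGenOpens.measurableE R)) => _ [_ [a [b ->]] <-].
rewrite setTI; apply: open_measurable_rV; apply: open_comp; last exact: interval_open.
by move=> x _; exact: cf.
Qed.

Lemma measurable_affine d (a : R) (b : 'rV[R]_d) :
  measurable_fun [set: 'rV[R]_d] (fun z => a *: z + b).
Proof.
apply: measurable_fun_rV => i.
under eq_fun do rewrite !mxE.
apply: measurable_funD => //; apply: measurable_funM => //.
exact: measurable_coord.
Qed.

Lemma coord_norm_le d (x : 'rV[R]_d) i : `|x ord0 i| <= `|x|.
Proof.
by rewrite [leRHS]/Num.norm /= mx_normrE; apply/bigmax_geP; right => /=; exists (ord0, i).
Qed.

(** Written with coordinates rather than with the sup norm, so that its preimage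
under [rV_cons] is visibly a product. *)
Definition cube d (r : R) : set 'rV[R]_d := [set x | forall i, `|x ord0 i| <= r].

Lemma measurable_cube d (r : R) : measurable (@cube d r).
Proof.
rewrite [X in measurable X](_ : _ = \bigcap_(i in [set: 'I_d]) [set z : 'rV[R]_d | `|z ord0 i| <= r]); last first.
  by apply/seteqP; split=> z /= h i; [move=> _|]; exact: h.
apply: fin_bigcap_measurable => // i _.
rewrite [X in measurable X](_ : _ =
   [set: 'rV[R]_d] `&` (fun z => z ord0 i) @^-1` `[- r, r]%classic).
  exact: measurable_coord.
by rewrite setTI; apply/seteqP; split=> z /=; rewrite in_itv /= ler_norml.
Qed.

Lemma rV_cons_head d (z : 'rV[R]_d) (t : R) :
  rV_cons (z, t) ord0 (lshift d (ord0 : 'I_1)) = t.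
Proof. by rewrite /rV_cons (row_mxEl (t%:M : 'M[R]_1)) mxE eqxx mulr1n. Qed.

Lemma rV_cons_tail d (z : 'rV[R]_d) (t : R) (j : 'I_d) :
  rV_cons (z, t) ord0 (rshift 1 j) = z ord0 j.
Proof. by rewrite /rV_cons (row_mxEr (t%:M : 'M[R]_1)). Qed.

Lemma lebesgue_rV_cube d (r : R) : 0 <= r ->
  lam d (cube r) = ((r *+ 2) ^+ d)%:E.
Proof.
move=> r0; elim: d => [|d IH].
  by rewrite /= diracE mem_set// => -[].
rewrite /= /lebesgue_rV_step /pushforward.
have -> : @rV_cons R d @^-1` (cube r) = (@cube d r) `*` `[- r, r]%classic.
  apply/seteqP; split=> -[z t] /=.
    move=> h; split => [i|]; first by rewrite -(rV_cons_tail z t); exact: h.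
    by have := h (lshift d (ord0 : 'I_1)); rewrite rV_cons_head in_itv /= ler_norml.
  move=> [hz ht] i; have [j ->|j ->] := split_ordP (i : 'I_(1 + d)).
    by rewrite (ord1 j) rV_cons_head; move: ht; rewrite in_itv /= ler_norml.
  by rewrite rV_cons_tail; exact: hz.
rewrite product_measure1E//; last exact: measurable_cube.
rewrite IH; transitivity (((r *+ 2) ^+ d)%:E * mu `[(- r)%R, r])%E => //.
rewrite lebesgue_measure_itv /= lte_fin; case: ifPn => hr.
  by rewrite -EFinD -EFinM exprSr opprK mulr2n.
have -> : r = 0 by lra.
by rewrite mule0 mul0rn exprS mul0r.
Qed.

Lemma lebesgue_rV_sigma_finite d : sigma_finite setT (lam d).
Proof.
exists (fun n => @cube d n%:R).
  apply/esym/seteqP; split=> // x _.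
  exists (Num.truncn `|x|).+1 => // i /=.
  by rewrite (le_trans (coord_norm_le x i))// ltW// truncnS_gt.
by move=> n; split; [exact: measurable_cube|rewrite lebesgue_rV_cube// ltry].
Qed.

(** A second name for the measure [lebesgue_rV d], on which the sigma-finite
structure needed by Fubini's theorem can be declared. *)
Definition lebesgue_rV_sf d : set 'rV[R]_d -> \bar R := lam d.

HB.instance Definition _ d := isMeasure.Build _ _ _ (@lebesgue_rV_sf d)
  (measure0 (lam d)) (measure_ge0 (lam d)) (@measure_semi_sigma_additive _ _ _ (lam d)).

HB.instance Definition _ d :=
  Measure_isSigmaFinite.Build _ _ _ (@lebesgue_rV_sf d) (@lebesgue_rV_sigma_finite d).

Lemma tonelli_rV d (f : 'rV[R]_d * 'rV[R]_d -> \bar R) :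
  measurable_fun setT f -> (forall x, 0 <= f x)%E ->
  (\int[lam d]_x \int[lam d]_y f (x, y) = \int[lam d]_y \int[lam d]_x f (x, y))%E.
Proof.
move=> mf f0; exact: (@fubini_tonelli _ _ _ _ R (@lebesgue_rV_sf d) (@lebesgue_rV_sf d) f mf f0).
Qed.

Lemma integral_lebesgue_rVS d (f : 'rV[R]_d.+1 -> \bar R) :
  measurable_fun setT f -> (forall x, 0 <= f x)%E ->
  (\int[lam d.+1]_x f x = \int[lam d]_z \int[mu]_t f (rV_cons (z, t)))%E.
Proof.
move=> mf f0.
have mg : measurable_fun setT (f \o @rV_cons R d).
  by apply: measurableT_comp => //; exact: measurable_rV_cons.
transitivity (\int[(lam d \x mu)%E]_x (f \o @rV_cons R d) x)%E.
  exact: (ge0_integral_pushforward (@measurable_rV_cons R d) (lam d \x mu)%E measurableT mf (fun y _ => f0 y)).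
exact: (@fubini_tonelli1 _ _ _ _ R (@lebesgue_rV_sf d) (@lebesgue_measure R) _ mg (fun=> f0 _)).
Qed.

Lemma rV_cons_affine d (a : R) (z w : 'rV[R]_d) (t u : R) :
  a *: rV_cons (z, t) + rV_cons (w, u) = rV_cons (a *: z + w, a * t + u).
Proof.
apply/rowP => i; rewrite 2!mxE.
have [j ->|j ->] := split_ordP (i : 'I_(1 + d)); first by rewrite (ord1 j) !rV_cons_head.
by rewrite !rV_cons_tail !mxE.
Qed.

Lemma rV_consE d (x : 'rV[R]_d.+1) : exists z t, x = rV_cons (z, t).
Proof.
exists (@rsubmx R 1 1 d x), (@lsubmx R 1 1 d x ord0 ord0).
by rewrite /rV_cons /= -mx11_scalar [in RHS]hsubmxK.
Qed.

Lemma measurable_sections d (f : 'rV[R]_d.+1 -> \bar R) :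
  measurable_fun setT f -> (forall x, 0 <= f x)%E ->
  measurable_fun setT (fun z : 'rV[R]_d => \int[mu]_t f (rV_cons (z, t)))%E.
Proof.
move=> mf f0.
have mg : measurable_fun setT (f \o @rV_cons R d).
  by apply: measurableT_comp => //; exact: measurable_rV_cons.
exact: (@measurable_fun_fubini_tonelli_F _ _ _ _ R (@lebesgue_measure R) _ mg (fun=> f0 _)).
Qed.

(** Induction on the dimension: the one-dimensional change of variables treats the
first coordinate, the induction hypothesis the other ones. *)
Lemma ge0_integral_affine d (a : R) (b : 'rV[R]_d) (f : 'rV[R]_d -> \bar R) :
  a != 0 -> measurable_fun setT f -> (forall x, 0 <= f x)%E ->
  (\int[lam d]_x f (a *: x + b)%R = (`|a| ^- d)%:E * \int[lam d]_x f x)%E.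
Proof.
move=> a0; elim: d b f => [|d IH] b f mf f0.
  rewrite expr0 invr1 mul1e; apply: eq_integral => x _; congr f.
  by apply/matrixP => i [].
rewrite integral_lebesgue_rVS//; last exact: measurableT_comp (measurable_affine _ _).
rewrite integral_lebesgue_rVS//.
have [w [u ->]] := rV_consE b.
have mcons g z : measurable_fun setT g -> measurable_fun setT (fun t : measurableTypeR R => g (rV_cons (z : 'rV[R]_d, t)) : \bar R).
  move=> mg; apply: (measurableT_comp mg).
  by apply: (measurableT_comp (@measurable_rV_cons R d)); exact: pair1_measurable.
transitivity (\int[lam d]_z (`|a|^-1%:E * \int[mu]_t f (rV_cons ((a *: z + w)%R, t))))%E.
  apply: eq_integral => z _.
  under eq_integral do rewrite rV_cons_affine.
  exact: (ge0_integral_affine1 u a0 (mcons _ (a *: z + w) mf) (fun=> f0 _)).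
have mI := measurable_sections mf f0.
have I0 z : (0 <= \int[mu]_t f (rV_cons (z : 'rV[R]_d, t)))%E by exact: integral_ge0.
have mIa : measurable_fun setT (fun z : 'rV[R]_d => \int[mu]_t f (rV_cons ((a *: z + w)%R, t)))%E.
  by apply: (measurableT_comp mI); exact: measurable_affine.
have a1 : 0 <= `|a|^-1 by rewrite invr_ge0.
apply: etrans (ge0_integralZl_EFin (lam d) measurableT (fun z _ => I0 _) mIa a1) _.
have -> := IH w _ mI I0.
by rewrite muleA -EFinM exprSr invfM mulrC.
Qed.

Lemma ge0_integral_translate d (b : 'rV[R]_d) (f : 'rV[R]_d -> \bar R) :
  measurable_fun setT f -> (forall x, 0 <= f x)%E ->
  (\int[lam d]_x f (x + b)%R = \int[lam d]_x f x)%E.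
Proof.
move=> mf f0; have /= := ge0_integral_affine b (oner_neq0 R) mf f0.
rewrite normr1 expr1n invr1 mul1e => <-.
by apply: eq_integral => x _; rewrite scale1r.
Qed.

Lemma integral_translate d (b : 'rV[R]_d) (f : 'rV[R]_d -> \bar R) :
  measurable_fun setT f ->
  (\int[lam d]_x f (x + b)%R = \int[lam d]_x f x)%E.
Proof.
move=> mf; rewrite integralE [RHS]integralE; congr (_ - _)%E.
  rewrite -(ge0_integral_translate b (measurable_funepos mf) (funepos_ge0 f)).
  by apply: eq_integral => x _; rewrite !funeposE.
rewrite -(ge0_integral_translate b (measurable_funeneg mf) (funeneg_ge0 f)).
by apply: eq_integral => x _; rewrite !funenegE.
Qed.

End lebesgue_rV_theory.

(** * Continuity, and integrals depending on a parameter *)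

Lemma continuous_pairing (X T U : topologicalType) (f : X -> T) (g : X -> U) x :
  {for x, continuous f} -> {for x, continuous g} ->
  {for x, continuous (fun y => (f y, g y))}.
Proof.
move=> cf cg S [[A B] /= [fA gB] AB]; rewrite /= nbhs_simpl /=.
have h1 : \forall y \near x, A (f y) by exact: cf.
have h2 : \forall y \near x, B (g y) by exact: cg.
by apply: filterS2 h1 h2 => y Ay By; apply: (AB (f y, g y)).
Qed.

Section continuity_rules.
Context {R : realType} {T : topologicalType}.
Implicit Types (f g : T -> R) (x : T).

Lemma contD f g x : continuous_at x f -> continuous_at x g ->
  continuous_at x (fun y => f y + g y).
Proof. by move=> cf cg; exact: continuousD. Qed.

Lemma contB f g x : continuous_at x f -> continuous_at x g ->
  continuous_at x (fun y => f y - g y).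
Proof. by move=> cf cg; exact: continuousB. Qed.

Lemma contM f g x : continuous_at x f -> continuous_at x g ->
  continuous_at x (fun y => f y * g y).
Proof. by move=> cf cg; exact: continuousM. Qed.

Lemma contN f x : continuous_at x f -> continuous_at x (fun y => - f y).
Proof. by move=> cf; exact: continuousN. Qed.

Lemma contV f x : f x != 0 -> continuous_at x f -> continuous_at x (fun y => (f y)^-1).
Proof. by move=> f0 cf; exact: continuousV. Qed.

Lemma contC (c : R) x : continuous_at x (fun=> c : R).
Proof. exact: cst_continuous. Qed.

Lemma cont_comp (U V : topologicalType) (f : T -> U) (g : U -> V) x :
  continuous_at x f -> continuous_at (f x) g -> continuous_at x (fun y => g (f y)).
Proof. by move=> cf cg; exact: (@continuous_comp _ _ _ f g). Qed.

Lemma cont_norm f x : continuous_at x f -> continuous_at x (fun y => `|f y|).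
Proof. by move=> cf; apply: cont_comp cf _; exact: norm_continuous. Qed.

End continuity_rules.

Section vector_continuity_rules.
Context {R : realType} {T : topologicalType} {V : normedModType R}.
Implicit Types (f g : T -> V) (s : T -> R) (x : T).

Lemma vcontD f g x : continuous_at x f -> continuous_at x g ->
  continuous_at x (fun y => f y + g y).
Proof. by move=> cf cg; exact: cvgD. Qed.

Lemma vcontB f g x : continuous_at x f -> continuous_at x g ->
  continuous_at x (fun y => f y - g y).
Proof. by move=> cf cg; exact: cvgB. Qed.

Lemma vcontZ s f x : continuous_at x s -> continuous_at x f ->
  continuous_at x (fun y => s y *: f y).
Proof. by move=> cs cf; exact: cvgZ. Qed.

Lemma vcontC (c : V) x : continuous_at x (fun=> c : V).
Proof. exact: cst_continuous. Qed.

End vector_continuity_rules.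

Lemma continuous_sum_fun (R : realType) (T : topologicalType) (I : Type) (s : seq I)
    (f : I -> T -> R) (x : T) :
  (forall i, {for x, continuous (f i)}) -> {for x, continuous (fun y => \sum_(i <- s) f i y)}.
Proof.
move=> cf; elim: s => [|i s IH].
  have -> : (fun y => \sum_(i <- [::]) f i y) = cst 0.
    by apply/funext => y; rewrite big_nil.
  exact: cst_continuous.
have -> : (fun y => \sum_(j <- i :: s) f j y) = (fun y => f i y + \sum_(j <- s) f j y).
  by apply/funext => y; rewrite big_cons.
by apply: continuousD; [exact: cf|exact: IH].
Qed.

Section near_uniform.
Context {R : realType}.

(** The tube lemma: a compact K is covered by finitely many of the neighbourhoods
on which the increment of F is small, and the corresponding neighbourhoods of p
have an intersection that works for all of K. *)
Lemma near_uniform (P Z : topologicalType) (K : set Z) (F : P -> Z -> R) (p : P) :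
  compact K -> (forall z, K z -> {for (p, z), continuous (fun q : P * Z => F q.1 q.2)}) ->
  forall e : R, 0 < e -> \forall q \near p, forall z, K z -> `|F q z - F p z| < e.
Proof.
move=> cK cF e e0.
have cov := iffLR (compact_near_coveringP K) cK.
have := cov P (nbhs p) (fun q z => `|F q z - F p z| < e) _ _.
apply => z Kz.
have e20 : 0 < e / 2 by rewrite divr_gt0.
have /cvgrPdist_lt/(_ _ e20) [[A B] /= [pA zB] AB] := cF z Kz.
exists (B, A) => // -[z' q] /= [Bz' Aq].
have h1 := AB (q, z') (conj Aq Bz').
have h2 := AB (p, z') (conj (nbhs_singleton pA) Bz').
rewrite /= in h1 h2.
rewrite [e]splitr (_ : _ - _ = (F p z - F p z') - (F p z - F q z')); last by ring.
by rewrite (le_lt_trans (ler_normB _ _))// ltrD.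
Qed.

End near_uniform.

Section compactly_supported.
Context {R : realType} {d : nat}.
Local Notation lam := (@lebesgue_rV R d).
Implicit Types (f g : 'rV[R]_d -> R) (r : R).

Lemma compact_cube r : compact (@cube R d r).
Proof.
have -> : @cube R d r = [set v : 'rV[R]_d | forall i, `[- r, r]%classic (v ord0 i)].
  by apply/seteqP; split=> v h i; have := h i; rewrite /= in_itv /= ler_norml.
by apply: (@rV_compact R d (fun=> `[- r, r]%classic)) => i; exact: segment_compact.
Qed.

(** A fixed cube rather than some compact support, so that a family of such
functions has a common integrable bound. *)
Definition ccont r f := continuous f /\ forall x, ~ cube r x -> f x = 0.

Lemma ccont_bounded r f : continuous f -> exists M, 0 <= M /\ forall x, cube r x -> `|f x| <= M.
Proof.
move=> cf.
have : compact (f @` cube r).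
  by apply: continuous_compact; [exact: continuous_subspaceT|exact: compact_cube].
move=> /compact_bounded[M [Mr h]]; exists (`|M| + 1); split; first by rewrite addr_ge0.
move=> x cx; apply: (h (`|M| + 1)); last by exists x.
by rewrite (le_lt_trans (ler_norm _))// ltrDl.
Qed.

Lemma cube_le r r' (x : 'rV[R]_d) : r <= r' -> cube r x -> cube r' x.
Proof. by move=> rr h i; exact: le_trans (h i) rr. Qed.

Lemma lam_cube_lty r : (lam (cube r) < +oo)%E.
Proof.
apply: (@le_lt_trans _ _ (lam (cube `|r|))); last by rewrite lebesgue_rV_cube// ltry.
rewrite le_measure ?inE//; [exact: measurable_cube..|].
by move=> x; apply: cube_le; exact: ler_norm.
Qed.

Lemma continuous_integrable_cube r f : continuous f -> lam.-integrable (cube r) (EFin \o f).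
Proof.
move=> cf; apply: measurable_bounded_integrable.
- exact: measurable_cube.
- exact: lam_cube_lty.
- by apply: measurable_funTS; exact: continuous_measurable_rV.
- have [M [M0 h]] := ccont_bounded r cf.
  by exists M; split => // [|y My x cx]; [rewrite num_real|exact: le_trans (h x cx) (ltW My)].
Qed.

Lemma supp_patch r f : (forall x, ~ cube r x -> f x = 0) -> f \_ (cube r) = f.
Proof.
move=> h; apply/funext => x; rewrite patchE; case: ifPn => // /negP.
by rewrite inE => /h ->.
Qed.

Lemma supp_Rintegral r f : (forall x, ~ cube r x -> f x = 0) ->
  \int[lam]_(x in cube r) f x = \int[lam]_x f x.
Proof. by move=> h; rewrite Rintegral_mkcond supp_patch. Qed.

Lemma ccont_integrable r f : ccont r f -> lam.-integrable setT (EFin \o f).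
Proof.
move=> [cf h]; have := continuous_integrable_cube r cf.
move/(iffLR (integrable_mkcond _ (@measurable_cube R d r))).
by rewrite restrict_EFin supp_patch.
Qed.

Lemma ccontM r f g : continuous f -> ccont r g -> ccont r (fun x => f x * g x).
Proof.
move=> cf [cg h]; split; last by move=> x /h ->; rewrite mulr0.
by move=> x; apply: continuousM; [exact: cf|exact: cg].
Qed.

(** On the cube the integrands converge uniformly by [near_uniform], and outside
it they vanish. *)
Lemma cvg_integral_param (P : topologicalType) (F : P -> 'rV[R]_d -> R) (p : P) r :
  (\forall q \near p, ccont r (F q)) ->
  (forall z, cube r z -> {for (p, z), continuous (fun q : P * 'rV[R]_d => F q.1 q.2)}) ->
  \int[lam]_z F q z @[q --> p] --> \int[lam]_z F p z.
Proof.
move=> nF cF; apply/cvgrPdist_le => e e0.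
have lf : lam (cube r) \is a fin_num.
  by rewrite ge0_fin_numE// lam_cube_lty.
pose c := fine (lam (cube r)) + 1.
have c0 : 0 < c by rewrite ltr_wpDl// fine_ge0.
have NU := near_uniform (@compact_cube r) cF (divr_gt0 e0 c0).
near=> q.
have Fq : ccont r (F q) by near: q.
have Fp : ccont r (F p) by exact: nbhs_singleton nF.
rewrite -(supp_Rintegral Fq.2) -(supp_Rintegral Fp.2) -RintegralB//; last 3 first.
- exact: measurable_cube.
- by apply: continuous_integrable_cube; case: Fp.
- by apply: continuous_integrable_cube; case: Fq.
have cB : continuous (fun x => F p x - F q x).
  by move=> x; apply: continuousB; [case: Fp => + _|case: Fq => + _]; exact.
rewrite (le_trans (le_normr_Rintegral _ _))//; [exact: measurable_cube|exact: continuous_integrable_cube|].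
have -> : e = (e / c) * c by rewrite divfK// gt_eqF.
apply: (@le_trans _ _ (\int[lam]_(x in cube r) (e / c))).
  apply: le_Rintegral.
  - exact: measurable_cube.
  - by apply: (@continuous_integrable_cube r (fun x => `|F p x - F q x|)) => x; apply: continuous_comp (cB x) _; exact: norm_continuous.
  - by apply: (@continuous_integrable_cube r (fun=> e / c)) => x; exact: cst_continuous.
  move=> z cz; rewrite distrC ltW//; move: z cz.
  by near: q; exact: NU.
rewrite Rintegral_cst//; last exact: measurable_cube.
by rewrite ler_wpM2l ?divr_ge0 ?(ltW e0) ?(ltW c0)// lerDl.
Unshelve. all: by end_near. Qed.

(** By [near_uniform] the derivative stays within 1 of its value at time a, on the
whole cube and for all times near a; this bound justifies differentiating under
the integral. *)
Lemma is_derive_integral_param (F F' : R -> 'rV[R]_d -> R) (u v a r : R) :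
  a \in `]u, v[ ->
  (forall h, h \in `]u, v[ -> ccont r (F h)) ->
  (forall h z, h \in `]u, v[ -> is_derive h 1 (F ^~ z) (F' h z)) ->
  (forall z, {for (a, z), continuous (fun q : R * 'rV[R]_d => F' q.1 q.2)}) ->
  is_derive a 1 (fun h => \int[lam]_z F h z) (\int[lam]_z F' a z).
Proof.
move=> auv cF dF cF'.
have cFa : continuous (F' a).
  move=> z; apply: (@continuous_comp _ _ _ (fun y => (a, y)) (fun q : R * 'rV[R]_d => F' q.1 q.2)).
    by apply: continuous_pairing; [exact: cst_continuous|exact: cvg_id].
  exact: cF'.
have [M [M0 hM]] := ccont_bounded r cFa.
have := @near_uniform R R 'rV[R]_d (cube r) F' a (@compact_cube r) (fun z _ => cF' z) 1 ltr01.
move=> /nbhs_ballP[e /= e0 eB].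
pose u' := Num.max u (a - e); pose v' := Num.min v (a + e).
have [ua av] : u < a /\ a < v by move: auv; rewrite in_itv /= => /andP.
have a' : [set` `]u', v'[] a.
  by rewrite /= in_itv /= gt_max lt_min ua av !ltrDl gtrDl oppr_lt0 e0.
have sub h : (h \in `]u', v'[) -> (h \in `]u, v[) /\ ball a e h.
  rewrite !in_itv /= gt_max lt_min => /andP[/andP[h1 h2] /andP[h3 h4]]; split.
    by rewrite h1 h3.
  rewrite /ball /= ltr_distl; apply/andP; split; lra.
have F'0 h z : h \in `]u, v[ -> ~ cube r z -> F' h z = 0.
  move=> huv nz.
  have dz := dF h z huv.
  rewrite -(@derive_val _ _ _ _ _ _ _ dz).
  transitivity ('D_1 (cst 0 : R -> R) h); last by rewrite derive_val.
  apply: near_eq_derive.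
  have := near_in_itvoo huv; apply: filterS => k kuv.
  by have [_ ->] := cF k kuv.
have der h z : h \in `]u', v'[ -> derivable (F ^~ z) h 1.
  by move=> /sub[huv _]; have := dF h z huv => dz; exact: ex_derive.
have p1 h z : h \in `]u, v[ -> partial1of2 F h z = F' h z.
  by move=> huv; rewrite partial1of2E; have dz := dF h z huv; exact: derive_val.
have integ h : [set` `]u', v'[] h -> lam.-integrable (cube r) (EFin \o F h).
  by move=> /= /sub[/cF [ch _] _]; exact: continuous_integrable_cube.
have G_ub h z : [set` `]u', v'[] h -> cube r z -> `|partial1of2 F h z| <= M + 1.
  move=> /= /sub[huv hb] cz; rewrite p1//.
  have := eB h hb z cz; have := hM z cz => h1 h2.
  have -> : F' h z = F' a z + (F' h z - F' a z) by ring.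
  by rewrite (le_trans (ler_normD _ _))// lerD// ltW.
have M10 : forall z : 'rV[R]_d, 0 <= (fun=> M + 1) z by move=> _; rewrite addr_ge0.
have intG : lam.-integrable (cube r) (EFin \o (fun=> M + 1)).
  by apply: continuous_integrable_cube => x; exact: cst_continuous.
have D := @derivable_under_integral R _ _ lam F (cube r) (@measurable_cube R d r) a u' v' a'
  integ (fun h z hI _ => der h z hI) _ M10 intG G_ub.
have DE := @differentiation_under_integral R _ _ lam F (cube r) (@measurable_cube R d r) a u' v' a'
  integ (fun h z hI _ => der h z hI) _ M10 intG G_ub.
have eqn : \forall h \near a, \int[lam]_(z in cube r) F h z = \int[lam]_z F h z.
  have := near_in_itvoo auv; apply: filterS => h huv.
  by apply: supp_Rintegral; case: (cF h huv).
apply: near_eq_is_derive eqn _.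
split=> //; rewrite -derive1E DE -(@supp_Rintegral r); last by move=> z; exact: F'0.
by apply: eq_Rintegral => z _; rewrite p1.
Qed.

Lemma joint_bounded (f : 'rV[R]_d * R -> R) (rad a b : R) :
  (forall x r, a <= r <= b -> {for (x, r), continuous f}) ->
  exists2 M, 0 <= M & forall x r, cube rad x -> a <= r <= b -> `|f (x, r)| <= M.
Proof.
move=> cf.
have cK : compact (@cube R d rad `*` `[a, b]).
  by apply: compact_setX; [exact: compact_cube|exact: segment_compact].
have : compact (f @` (@cube R d rad `*` `[a, b])).
  apply: continuous_compact => //; apply: continuous_in_subspaceT => -[x r].
  by rewrite inE => -[_ /=]; rewrite in_itv /= => /(cf x).
move=> /compact_bounded[M [Mr h]]; exists (`|M| + 1); first by rewrite addr_ge0.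
move=> x r cx rab; apply: (h (`|M| + 1)).
  by rewrite (le_lt_trans (ler_norm _))// ltrDl.
by exists (x, r) => //; split => //=; rewrite in_itv.
Qed.

End compactly_supported.

(** * Directional derivatives, integration by parts, convolutions *)

Section line_derivative.
Context {R : realType} {V : normedModType R}.

Lemma line_quotient (f : V -> R) (x e : V) (h : R) :
  (fun k : R => k^-1 *: (((fun k => f (x + k *: e)) \o shift h) (k *: 1) - f (x + h *: e))) =
  (fun k : R => k^-1 *: ((f \o shift (x + h *: e)) (k *: e) - f (x + h *: e))).
Proof.
apply/funext => k /=; congr (_ *: (f _ - _)).
by rewrite /shift /= scalerDl /GRing.scale /= mulr1 addrCA.
Qed.

Lemma is_derive_line (f : V -> R) (x e : V) (h c : R) :
  is_derive (x + h *: e) e f c -> is_derive h 1 (fun k => f (x + k *: e)) c.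
Proof.
move=> [df <-]; split; first by rewrite /derivable line_quotient.
by rewrite /derive line_quotient.
Qed.

Lemma is_derive_line0 (f : V -> R) (x e : V) (c : R) :
  is_derive (0 : R) 1 (fun k => f (x + k *: e)) c -> is_derive x e f c.
Proof.
move=> [df <-]; have := line_quotient f x e 0; rewrite scale0r addr0 => E.
split; first by rewrite /derivable -E; move: df; rewrite /derivable /= scale0r addr0.
by rewrite /derive -E /= scale0r addr0.
Qed.

Lemma is_derive_unique (W : normedModType R) (f : V -> W) (x e : V) (c c' : W) :
  is_derive x e f c -> is_derive x e f c' -> c = c'.
Proof. by move=> [_ <-] [_ <-]. Qed.

End line_derivative.

Section rV_integrals.
Context {R : realType} {d : nat}.
Local Notation lam := (@lebesgue_rV R d).
Implicit Types (f g : 'rV[R]_d -> R) (r : R).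

Lemma Rintegral_translate b f : measurable_fun setT f ->
  \int[lam]_x f (x + b) = \int[lam]_x f x.
Proof.
move=> mf; rewrite /Rintegral; congr fine.
by rewrite -[RHS](integral_translate b)//; exact/measurable_EFinP.
Qed.

Lemma normrV_le_cube r (x : 'rV[R]_d) : 0 <= r -> cube r x -> `|x| <= r.
Proof.
move=> r0 cx; rewrite [leLHS]/Num.norm /= mx_normrE.
by apply/bigmax_leP; split => //= -[i j] _ /=; rewrite (ord1 i); exact: cx.
Qed.

Lemma ccont_translate r f (b : 'rV[R]_d) s : ccont r f -> `|b| <= s ->
  ccont (r + s) (fun x => f (x + b)).
Proof.
move=> [cf h] bs; split.
  move=> x; apply: (@continuous_comp _ _ _ (fun x : 'rV[R]_d => x + b) f); last exact: cf.
  by apply: continuousD => //; exact: cst_continuous.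
move=> x nx; apply: h => cx; apply: nx => i.
have := cx i; rewrite mxE => hi.
have -> : x ord0 i = x ord0 i + b ord0 i - b ord0 i by rewrite addrK.
by rewrite (le_trans (ler_normB _ _))// lerD// (le_trans (coord_norm_le _ _)).
Qed.

(** By translation invariance the integral of x -> f (x + h e) does not depend on
h; its derivative at h = 0 is the integral of the derivative of f. Applied to
products this is the integration by parts used throughout. *)
Lemma Rintegral_derive0 r f g (e : 'rV[R]_d) : ccont r f ->
  (forall x, is_derive x e f (g x)) -> continuous g -> \int[lam]_x g x = 0.
Proof.
move=> cf df cg.
pose F (h : R) (x : 'rV[R]_d) := f (x + h *: e).
have D : is_derive (0 : R) 1 (fun h => \int[lam]_x F h x) (\int[lam]_x (fun h x => g (x + h *: e)) 0 x).
  apply: (@is_derive_integral_param R d F (fun h x => g (x + h *: e)) (-1) 1 0 (r + `|e|)).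
  - by rewrite in_itv /= ltrN10 ltr01.
  - move=> h; rewrite in_itv /= => /andP[h1 h2]; apply: ccont_translate => //.
    by rewrite normrZ ler_piMl// ler_norml !ltW.
  - by move=> h z _; apply: is_derive_line; exact: df.
  - move=> z; apply: (@continuous_comp _ _ _ (fun q : R * 'rV[R]_d => q.2 + q.1 *: e) g); last exact: cg.
    apply: continuousD; first by exact: cvg_snd.
    by apply: continuousZl; exact: cvg_fst.
have C : is_derive (0 : R) 1 (fun h => \int[lam]_x F h x) 0.
  have -> : (fun h => \int[lam]_x F h x) = cst (\int[lam]_x f x).
    by apply/funext => h; apply: Rintegral_translate; apply: continuous_measurable_rV; case: cf.
  exact: is_derive_cst.
have := is_derive_unique D C.
by under eq_Rintegral do rewrite scale0r addr0.
Qed.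

Local Open Scope ereal_scope.

Lemma tonelli_conv (k g : 'rV[R]_d -> R) (c : R) :
  measurable_fun setT k -> measurable_fun setT g ->
  (forall x, 0 <= k x)%R -> (forall x, 0 <= g x)%R ->
  \int[lam]_x \int[lam]_z (k z * g (x - c *: z))%:E =
  \int[lam]_z (k z)%:E * \int[lam]_x (g x)%:E.
Proof.
move=> mk mg k0 g0.
have msub : measurable_fun [set: 'rV[R]_d * 'rV[R]_d]
    (fun q : 'rV[R]_d * 'rV[R]_d => q.1 - c *: q.2)%R.
  apply: measurable_fun_rV => i.
  rewrite [X in measurable_fun _ X](_ : _ = (fun q => ((fun x : 'rV[R]_d => x ord0 i) \o fst) q - c * ((fun x : 'rV[R]_d => x ord0 i) \o snd) q)%R); last first.
    by apply/funext => q; rewrite !mxE.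
  apply: measurable_funB.
    by apply: measurableT_comp; [exact: measurable_coord|exact: measurable_fst].
  apply: measurable_funM => //.
  by apply: measurableT_comp; [exact: measurable_coord|exact: measurable_snd].
rewrite (tonelli_rV (f := fun q => (k q.2 * g (q.1 - c *: q.2))%:E)); last 2 first.
- apply/measurable_EFinP; apply: measurable_funM.
    by apply: (measurableT_comp mk); exact: measurable_snd.
  exact: measurableT_comp mg msub.
- by move=> q; rewrite lee_fin mulr_ge0.
under eq_integral => y _.
  rewrite /=.
  under eq_integral do rewrite EFinM.
  rewrite ge0_integralZl_EFin//; last 2 first.
  - by move=> x _; rewrite lee_fin.
  - apply/measurable_EFinP; apply: (measurableT_comp mg).
    have := @measurable_affine R d 1 (- (c *: y))%R.
    by under eq_fun do rewrite scale1r.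
  rewrite (ge0_integral_translate (- (c *: y))%R (f := fun x => (g x)%:E)); last 2 first.
  - exact/measurable_EFinP.
  - by move=> x; rewrite lee_fin.
  over.
rewrite /= ge0_integralZr//.
- exact/measurable_EFinP.
- by move=> x _; rewrite lee_fin.
- by apply: integral_ge0 => x _; rewrite lee_fin.
Qed.

Import HBNNSimple.

(** For indicators this is the definition of a density; simple functions follow by
linearity and the general case by monotone convergence. *)
Lemma ge0_integral_density (mu : {measure set 'rV[R]_d -> \bar R}) f (g : 'rV[R]_d -> \bar R) :
  has_density mu f -> measurable_fun setT g -> (forall x, 0 <= g x) ->
  \int[mu]_x g x = \int[lam]_x (g x * (f x)%:E).
Proof.
move=> [mf f0 muf] mg g0.
have mF : measurable_fun setT (EFin \o f) by exact/measurable_EFinP.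
pose g_ := nnsfun_approx measurableT mg.
have cg x : (EFin \o g_ ^~ x) n @[n --> \oo] --> g x.
  by apply: cvg_nnsfun_approx => // y _; exact: g0.
have nd x : {homo (fun n => (g_ n x)%:E) : m n / (m <= n)%N >-> m <= n}.
  by move=> m n mn; rewrite lee_fin; exact/lefP/nd_nnsfun_approx.
transitivity (limn (fun n => \int[mu]_x (g_ n x)%:E)).
  rewrite -monotone_convergence; [|exact: measurableT| | |].
  - by apply: eq_integral => x _; apply/esym/cvg_lim => //; exact: cg.
  - by move=> n; exact/measurable_EFinP.
  - by move=> n x _; rewrite lee_fin.
  - by move=> x _; exact: nd.
transitivity (limn (fun n => \int[lam]_x ((g_ n x)%:E * (f x)%:E))); last first.
  rewrite -monotone_convergence; [|exact: measurableT| | |].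
  - apply: eq_integral => x _; apply/cvg_lim => //.
    by apply: cvgeZr => //; exact: cg.
  - by move=> n; apply: emeasurable_funM => //; exact/measurable_EFinP.
  - by move=> n x _; rewrite mule_ge0// lee_fin.
  - by move=> x _ m n mn; rewrite lee_wpmul2r ?lee_fin//; exact/lefP/nd_nnsfun_approx.
congr (limn _); apply/funext => n.
rewrite integral_nnsfun//= sintegralE.
have -> : (g_ n \_ [set: 'rV[R]_d] : 'rV[R]_d -> R) = g_ n.
  by apply/funext => x; rewrite patchT ?inE.
under [RHS]eq_integral => x _.
  rewrite fimfunE -fsumEFin// ge0_mule_fsuml; last first.
    by move=> r; rewrite lee_fin; exact: nnfun_muleindic_ge0.
  over.
rewrite ge0_integral_fsum//; last 2 first.
- move=> r; apply: emeasurable_funM => //; apply/measurable_EFinP.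
  exact: measurable_funM.
- by move=> r x _; rewrite mule_ge0// ?lee_fin//; exact: nnfun_muleindic_ge0.
apply: eq_fsbigr => r /[!inE] -[x _ <-].
under eq_integral do rewrite EFinM -muleA.
rewrite ge0_integralZl_EFin//; last 2 first.
- by move=> y _; rewrite mule_ge0// lee_fin.
- by apply: emeasurable_funM => //; exact/measurable_EFinP.
congr (_ * _); rewrite muf//.
rewrite [LHS]integral_mkcond; apply: eq_integral => y _.
rewrite patchE indicE; case: ifPn => _; by rewrite ?mul1e ?mul0e.
Qed.

End rV_integrals.

(** * Rules of differentiation, integrals against a finite measure *)

Section derivative_rules.
Context {R : realType} {V : normedModType R}.
Implicit Types (f g : V -> R) (x e : V).

Lemma is_deriveM_fun f g x e a b : is_derive x e f a -> is_derive x e g b ->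
  is_derive x e (fun y => f y * g y) (f x * b + g x * a).
Proof. by move=> df dg; exact: (is_deriveM df dg). Qed.

Lemma is_deriveD_fun f g x e a b : is_derive x e f a -> is_derive x e g b ->
  is_derive x e (fun y => f y + g y) (a + b).
Proof. by move=> df dg; exact: (is_deriveD df dg). Qed.

Lemma is_deriveN_fun f x e a : is_derive x e f a -> is_derive x e (fun y => - f y) (- a).
Proof. by move=> df; exact: (is_deriveN df). Qed.

Lemma is_deriveB_fun f g x e a b : is_derive x e f a -> is_derive x e g b ->
  is_derive x e (fun y => f y - g y) (a - b).
Proof. by move=> df dg; exact: (is_deriveB df dg). Qed.

Lemma is_deriveZ_fun f x e k a : is_derive x e f a ->
  is_derive x e (fun y => k * f y) (k * a).
Proof. by move=> df; exact: (is_deriveZ k df). Qed.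

Lemma is_derive_cst_fun (k : R) x e : is_derive x e (fun=> k) (0 : R).
Proof. exact: is_derive_cst. Qed.

Lemma is_derive_sum_fun n (f : 'I_n -> V -> R) x e (a : 'I_n -> R) :
  (forall i, is_derive x e (f i) (a i)) ->
  is_derive x e (fun y => \sum_i f i y) (\sum_i a i).
Proof.
move=> df; have := is_derive_sum df.
by rewrite (_ : \sum_(i < n) f i = (fun y => \sum_i f i y)) //; apply/funext => y; rewrite fct_sumE.
Qed.

Lemma is_derive_comp_scalar (g : R -> R) f x e a b :
  is_derive (f x) 1 g b -> is_derive x e f a ->
  is_derive x e (fun y => g (f y)) (b * a).
Proof.
move=> dg df; apply: is_derive_line0.
have dg' : is_derive (f (x + 0 *: e)) 1 g b by rewrite scale0r addr0.
have df' : is_derive (0 : R) 1 (fun k => f (x + k *: e)) a.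
  by apply: is_derive_line; rewrite scale0r addr0.
exact: is_derive1_comp dg' df'.
Qed.

Lemma is_deriveV_fun f x e a : f x != 0 -> is_derive x e f a ->
  is_derive x e (fun y => (f y)^-1) (- (f x) ^- 2 * a).
Proof.
move=> f0 df; apply: (@is_derive_comp_scalar (fun u => u^-1)) => //.
by have := is_deriveV f0 (is_derive_id (f x) 1); rewrite /GRing.scale /= mulr1.
Qed.

End derivative_rules.

Section sequential.
Context {R : realType}.

(** Brings continuity in a parameter within reach of the dominated convergence
theorem, which speaks of sequences. *)
Lemma continuous_for_seq (P : pseudoMetricType R) (f : P -> R) (p : P) (U : set P) :
  nbhs p U ->
  (forall x : nat -> P, (forall n, U (x n)) -> x n @[n --> \oo] --> p ->
    f (x n) @[n --> \oo] --> f p) ->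
  {for p, continuous f}.
Proof.
move=> nU h; apply/cvgrPdist_lt => e e0; apply: contrapT => H.
have step n : exists q, ball p n.+1%:R^-1 q /\ U q /\ ~ `|f p - f q| < e.
  apply: contrapT => /forallNP Hn; apply: H.
  have b : nbhs p (ball p n.+1%:R^-1) by apply: nbhsx_ballx.
  near=> q; apply: contrapT => nq; apply: (Hn q); split; [|split => //].
    by near: q.
  by near: q.
have [x hx] := choice step.
have xp : x n @[n --> \oo] --> p.
  apply/cvg_ballP => d d0; near=> n.
  have := (hx n).1; apply: le_ball.
  by near: n; have := near_infty_natSinv_lt (PosNum d0); apply: filterS => k /= /ltW.
have /cvgrPdist_lt/(_ e e0) [N _ hN] := h x (fun n => (hx n).2.1) xp.
exact: (hx N).2.2 (hN N (leqnn N)).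
Unshelve. all: by end_near. Qed.

End sequential.

Section finite_measure_parameter.
Context {R : realType} dY {Y : measurableType dY} (mu : {finite_measure set Y -> \bar R}).

Lemma bounded_integrable (f : Y -> R) M : measurable_fun setT f ->
  (forall y, `|f y| <= M) -> mu.-integrable setT (EFin \o f).
Proof.
move=> mf fM; apply: measurable_bounded_integrable => //.
  by rewrite -ge0_fin_numE//; exact: fin_num_measure.
exists M; split; first exact: num_real.
by move=> y My x _; exact: le_trans (fM x) (ltW My).
Qed.

Lemma continuous_Rintegral_param (P : pseudoMetricType R) (F : P -> Y -> R) p M :
  (forall q, measurable_fun setT (F q)) ->
  (\forall q \near p, forall y, `|F q y| <= M) ->
  (forall y, {for p, continuous (F ^~ y)}) ->
  {for p, continuous (fun q => \int[mu]_y F q y)}.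
Proof.
move=> mF bF cF; apply: (continuous_for_seq bF) => x xU xp.
have pU := nbhs_singleton bF.
apply: fine_cvg; rewrite fineK; last first.
  exact: integrable_fin_num (bounded_integrable (mF p) pU).
apply: (@dominated_cvg _ _ _ mu setT measurableT (fun n y => (F (x n) y)%:E) _ (EFin \o (fun=> M))).
- by move=> n; exact/measurable_EFinP.
- move=> y _; apply: cvg_EFin; first exact: nearW.
  exact: (cvg_comp _ _ xp (cF y)).
- by [].
- exact: (@bounded_integrable (fun=> M) `|M| (@measurable_cst _ _ _ _ setT M) (fun=> lexx _)).
- by move=> n y _; rewrite lee_fin; exact: xU.
Qed.

Lemma Rintegral_gt0 (f : Y -> R) M : (0 < mu setT)%E -> measurable_fun setT f ->
  (forall y, 0 < f y <= M) -> 0 < \int[mu]_y f y.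
Proof.
move=> mu0 mf fM.
have f0 y : 0 <= f y by case/andP: (fM y) => /ltW.
have intf : mu.-integrable setT (EFin \o f).
  by apply: (@bounded_integrable _ M) => // y; rewrite ger0_norm//; case/andP: (fM y).
rewrite lt_neqAle Rintegral_ge0// andbT eq_sym; apply/eqP => h.
have : (\int[mu]_y `|(f y)%:E| = 0)%E.
  under eq_integral do rewrite gee0_abs ?lee_fin//.
  by rewrite -[LHS]fineK ?(integrable_fin_num _ intf)//; congr EFin.
move/ae_eq_integral_abs => /(_ measurableT) [].
  exact/measurable_EFinP.
move=> N [mN N0 hN]; have : mu setT = 0%E.
  apply/eqP; rewrite -measure_le0 -N0 le_measure ?inE//.
  move=> y _; apply: hN => /= /(_ I) [fy].
  by have := fM y; rewrite fy ltxx.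
by move=> E; rewrite E ltxx in mu0.
Qed.

End finite_measure_parameter.

(** * Gaussian moments of the initial measure *)

Section euclid.
Context {R : realType} {d : nat}.
Implicit Types (x y z e : 'rV[R]_d).

Definition dotp e z : R := \sum_i e ord0 i * z ord0 i.

Lemma sqr_enorm_ge0 z : 0 <= sqr_enorm z.
Proof. by apply: sumr_ge0 => i _; exact: sqr_ge0. Qed.

Lemma sqr_coord_le z i : z ord0 i ^+ 2 <= sqr_enorm z.
Proof.
by rewrite /sqr_enorm (bigD1 i)//= lerDl; apply: sumr_ge0 => j _; exact: sqr_ge0.
Qed.

Lemma mul_coord_le z i j : `|z ord0 i * z ord0 j| <= sqr_enorm z.
Proof.
have := sqr_coord_le z i; have := sqr_coord_le z j.
rewrite normrM -(real_normK (num_real (z ord0 i))) -(real_normK (num_real (z ord0 j))).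
set a := `|z ord0 i|; set b := `|z ord0 j| => ha hb.
have := sqr_ge0 (a - b); rewrite sqrrB; lra.
Qed.

Lemma coord_le1D z i : `|z ord0 i| <= 1 + sqr_enorm z.
Proof.
have := sqr_coord_le z i; rewrite -(real_normK (num_real (z ord0 i))).
set a := `|z ord0 i| => ha; have := sqr_ge0 (a - 1); have : 0 <= a by exact: normr_ge0.
rewrite sqrrB; lra.
Qed.

Lemma is_derive_coord z e i : is_derive z e (fun x : 'rV[R]_d => x ord0 i) (e ord0 i).
Proof.
apply: is_derive_line0.
rewrite (_ : (fun k : R => _) = (fun k : R => z ord0 i + k * e ord0 i)); last first.
  by apply/funext => k; rewrite !mxE.
have D := is_deriveD_fun (is_derive_cst_fun (z ord0 i) (0 : R) 1)
  (is_deriveM_fun (is_derive_id (0 : R) 1) (is_derive_cst_fun (e ord0 i) (0 : R) 1)).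
by apply: is_derive_eq D _; rewrite mulr0 !add0r mulr1.
Qed.

Lemma is_derive_sqr_enorm z e : is_derive z e (@sqr_enorm R d) (2 * dotp e z).
Proof.
have D i : is_derive z e (fun x : 'rV[R]_d => x ord0 i ^+ 2) (2 * (e ord0 i * z ord0 i)).
  under eq_fun do rewrite expr2.
  apply: is_derive_eq (is_deriveM_fun (is_derive_coord z e i) (is_derive_coord z e i)) _.
  by ring.
by apply: is_derive_eq (is_derive_sum_fun D) _; rewrite /dotp mulr_sumr.
Qed.

Lemma continuous_coord i : continuous (fun x : 'rV[R]_d => x ord0 i).
Proof. by move=> x; exact: coord_continuous. Qed.

Lemma continuous_sqr_enorm : continuous (@sqr_enorm R d).
Proof.
move=> x; apply: continuous_sum_fun => i.
have -> : (fun y : 'rV[R]_d => y ord0 i ^+ 2) = (fun y => y ord0 i * y ord0 i).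
  by apply/funext => y; rewrite expr2.
by apply: continuousM; exact: continuous_coord.
Qed.

Lemma continuous_dotp e : continuous (dotp e).
Proof.
move=> x; apply: continuous_sum_fun => i.
by apply: continuousM; [exact: cst_continuous|exact: continuous_coord].
Qed.

Lemma dotp_unit i z : dotp (unit_vec i) z = z ord0 i.
Proof.
rewrite /dotp (bigD1 i)//= mxE !eqxx mul1r big1 ?addr0// => j ji.
by rewrite mxE eqxx (negbTE ji) mul0r.
Qed.

End euclid.

Section gaussian_moments.
Context {R : realType} {d : nat} (u0 : probability 'rV[R]_d R).
Implicit Types (x y z e : 'rV[R]_d) (k : 'rV[R]_d -> R).

(** The heat kernel without its normalising constant, which cancels in the
score. *)
Definition gauss (r : R) z : R := expR (- (sqr_enorm z / (4 * r))).

Definition gauss_moment k (r : R) x : R := \int[u0]_y (k (x - y) * gauss r (x - y)).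

Lemma gauss_gt0 r z : 0 < gauss r z. Proof. exact: expR_gt0. Qed.

Lemma gauss_le1 r z : 0 < r -> gauss r z <= 1.
Proof.
move=> r0; rewrite -expR0 ler_expR oppr_le0 divr_ge0 ?sqr_enorm_ge0// mulr_ge0// ltW//.
Qed.

(** From [u <= exp u] with [u = |z|^2 / (4 r)]; weights of quadratic growth are
therefore bounded against the Gaussian, whatever the initial measure. *)
Lemma gauss_bound r z : 0 < r -> (1 + sqr_enorm z) * gauss r z <= 1 + 4 * r.
Proof.
move=> r0; rewrite mulrDl mul1r lerD ?gauss_le1//.
rewrite /gauss expRN ler_pdivrMr ?expR_gt0//.
have r40 : 0 < 4 * r by rewrite mulr_gt0.
rewrite -ler_pdivrMl// mulrC; apply: le_trans (expR_ge1Dx _).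
by rewrite lerDr.
Qed.

Lemma gauss_continuous x r : 0 < r ->
  {for (x, r), continuous (fun q : 'rV[R]_d * R => gauss q.2 q.1)}.
Proof.
move=> r0; rewrite /gauss.
apply: (@continuous_comp _ _ _ (fun q : 'rV[R]_d * R => - (sqr_enorm q.1 / (4 * q.2))) expR); last exact: continuous_expR.
apply: continuousN; apply: continuousM.
  by apply: (@continuous_comp _ _ _ fst (@sqr_enorm R d)); [exact: cvg_fst|exact: continuous_sqr_enorm].
apply: continuousV; first by rewrite /= mulf_neq0// gt_eqF.
by apply: continuousM; [exact: cst_continuous|exact: cvg_snd].
Qed.

Lemma gauss_continuous_x r : 0 < r -> continuous (gauss r).
Proof.
move=> r0 x; apply: (@continuous_comp _ _ _ (fun x : 'rV[R]_d => (x, r)) (fun q : 'rV[R]_d * R => gauss q.2 q.1)).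
  by apply: continuous_pairing; [exact: cvg_id|exact: cst_continuous].
exact: gauss_continuous.
Qed.

Lemma is_derive_gauss r z e : 0 < r ->
  is_derive z e (gauss r) (- (dotp e z / (2 * r)) * gauss r z).
Proof.
move=> r0; rewrite /gauss.
have D : is_derive z e (fun y => - (sqr_enorm y / (4 * r))) (- (dotp e z / (2 * r))).
  have H := is_deriveZ_fun (- (4 * r)^-1) (is_derive_sqr_enorm z e).
  rewrite (_ : (fun y => - _) = (fun y => - (4 * r)^-1 * sqr_enorm y)); last first.
    by apply/funext => y; rewrite mulNr mulrC.
  apply: is_derive_eq H _.
  by field; rewrite gt_eqF.
have E := @is_derive_comp_scalar R _ expR (fun y => - (sqr_enorm y / (4 * r))) z e _ _ (is_derive_expR _) D.
by apply: is_derive_eq E _; rewrite mulrC.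
Qed.

Lemma moment_integrand_continuous k r x : 0 < r -> continuous k ->
  continuous (fun y => k (x - y) * gauss r (x - y)).
Proof.
move=> r0 ck y.
have cs : {for y, continuous (fun y : 'rV[R]_d => x - y)}.
  by apply: continuousB; [exact: cst_continuous|exact: cvg_id].
apply: (@continuousM R 'rV[R]_d (fun y => k (x - y)) (fun y => gauss r (x - y))).
  by apply: (@continuous_comp _ _ _ (fun y : 'rV[R]_d => x - y) k) => //; exact: ck.
by apply: (@continuous_comp _ _ _ (fun y : 'rV[R]_d => x - y) (gauss r)) => //; exact: gauss_continuous_x.
Qed.

Lemma moment_integrand_bound k C r z : 0 < r -> 0 <= C ->
  (forall z, `|k z| <= C * (1 + sqr_enorm z)) -> `|k z * gauss r z| <= C * (1 + 4 * r).
Proof.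
move=> r0 C0 kC; rewrite normrM (gtr0_norm (gauss_gt0 _ _)).
apply: le_trans (ler_wpM2r (ltW (gauss_gt0 r z)) (kC z)) _.
by rewrite -mulrA ler_wpM2l// gauss_bound.
Qed.

Lemma moment_integrable k C r x : 0 < r -> 0 <= C -> continuous k ->
  (forall z, `|k z| <= C * (1 + sqr_enorm z)) ->
  u0.-integrable setT (EFin \o (fun y => k (x - y) * gauss r (x - y))).
Proof.
move=> r0 C0 ck kC; apply: (@bounded_integrable _ _ _ u0 _ (C * (1 + 4 * r))).
  by apply: continuous_measurable_rV; exact: moment_integrand_continuous.
by move=> y; exact: moment_integrand_bound.
Qed.

Lemma moment_continuous k C x r : 0 < r -> 0 <= C -> continuous k ->
  (forall z, `|k z| <= C * (1 + sqr_enorm z)) ->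
  {for (x, r), continuous (fun q : 'rV[R]_d * R => gauss_moment k q.2 q.1)}.
Proof.
move=> r0 C0 ck kC.
have r20 : 0 < r / 2 by rewrite divr_gt0.
(* the time is kept above r / 2, so that the integrand is continuous in y for
   every parameter q and not only for those near (x, r) *)
pose F (q : 'rV[R]_d * R) y := k (q.1 - y) * gauss (Num.max q.2 (r / 2)) (q.1 - y).
have mx0 q : 0 < Num.max q (r / 2) by rewrite lt_max r20 orbT.
have nearr : \forall q \near (x, r), r / 2 < (q : 'rV[R]_d * R).2 < 2 * r.
  have : (fun q : 'rV[R]_d * R => q.2) @ (x, r) --> r by exact: cvg_snd.
  move=> h; apply: (h [set s | r / 2 < s < 2 * r]).
  have := @near_in_itvoo R (r / 2) (2 * r) r; apply; rewrite in_itv /=; apply/andP; split; lra.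
have H : {for (x, r), continuous (fun q => \int[u0]_y F q y)}.
  apply: (@continuous_Rintegral_param R _ _ u0 _ F (x, r) (C * (1 + 4 * (2 * r)))).
  - by move=> q; apply: continuous_measurable_rV; exact: moment_integrand_continuous.
  - apply: filterS nearr => q /andP[q1 q2] y.
    apply: le_trans (moment_integrand_bound _ (mx0 q.2) C0 kC) _.
    rewrite ler_wpM2l// lerD2l ler_pM2l// ge_max (ltW q2) /=; lra.
  - move=> y.
    have cs : {for (x, r), continuous (fun q : 'rV[R]_d * R => q.1 - y)}.
      by apply: continuousB; [exact: cvg_fst|exact: cst_continuous].
    apply: continuousM.
      by apply: (@continuous_comp _ _ _ (fun q : 'rV[R]_d * R => q.1 - y) k) => //; exact: ck.
    apply: (@continuous_comp _ _ _ (fun q : 'rV[R]_d * R => (q.1 - y, Num.max q.2 (r / 2))) (fun q : 'rV[R]_d * R => gauss q.2 q.1)).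
      apply: continuous_pairing => //.
      by apply: continuous_max; [exact: cvg_snd|exact: cst_continuous].
    exact: gauss_continuous.
have E : \forall q \near (x, r), \int[u0]_y F q y = gauss_moment k q.2 q.1.
  apply: filterS nearr => q /andP[q1 q2]; rewrite /F /gauss_moment.
  by rewrite max_l// ltW.
have E0 : \int[u0]_y F (x, r) y = gauss_moment k r x := nbhs_singleton E.
have H' : (\int[u0]_y F q y) @[q --> (x, r)] --> gauss_moment k r x by rewrite -E0; exact: H.
exact: cvg_trans (near_eq_cvg E) H'.
Qed.

(** Differentiation under the integral along the line x + h e; the new weight comes
from the derivative of k and from that of the Gaussian. *)
Lemma is_derive_moment k k' C r x e : 0 < r -> 0 <= C -> continuous k -> continuous k' ->
  (forall z, is_derive z e k (k' z)) ->
  (forall z, `|k z| <= C * (1 + sqr_enorm z)) ->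
  (forall z, `|k' z - k z * (dotp e z / (2 * r))| <= C * (1 + sqr_enorm z)) ->
  is_derive x e (gauss_moment k r) (gauss_moment (fun z => k' z - k z * (dotp e z / (2 * r))) r x).
Proof.
move=> r0 C0 ck ck' dk kC kC'.
pose kk z := k' z - k z * (dotp e z / (2 * r)).
pose f (h : R) y := k (x + h *: e - y) * gauss r (x + h *: e - y).
have a0 : [set` `](-1), 1[] (0 : R) by rewrite /= in_itv /= ltrN10 ltr01.
have df (h : R) (y : 'rV[R]_d) : is_derive h 1 (f ^~ y) (kk (x + h *: e - y) * gauss r (x + h *: e - y)).
  have D z : is_derive z e (fun z => k z * gauss r z) (kk z * gauss r z).
    apply: is_derive_eq (is_deriveM_fun (dk z) (is_derive_gauss z e r0)) _.
    by rewrite /kk; ring.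
  have E (h' : R) : x + h' *: e - y = x - y + h' *: e by rewrite addrAC.
  have -> : f ^~ y = (fun h' : R => (fun z => k z * gauss r z) (x - y + h' *: e)).
    by apply/funext => h'; rewrite /f E.
  by rewrite !E; apply: is_derive_line; exact: D.
have p1 (h : R) (y : 'rV[R]_d) : partial1of2 f h y = kk (x + h *: e - y) * gauss r (x + h *: e - y).
  by rewrite partial1of2E; have dz := df h y; exact: derive_val.
have integ (h : R) : [set` `](-1 : R), 1[] h -> u0.-integrable setT (EFin \o f h).
  by move=> _; exact: moment_integrable kC.
have der (h : R) (y : 'rV[R]_d) : [set` `](-1 : R), 1[] h -> setT y -> derivable (f ^~ y) h 1.
  by move=> _ _; have dz := df h y; exact: ex_derive.
have M0 (y : 'rV[R]_d) : 0 <= (fun=> C * (1 + 4 * r)) y.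
  by rewrite mulr_ge0// addr_ge0// mulr_ge0// ltW.
have intG : u0.-integrable setT (EFin \o (fun y : 'rV[R]_d => C * (1 + 4 * r))).
  apply: (@bounded_integrable _ _ _ u0 (fun=> C * (1 + 4 * r)) `|C * (1 + 4 * r)|) => //.
have G_ub (h : R) (y : 'rV[R]_d) : [set` `](-1 : R), 1[] h -> setT y -> `|partial1of2 f h y| <= C * (1 + 4 * r).
  by move=> _ _; rewrite p1; exact: moment_integrand_bound.
have D1 := derivable_under_integral measurableT a0 integ der M0 intG G_ub.
have D2 := differentiation_under_integral measurableT a0 integ der M0 intG G_ub.
apply: is_derive_line0; split; first exact: D1.
rewrite -derive1E [LHS]D2; apply: eq_Rintegral => y _.
by rewrite p1 scale0r addr0.
Qed.

End gaussian_moments.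

(** * The score of a heat solution *)

Section score_facts.
Context {R : realType} {d : nat} (u0 : probability 'rV[R]_d R).
Implicit Types (x y z e : 'rV[R]_d) (r : R).
Local Notation moment := (gauss_moment u0).

Definition gauss_mass r x := moment (fun=> 1) r x.
Definition gauss_mean i r x := moment (fun z => z ord0 i) r x.
Definition gauss_second i j r x := moment (fun z => z ord0 i * z ord0 j) r x.

Let one_growth (x : 'rV[R]_d) : `|1 : R| <= 1 * (1 + sqr_enorm x).
Proof. by rewrite normr1 mul1r lerDl sqr_enorm_ge0. Qed.

Let coord_growth i (x : 'rV[R]_d) : `|x ord0 i| <= 1 * (1 + sqr_enorm x).
Proof. by rewrite mul1r coord_le1D. Qed.

Let prod_growth i j (x : 'rV[R]_d) : `|x ord0 i * x ord0 j| <= 1 * (1 + sqr_enorm x).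
Proof. by rewrite mul1r (le_trans (mul_coord_le x i j))// lerDr. Qed.

Let one_cont : continuous ((fun=> 1) : 'rV[R]_d -> R).
Proof. by move=> x; exact: cst_continuous. Qed.

Let cst_cont (c : R) : continuous ((fun=> c) : 'rV[R]_d -> R).
Proof. by move=> x; exact: cst_continuous. Qed.

Let coord_cont i : continuous (fun x : 'rV[R]_d => x ord0 i).
Proof. exact: continuous_coord. Qed.

Let prod_cont i j : continuous (fun x : 'rV[R]_d => x ord0 i * x ord0 j).
Proof. by move=> x; apply: continuousM; exact: coord_cont. Qed.

Lemma moment_lincomb (I : Type) (s : seq I) (c : I -> R) (k : I -> 'rV[R]_d -> R) r x :
  0 < r -> (forall j, continuous (k j)) ->
  (forall j z, `|k j z| <= 1 * (1 + sqr_enorm z)) ->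
  moment (fun z => \sum_(j <- s) c j * k j z) r x = \sum_(j <- s) c j * moment (k j) r x.
Proof.
move=> r0 ck kb.
have intk j : u0.-integrable setT (EFin \o (fun y => k j (x - y) * gauss r (x - y))).
  exact: (moment_integrable u0 x r0 ler01 (ck j) (kb j)).
suff [] : u0.-integrable setT (EFin \o (fun y => (\sum_(j <- s) c j * k j (x - y)) * gauss r (x - y))) /\
  moment (fun z => \sum_(j <- s) c j * k j z) r x = \sum_(j <- s) c j * moment (k j) r x by [].
elim: s => [|i s [IH1 IH2]].
  split.
    rewrite (_ : EFin \o _ = (fun=> 0%E)); first exact: integrable0.
    by apply/funext => y /=; rewrite big_nil mul0r.
  rewrite big_nil /gauss_moment.
  under eq_Rintegral do rewrite big_nil mul0r.
  by rewrite /Rintegral integral0.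
have E y : (\sum_(j <- i :: s) c j * k j (x - y)) * gauss r (x - y) =
  c i * (k i (x - y) * gauss r (x - y)) + (\sum_(j <- s) c j * k j (x - y)) * gauss r (x - y).
  by rewrite big_cons; ring.
have I1 : u0.-integrable setT (EFin \o (fun y => c i * (k i (x - y) * gauss r (x - y)))).
  by have := @integrableZl _ _ _ u0 setT measurableT (c i) _ (intk i).
split.
  rewrite (_ : EFin \o _ = ((EFin \o (fun y => (c i * (k i (x - y) * gauss r (x - y)))%R)) \+
    (EFin \o (fun y => ((\sum_(j <- s) c j * k j (x - y)) * gauss r (x - y))%R)))%E).
    exact: integrableD.
  by apply/funext => y /=; rewrite E.
rewrite big_cons -IH2 /gauss_moment.
under eq_Rintegral do rewrite E.
by rewrite RintegralD// RintegralZl.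
Qed.

Lemma mass_gt0 r x : 0 < r -> 0 < gauss_mass r x.
Proof.
move=> r0; apply: (@Rintegral_gt0 _ _ _ u0 (fun y => 1 * gauss r (x - y)) 1).
- by have := probability_setT u0; rewrite /= => ->; rewrite lte01.
- by apply: continuous_measurable_rV; exact: (moment_integrand_continuous r0 one_cont).
- by move=> y; rewrite mul1r gauss_gt0 gauss_le1.
Qed.

Lemma sum_norm_ge0 e : 0 <= \sum_i `|e ord0 i|.
Proof. by apply: sumr_ge0 => i _. Qed.

Lemma dotp_bound1 e z : `|dotp e z| <= (\sum_i `|e ord0 i|) * (1 + sqr_enorm z).
Proof.
rewrite /dotp (le_trans (ler_norm_sum _ _ _))// mulr_suml ler_sum// => i _.
by rewrite normrM ler_wpM2l// coord_le1D.
Qed.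

Lemma dotp_bound2 e z i : `|z ord0 i * dotp e z| <= (\sum_i `|e ord0 i|) * (1 + sqr_enorm z).
Proof.
rewrite /dotp mulr_sumr (le_trans (ler_norm_sum _ _ _))// mulr_suml ler_sum// => j _.
rewrite mulrCA normrM ler_wpM2l// (le_trans (mul_coord_le z i j))//; lra.
Qed.

Lemma is_derive_mass r x e : 0 < r ->
  is_derive x e (gauss_mass r) (- (2 * r)^-1 * \sum_j e ord0 j * gauss_mean j r x).
Proof.
move=> r0.
have r20 : 0 < (2 * r)^-1 by rewrite invr_gt0 mulr_gt0.
pose C := 1 + (\sum_i `|e ord0 i|) * (2 * r)^-1.
have C1 : 1 <= C by rewrite lerDl mulr_ge0 ?sum_norm_ge0// ltW.
have C0 : 0 <= C by rewrite (le_trans ler01).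
have D := @is_derive_moment R d u0 (fun=> 1) (fun=> 0) C r x e r0 C0 one_cont (@cst_cont 0)
  (fun z => is_derive_cst_fun _ _ _).
apply: is_derive_eq (D _ _) _.
- by move=> z; rewrite (le_trans (one_growth z))// ler_wpM2r// addr_ge0// sqr_enorm_ge0.
- move=> z; rewrite sub0r normrN mul1r normrM (gtr0_norm r20).
  apply: (@le_trans _ _ ((\sum_i `|e ord0 i|) * (1 + sqr_enorm z) * (2 * r)^-1)).
    by rewrite ler_wpM2r ?(ltW r20)// dotp_bound1.
  rewrite mulrAC ler_wpM2r ?addr_ge0 ?sqr_enorm_ge0//.
  by rewrite lerDr.
rewrite /gauss_mean -moment_lincomb// /gauss_moment -RintegralZl//; last first.
  apply: (@moment_integrable _ _ u0 (fun z => \sum_j e ord0 j * z ord0 j) (\sum_i `|e ord0 i|)) => //.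
  - exact: sum_norm_ge0.
  - exact: (@continuous_dotp R d e).
  - exact: dotp_bound1.
by apply: eq_Rintegral => y _; rewrite /dotp; ring.
Qed.

Lemma is_derive_mean r x e i : 0 < r ->
  is_derive x e (gauss_mean i r) (e ord0 i * gauss_mass r x - (2 * r)^-1 * \sum_j e ord0 j * gauss_second i j r x).
Proof.
move=> r0.
have r20 : 0 < (2 * r)^-1 by rewrite invr_gt0 mulr_gt0.
pose C := 1 + `|e ord0 i| + (\sum_i `|e ord0 i|) * (2 * r)^-1.
have C1 : 1 <= C by rewrite /C -addrA lerDl addr_ge0// mulr_ge0 ?sum_norm_ge0// ltW.
have C0 : 0 <= C by rewrite (le_trans ler01).
have D := @is_derive_moment R d u0 (fun z => z ord0 i) (fun=> e ord0 i) C r x e r0 C0 (@coord_cont i) (@cst_cont (e ord0 i))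
  (fun z => is_derive_coord _ _ _).
have n0 z : 0 <= 1 + sqr_enorm z :> R by rewrite addr_ge0// sqr_enorm_ge0.
apply: is_derive_eq (D _ _) _.
- by move=> z; rewrite (le_trans (coord_growth i z))// ler_wpM2r.
- move=> z; apply: le_trans (ler_normB _ _) _.
  rewrite mulrA normrM (gtr0_norm r20).
  apply: (@le_trans _ _ (`|e ord0 i| * (1 + sqr_enorm z) + (\sum_i `|e ord0 i|) * (1 + sqr_enorm z) * (2 * r)^-1)).
    rewrite lerD//; first by rewrite ler_peMr// lerDl sqr_enorm_ge0.
    by rewrite ler_wpM2r ?(ltW r20)// dotp_bound2.
  rewrite mulrAC -mulrDl ler_wpM2r// /C; lra.
have I1 : u0.-integrable setT (EFin \o (fun y => 1 * gauss r (x - y))).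
  exact: (moment_integrable u0 x r0 ler01 one_cont one_growth).
have I2 : u0.-integrable setT (EFin \o (fun y => (\sum_j e ord0 j * ((x - y) ord0 i * (x - y) ord0 j)) * gauss r (x - y))).
  apply: (@moment_integrable _ _ u0 (fun z => \sum_j e ord0 j * (z ord0 i * z ord0 j)) (\sum_i `|e ord0 i|)) => //.
  - exact: sum_norm_ge0.
  - move=> z; apply: continuous_sum_fun => j; apply: continuousM; [exact: cst_continuous|exact: prod_cont].
  - move=> z; apply: le_trans (dotp_bound2 e z i); rewrite le_eqVlt; apply/orP; left; apply/eqP.
    by congr `|_|; rewrite /dotp mulr_sumr; apply: eq_bigr => j _; rewrite mulrCA.
rewrite /gauss_second -(moment_lincomb _ (fun j => e ord0 j))// /gauss_mass /gauss_moment -!RintegralZl// -RintegralB//; last 2 first.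
- by have := @integrableZl _ _ _ u0 setT measurableT (e ord0 i) _ I1.
- by have := @integrableZl _ _ _ u0 setT measurableT (2 * r)^-1 _ I2.
apply: eq_Rintegral => y _.
have -> : \sum_j e ord0 j * ((x - y) ord0 i * (x - y) ord0 j) = (x - y) ord0 i * dotp e (x - y).
  by rewrite /dotp mulr_sumr; apply: eq_bigr => j _; rewrite mulrCA.
ring.
Qed.

End score_facts.

Section score_drift.
Context {R : realType} {d : nat} (u0 : probability 'rV[R]_d R).
Implicit Types (x y z e : 'rV[R]_d) (r : R).
Local Notation moment := (gauss_moment u0).
Local Notation gauss_mass := (gauss_mass u0).
Local Notation gauss_mean := (gauss_mean u0).
Local Notation gauss_second := (gauss_second u0).
Local Notation s := (score (heat_solution u0)).

(** The Jacobian of the score: - I / (2 r) plus the covariance matrix of x - y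
under the normalised Gaussian weight, divided by 4 r^2. *)
Definition dscore (j i : 'I_d) x r : R :=
  - (2 * r)^-1 * ((j == i)%:R +
    (2 * r)^-1 * (gauss_mean i r x * gauss_mean j r x / gauss_mass r x ^+ 2 - gauss_second i j r x / gauss_mass r x)).

Lemma heat_solutionE r : 0 < r ->
  exists2 c, 0 < c & forall x, heat_solution u0 x r = c * gauss_mass r x.
Proof.
move=> r0; exists ((4 * pi * r) `^ (- (d%:R / 2))).
  by rewrite powR_gt0// !mulr_gt0// pi_gt0.
move=> x; rewrite /heat_solution /heat_kernel.
rewrite RintegralZl//.
  by congr (_ * _); apply: eq_Rintegral => y _; rewrite mul1r.
have := @moment_integrable R d u0 (fun=> 1) 1 r x r0 ler01.
rewrite (_ : EFin \o (fun y => 1 * _) = EFin \o (fun y => expR (- (sqr_enorm (x - y) / (4 * r))))); last first.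
  by apply/funext => y; rewrite /= mul1r.
apply; first by move=> z; exact: cst_continuous.
by move=> z; rewrite normr1 mul1r lerDl sqr_enorm_ge0.
Qed.

Lemma scoreE r x i : 0 < r ->
  s x r ord0 i = - (2 * r)^-1 * (gauss_mean i r x * (gauss_mass r x)^-1).
Proof.
move=> r0; rewrite /score /gradient mxE /partial.
have [c c0 hE] := heat_solutionE r0.
have -> : (fun y => ln (heat_solution u0 y r)) = (fun y => ln (c * gauss_mass r y)).
  by apply/funext => y; rewrite hE.
have m0 := mass_gt0 u0 x r0.
have D1 := is_deriveZ_fun c (is_derive_mass u0 x (unit_vec i) r0).
have D2 := @is_derive_comp_scalar R _ (@ln R) (fun y => c * gauss_mass r y) x (unit_vec i) _ _
  (is_derive1_ln (mulr_gt0 c0 m0)) D1.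
rewrite (derive_val (is_derive := D2)).
have -> : \sum_j unit_vec i ord0 j * gauss_mean j r x = gauss_mean i r x.
  rewrite (bigD1 i)//= mxE !eqxx mul1r big1 ?addr0// => j ji.
  by rewrite mxE eqxx (negbTE ji) mul0r.
by field; rewrite !gt_eqF.
Qed.

Lemma is_derive_score_dir r x e i : 0 < r ->
  is_derive x e (fun y => s y r ord0 i) (\sum_j e ord0 j * dscore j i x r).
Proof.
move=> r0.
have -> : (fun y => s y r ord0 i) = (fun y => - (2 * r)^-1 * (gauss_mean i r y * (gauss_mass r y)^-1)).
  by apply/funext => y; rewrite scoreE.
have m0 := mass_gt0 u0 x r0.
have m0' : gauss_mass r x != 0 by rewrite gt_eqF.
have D := is_deriveZ_fun (- (2 * r)^-1) (is_deriveM_fun (is_derive_mean u0 x e i r0) 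
   (is_deriveV_fun m0' (is_derive_mass u0 x e r0))).
apply: is_derive_eq D _.
rewrite /dscore.
have -> : \sum_j e ord0 j * (- (2 * r)^-1 * ((j == i)%:R + (2 * r)^-1 *
    (gauss_mean i r x * gauss_mean j r x / gauss_mass r x ^+ 2 - gauss_second i j r x / gauss_mass r x))) =
  - (2 * r)^-1 * (\sum_j e ord0 j * (j == i)%:R) 
  - (2 * r)^-1 * (2 * r)^-1 * (gauss_mean i r x / gauss_mass r x ^+ 2) * (\sum_j e ord0 j * gauss_mean j r x)
  + (2 * r)^-1 * (2 * r)^-1 / gauss_mass r x * (\sum_j e ord0 j * gauss_second i j r x).
  rewrite !mulr_sumr -sumrB -big_split /=; apply: eq_bigr => j _; ring.
have -> : \sum_j e ord0 j * (j == i)%:R = e ord0 i.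
  rewrite (bigD1 i)//= eqxx mulr1 big1 ?addr0// => j /negbTE ->.
  by rewrite mulr0.
by field; rewrite m0' gt_eqF.
Qed.

Lemma is_derive_score r x i j : 0 < r ->
  is_derive x (unit_vec j) (fun y => s y r ord0 i) (dscore j i x r).
Proof.
move=> r0; apply: is_derive_eq (is_derive_score_dir x (unit_vec j) i r0) _.
rewrite (bigD1 j)//= mxE !eqxx mul1r big1 ?addr0// => k kj.
by rewrite mxE eqxx (negbTE kj) mul0r.
Qed.

Lemma mass_continuous x r : 0 < r ->
  {for (x, r), continuous (fun q : 'rV[R]_d * R => gauss_mass q.2 q.1)}.
Proof.
move=> r0; apply: (@moment_continuous _ _ u0 (fun=> 1) 1) => //.
  by move=> z; exact: cst_continuous.
by move=> z; rewrite normr1 mul1r lerDl sqr_enorm_ge0.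
Qed.

Lemma mean_continuous i x r : 0 < r ->
  {for (x, r), continuous (fun q : 'rV[R]_d * R => gauss_mean i q.2 q.1)}.
Proof.
move=> r0; apply: (@moment_continuous _ _ u0 (fun z => z ord0 i) 1) => //.
  exact: continuous_coord.
by move=> z; rewrite mul1r coord_le1D.
Qed.

Lemma second_continuous i j x r : 0 < r ->
  {for (x, r), continuous (fun q : 'rV[R]_d * R => gauss_second i j q.2 q.1)}.
Proof.
move=> r0; apply: (@moment_continuous _ _ u0 (fun z => z ord0 i * z ord0 j) 1) => //.
  by move=> z; apply: continuousM; exact: continuous_coord.
by move=> z; rewrite mul1r (le_trans (mul_coord_le z i j))// lerDr.
Qed.

Let inv2r_continuous x r : 0 < r ->
  {for (x, r), continuous (fun q : 'rV[R]_d * R => (2 * q.2)^-1)}.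
Proof.
move=> r0; apply: continuousV; first by rewrite /= mulf_neq0// gt_eqF.
by apply: continuousM; [exact: cst_continuous|exact: cvg_snd].
Qed.

Let inv_mass_continuous x r : 0 < r ->
  {for (x, r), continuous (fun q : 'rV[R]_d * R => (gauss_mass q.2 q.1)^-1)}.
Proof.
move=> r0; apply: continuousV; first by rewrite /= gt_eqF// mass_gt0.
exact: mass_continuous.
Qed.

Lemma near_pos_time x r : 0 < r -> \forall q \near (x, r), 0 < (q : 'rV[R]_d * R).2.
Proof.
move=> r0.
have : (fun q : 'rV[R]_d * R => q.2) @ (x, r) --> r by exact: cvg_snd.
move=> h; apply: (h [set s | 0 < s]); exact: lt_nbhsr.
Qed.

Lemma score_continuous i x r : 0 < r -> cont_at (fun y r => s y r ord0 i) x r.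
Proof.
move=> r0.
have H : {for (x, r), continuous (fun q : 'rV[R]_d * R =>
    - (2 * q.2)^-1 * (gauss_mean i q.2 q.1 * (gauss_mass q.2 q.1)^-1))}.
  apply: continuousM; first by apply: continuousN; exact: inv2r_continuous.
  by apply: continuousM; [exact: mean_continuous|exact: inv_mass_continuous].
have E : \forall q \near (x, r), - (2 * (q : 'rV[R]_d * R).2)^-1 * (gauss_mean i q.2 q.1 * (gauss_mass q.2 q.1)^-1) = s q.1 q.2 ord0 i.
  by apply: filterS (near_pos_time x r0) => q q0; rewrite scoreE.
have H' : - (2 * (q : 'rV[R]_d * R).2)^-1 * (gauss_mean i q.2 q.1 * (gauss_mass q.2 q.1)^-1) @[q --> (x, r)] --> s x r ord0 i.
  by rewrite scoreE//; exact: H.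
exact: cvg_trans (near_eq_cvg E) H'.
Qed.

Lemma dscore_continuous j i x r : 0 < r -> cont_at (dscore j i) x r.
Proof.
move=> r0; rewrite /cont_at /dscore.
apply: continuousM; first by apply: continuousN; exact: inv2r_continuous.
apply: continuousD; first exact: cst_continuous.
apply: continuousM; first exact: inv2r_continuous.
have -> : (fun q : 'rV[R]_d * R => gauss_mean i q.2 q.1 * gauss_mean j q.2 q.1 / gauss_mass q.2 q.1 ^+ 2 - gauss_second i j q.2 q.1 / gauss_mass q.2 q.1) =
   (fun q => gauss_mean i q.2 q.1 * gauss_mean j q.2 q.1 * ((gauss_mass q.2 q.1)^-1 * (gauss_mass q.2 q.1)^-1) - gauss_second i j q.2 q.1 / gauss_mass q.2 q.1).
  by apply/funext => q; rewrite expr2 invfM.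
apply: continuousB.
  apply: continuousM; apply: continuousM; [exact: mean_continuous..|exact: inv_mass_continuous|exact: inv_mass_continuous].
by apply: continuousM; [exact: second_continuous|exact: inv_mass_continuous].
Qed.

(** Cauchy-Schwarz, in the form: the moment of (z_i - l)^2 is nonnegative for
l = mean / mass. *)
Lemma mean_sqr_le i r x : 0 < r -> gauss_mean i r x ^+ 2 <= gauss_mass r x * gauss_second i i r x.
Proof.
move=> r0; have m0 := mass_gt0 u0 x r0.
pose l := gauss_mean i r x / gauss_mass r x.
(* the three monomials of (z_i - l)^2, to which [moment_lincomb] applies *)
pose k (n : nat) (z : 'rV[R]_d) : R := match n with 0 => z ord0 i * z ord0 i | 1 => z ord0 i | _ => 1 end.
pose c (n : nat) : R := match n with 0 => 1 | 1 => - (2 * l) | _ => l ^+ 2 end.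
have ck n : continuous (k n).
  case: n => [|[|n]] z /=; [|exact: continuous_coord|exact: cst_continuous].
  by apply: continuousM; exact: continuous_coord.
have bk n z : `|k n z| <= 1 * (1 + sqr_enorm z).
  rewrite mul1r; case: n => [|[|n]] /=; [|exact: coord_le1D|].
    by rewrite (le_trans (mul_coord_le z i i))// lerDr.
  by rewrite normr1 lerDl sqr_enorm_ge0.
have := moment_lincomb u0 [:: 0; 1; 2]%N c x r0 ck bk.
rewrite !big_cons big_nil /= addr0.
rewrite -/(gauss_mean i r x) -/(gauss_mass r x) -/(gauss_second i i r x) => E.
have : 0 <= moment (fun z => \sum_(j <- [:: 0; 1; 2]%N) c j * k j z) r x.
  apply: Rintegral_ge0 => y _; rewrite mulr_ge0 ?(ltW (gauss_gt0 _ _))//.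
  rewrite !big_cons big_nil /= addr0.
  have := sqr_ge0 ((x - y) ord0 i - l); congr (_ <= _); ring.
rewrite E mul1r /l => h.
have : 0 <= gauss_mass r x * (gauss_second i i r x + (- (2 * (gauss_mean i r x / gauss_mass r x)) * gauss_mean i r x + (gauss_mean i r x / gauss_mass r x) ^+ 2 * gauss_mass r x)).
  by rewrite mulr_ge0// ltW.
have -> : gauss_mass r x * (gauss_second i i r x + (- (2 * (gauss_mean i r x / gauss_mass r x)) * gauss_mean i r x + (gauss_mean i r x / gauss_mass r x) ^+ 2 * gauss_mass r x)) = gauss_mass r x * gauss_second i i r x - gauss_mean i r x ^+ 2.
  by field; rewrite gt_eqF.
by rewrite subr_ge0.
Qed.

(** The Li-Yau inequality: the covariance matrix in [dscore] has a nonnegative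
diagonal. *)
Lemma div_score_ge x r : 0 < r -> - (d%:R / 2) / r <= \sum_i dscore i i x r.
Proof.
move=> r0; have m0 := mass_gt0 u0 x r0.
have -> : - (d%:R / 2) / r = \sum_(i < d) (- (2 * r)^-1).
  by rewrite sumr_const card_ord -mulr_natl; field; rewrite gt_eqF.
apply: ler_sum => i _; rewrite /dscore eqxx -[leLHS]mulr1 ler_nM2l; last first.
  by rewrite oppr_lt0 invr_gt0 mulr_gt0.
rewrite gerDl pmulr_rle0 ?invr_gt0 ?mulr_gt0// subr_le0 ler_pdivrMr ?exprn_gt0//.
rewrite expr2 mulrA divfK ?gt_eqF// mulrC -expr2 [leRHS]mulrC; exact: mean_sqr_le.
Qed.

Lemma mass_le1 r x : 0 < r -> gauss_mass r x <= 1.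
Proof.
move=> r0.
have E : \int[u0]_y (cst 1 y : R) = 1.
  by rewrite Rintegral_cst// mul1r; have := probability_setT u0 => /= ->.
rewrite -E; apply: le_Rintegral => //.
- apply: (@moment_integrable R d u0 (fun=> 1) 1 r x r0 ler01); first by move=> z; exact: cst_continuous.
  by move=> z; rewrite normr1 mul1r lerDl sqr_enorm_ge0.
- apply: (@bounded_integrable _ _ _ u0 (cst 1) 1) => // y.
  by rewrite normr1.
- by move=> y _; rewrite mul1r gauss_le1.
Qed.

(** An entropy bound. Put [l = - ln mass], so that [exp (- l)] is the mass, and
[u = |z|^2 / (8 r)], so that the Gaussian is [exp (- 2 u)]. Then
[u exp (- 2 u) <= l exp (- 2 u) + exp (- l)] pointwise: when [u > l] this holds
because [u exp (- 2 u) <= exp (- u)]. *)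
Lemma sum_second_le r x : 0 < r ->
  \sum_i gauss_second i i r x <= 8 * r * (1 - ln (gauss_mass r x)) * gauss_mass r x.
Proof.
move=> r0; have m0 := mass_gt0 u0 x r0; have m1 := mass_le1 x r0.
set l := - ln (gauss_mass r x).
have l0 : 0 <= l by rewrite /l oppr_ge0 ln_le0.
have := @moment_lincomb R d u0 'I_d (index_enum _) (fun=> 1) (fun i z => z ord0 i * z ord0 i) r x r0.
have ck (i : 'I_d) : continuous (fun z : 'rV[R]_d => z ord0 i * z ord0 i).
  by move=> z; apply: continuousM; exact: continuous_coord.
have bk (i : 'I_d) (z : 'rV[R]_d) : `|z ord0 i * z ord0 i| <= 1 * (1 + sqr_enorm z).
  by rewrite mul1r (le_trans (mul_coord_le z i i))// lerDr.
move=> /(_ ck bk).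
under [X in _ = X -> _]eq_bigr do rewrite mul1r.
rewrite -/(gauss_second _ _ _ _) => <-.
have E (z : 'rV[R]_d) : \sum_i 1 * (z ord0 i * z ord0 i) = sqr_enorm z.
  by apply: eq_bigr => i _; rewrite mul1r expr2.
have c1 : continuous ((fun=> 1) : 'rV[R]_d -> R) by move=> z; exact: cst_continuous.
have b1 (z : 'rV[R]_d) : `|1 : R| <= 1 * (1 + sqr_enorm z).
  by rewrite normr1 mul1r lerDl sqr_enorm_ge0.
have I1 := moment_integrable u0 x r0 ler01 c1 b1.
have I2 : u0.-integrable setT (EFin \o cst (gauss_mass r x)).
  exact: (@bounded_integrable _ _ _ u0 (cst (gauss_mass r x)) `|gauss_mass r x|).
have -> : 8 * r * (1 - ln (gauss_mass r x)) * gauss_mass r x =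
   8 * r * (l * gauss_mass r x + \int[u0]_y (cst (gauss_mass r x) y)).
  rewrite Rintegral_cst//; have := probability_setT u0 => /= ->.
  by rewrite /= mulr1 /l; ring.
have I3 : u0.-integrable setT (EFin \o (fun y => l * (1 * gauss r (x - y)))).
  by have := @integrableZl _ _ _ u0 setT measurableT l _ I1.
have I4 : u0.-integrable setT (EFin \o (fun y => l * (1 * gauss r (x - y)) + cst (gauss_mass r x) y)).
  by have := integrableD measurableT I3 I2.
rewrite {1}/gauss_mass /gauss_moment -RintegralZl// -RintegralD// -RintegralZl//.
apply: le_Rintegral => //.
- have cN : continuous (fun z : 'rV[R]_d => \sum_i 1 * (z ord0 i * z ord0 i)).
    move=> z; apply: continuous_sum_fun => i.
    by apply: continuousM; [exact: cst_continuous|exact: ck].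
  apply: (moment_integrable u0 x r0 ler01 cN) => z.
  by rewrite E ger0_norm ?sqr_enorm_ge0// mul1r lerDr.
- by have := @integrableZl _ _ _ u0 setT measurableT (8 * r) _ I4.
move=> y _; rewrite E mul1r /=.
have -> : gauss_mass r x = expR (- l) by rewrite /l opprK lnK.
set a := sqr_enorm (x - y) / (8 * r).
have -> : sqr_enorm (x - y) = 8 * r * a by rewrite /a mulrC divfK// gt_eqF// mulr_gt0.
have -> : gauss r (x - y) = expR (- a) * expR (- a).
  by rewrite -expRD /gauss /a; congr expR; field; rewrite gt_eqF.
rewrite -mulrA ler_pM2l ?mulr_gt0//.
have [al|la] := leP a l.
  by rewrite (le_trans (ler_wpM2r _ al)) ?mulr_ge0 ?expR_ge0// lerDl expR_ge0.
rewrite (@le_trans _ _ (expR (- l)))// ?lerDr ?mulr_ge0 ?expR_ge0//.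
rewrite mulrA (@le_trans _ _ (1 * expR (- a)))//.
  rewrite ler_wpM2r ?expR_ge0// expRN ler_pdivrMr ?expR_gt0// mul1r.
  by apply: le_trans (expR_ge1Dx _); rewrite lerDr.
by rewrite mul1r ler_expR lerN2 ltW.
Qed.

(** Since [|x - y|^2 <= 2 |x|^2 + 2 |y|^2], the mass at (x, r) is at least
[exp (- |x|^2 / (2 t))] times the mass at (0, t / 2). *)
Lemma ln_mass_ge t : 0 < t -> exists c, forall r x, t <= r ->
  - ln (gauss_mass r x) <= c + sqr_enorm x / (2 * t).
Proof.
move=> t0; have t20 : 0 < t / 2 by rewrite divr_gt0.
exists (- ln (gauss_mass (t / 2) 0)) => r x tr.
have r0 : 0 < r by rewrite (lt_le_trans t0).
have m0 := mass_gt0 u0 x r0; have m0' := mass_gt0 u0 0 t20.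
have H : expR (- (sqr_enorm x / (2 * t))) * gauss_mass (t / 2) 0 <= gauss_mass r x.
  have c1 : continuous ((fun=> 1) : 'rV[R]_d -> R) by move=> z; exact: cst_continuous.
  have b1 (z : 'rV[R]_d) : `|1 : R| <= 1 * (1 + sqr_enorm z).
    by rewrite normr1 mul1r lerDl sqr_enorm_ge0.
  have I1 := moment_integrable u0 x r0 ler01 c1 b1.
  have I2 := moment_integrable u0 0 t20 ler01 c1 b1.
  rewrite {1}/gauss_mass /gauss_moment -RintegralZl//; apply: le_Rintegral => //.
    by have := @integrableZl _ _ _ u0 setT measurableT (expR (- (sqr_enorm x / (2 * t)))) _ I2.
  move=> y _; rewrite !mul1r /gauss -expRD ler_expR -opprD lerN2 sub0r.
  have -> : sqr_enorm (- y) = sqr_enorm y.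
    by apply: eq_bigr => i _; rewrite mxE sqrrN.
  have N2 : sqr_enorm (x - y) <= 2 * sqr_enorm x + 2 * sqr_enorm y.
    rewrite /sqr_enorm !mulr_sumr -big_split /=; apply: ler_sum => i _.
    rewrite !mxE; have := sqr_ge0 (x ord0 i + y ord0 i).
    by rewrite sqrrD sqrrB; clear; lra.
  apply: (@le_trans _ _ ((2 * sqr_enorm x + 2 * sqr_enorm y) / (4 * r))).
    by rewrite ler_wpM2r// invr_ge0 mulr_ge0// ltW.
  apply: (@le_trans _ _ ((2 * sqr_enorm x + 2 * sqr_enorm y) / (4 * t))).
    rewrite ler_wpM2l ?addr_ge0 ?mulr_ge0 ?sqr_enorm_ge0//.
    by rewrite lef_pV2 ?posrE ?mulr_gt0// ler_pM2l.
  rewrite le_eqVlt; apply/orP; left; apply/eqP.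
  by field; rewrite gt_eqF.
have : ln (expR (- (sqr_enorm x / (2 * t))) * gauss_mass (t / 2) 0) <= ln (gauss_mass r x).
  by rewrite ler_ln ?posrE ?mulr_gt0 ?expR_gt0.
by rewrite lnM ?posrE ?expR_gt0// expRK lerNl opprD opprK addrC.
Qed.

(** By [mean_sqr_le] the squared length of the score is at most
[sum of second moments / (4 r^2 mass)], hence by [sum_second_le] of order
[(1 - ln mass) / r], and [ln_mass_ge] bounds the logarithm quadratically. *)
Lemma score_growth t : 0 < t -> exists2 C, 0 <= C & forall x r, t <= r ->
  \sum_i s x r ord0 i ^+ 2 <= C * (1 + sqr_enorm x).
Proof.
move=> t0; have [c hc] := ln_mass_ge t0.
exists (2 / t * (1 + `|c| + (2 * t)^-1)).
  by rewrite mulr_ge0 ?divr_ge0 ?(ltW t0)// !addr_ge0// invr_ge0 mulr_ge0// ltW.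
move=> x r tr; have r0 : 0 < r by rewrite (lt_le_trans t0).
have m0 := mass_gt0 u0 x r0.
have N0 := sqr_enorm_ge0 x.
apply: (@le_trans _ _ (((2 * r)^-1 ^+ 2 / gauss_mass r x) * \sum_i gauss_second i i r x)).
  rewrite mulr_sumr; apply: ler_sum => i _.
  rewrite scoreE// exprMn sqrrN -mulrA ler_wpM2l ?sqr_ge0//.
  rewrite exprMn -ler_pdivlMr ?exprn_gt0 ?invr_gt0// exprVn invrK expr2.
  rewrite mulrACA -expr2 mulrC mulrA [X in _ <= X](_ : _ = gauss_mass r x * gauss_second i i r x); last first.
    by field; rewrite gt_eqF.
  exact: mean_sqr_le.
apply: (@le_trans _ _ (((2 * r)^-1 ^+ 2 / gauss_mass r x) * (8 * r * (1 - ln (gauss_mass r x)) * gauss_mass r x))).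
  by rewrite ler_wpM2l ?sum_second_le// divr_ge0 ?sqr_ge0 ?(ltW m0).
have -> : ((2 * r)^-1 ^+ 2 / gauss_mass r x) * (8 * r * (1 - ln (gauss_mass r x)) * gauss_mass r x) =
  2 / r * (1 - ln (gauss_mass r x)) by field; rewrite !gt_eqF.
have H := hc r x tr.
have m1 := mass_le1 x r0.
have l0 : 0 <= 1 - ln (gauss_mass r x) by rewrite subr_ge0 (le_trans (ln_le0 m1)).
apply: (@le_trans _ _ (2 / t * (1 - ln (gauss_mass r x)))).
  by rewrite ler_wpM2r// ler_pM2l// lef_pV2 ?posrE.
rewrite -[leRHS]mulrA ler_pM2l ?divr_gt0//.
have tn : 0 <= (2 * t)^-1 by rewrite invr_ge0 mulr_ge0// ltW.
have cc := ler_norm c; have cN := mulr_ge0 (normr_ge0 c) N0.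
have TN := mulr_ge0 tn N0.
rewrite [_ / _]mulrC in H.
have -> : (1 + `|c| + (2 * t)^-1) * (1 + sqr_enorm x) =
  1 + `|c| + (2 * t)^-1 + sqr_enorm x + `|c| * sqr_enorm x + (2 * t)^-1 * sqr_enorm x by ring.
move: H TN cN cc tn.
set T1 := (2 * t)^-1; set T2 := T1 * _; set T3 := `|c| * _; set T4 := `|c|; set T5 := ln _.
move=> H TN cN cc tn; move: N0; set T6 := sqr_enorm x => N0; lra.
Qed.

Lemma score_lipschitz t T rad : 0 < t -> exists2 L, 0 <= L &
  forall x y r i, t <= r <= T -> cube rad x -> cube rad y ->
    `|s y r ord0 i - s x r ord0 i| <= L * `|y - x|.
Proof.
move=> t0.
pose B (q : 'rV[R]_d * R) := \sum_i \sum_j `|dscore j i q.1 q.2|.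
have [x r /andP[tr _]|M M0 hM] := @joint_bounded R d B rad t T.
  apply: continuous_sum_fun => i; apply: continuous_sum_fun => j.
  apply: (@continuous_comp _ _ _ (fun q : 'rV[R]_d * R => dscore j i q.1 q.2) Num.norm); last exact: norm_continuous.
  by apply: dscore_continuous; rewrite (lt_le_trans t0).
exists M => // x y r i trT cx cy.
have r0 : 0 < r by case/andP: trT => h _; rewrite (lt_le_trans t0).
pose e := y - x.
have df (h : R) : is_derive h 1 (fun h => s (x + h *: e) r ord0 i) (\sum_j e ord0 j * dscore j i (x + h *: e) r).
  exact: is_derive_line (is_derive_score_dir _ _ _ r0).
have cf : {within `[0, 1], continuous (fun h : R => s (x + h *: e) r ord0 i)}.
  by apply: derivable_within_continuous => h _; have dh := df h; exact: ex_derive.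
have [h h01] := MVT_segment ler01 (fun h _ => df h) cf.
rewrite scale1r scale0r addr0 subr0 mulr1 /e [x + _]addrC subrK => ->.
have cz : cube rad (x + h *: e).
  move=> k; rewrite !mxE.
  have -> : x ord0 k + h * (y ord0 k - x ord0 k) = (1 - h) * x ord0 k + h * y ord0 k by ring.
  move: h01; rewrite in_itv /= => /andP[h0 h1].
  apply: le_trans (ler_normD _ _) _; rewrite !normrM (ger0_norm h0) ger0_norm ?subr_ge0//.
  apply: (@le_trans _ _ ((1 - h) * rad + h * rad)); last by rewrite -mulrDl subrK mul1r.
  by rewrite lerD// ler_wpM2l// subr_ge0.
rewrite -/e; apply: le_trans (ler_norm_sum _ _ _) _.
apply: (@le_trans _ _ (\sum_j `|e| * `|dscore j i (x + h *: e) r|)).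
  by apply: ler_sum => j _; rewrite normrM ler_wpM2r// coord_norm_le.
rewrite -mulr_sumr mulrC ler_wpM2r//.
apply: le_trans (hM _ r cz trT); rewrite ger0_norm; last first.
  by apply: sumr_ge0 => k _; apply: sumr_ge0.
rewrite /B [leRHS](bigD1 i)//= lerDl; apply: sumr_ge0 => k _; exact: sumr_ge0.
Qed.

End score_drift.

(** * Logarithmic cutoff functions *)

Section tangent.
Context {R : realType}.

(** The difference quotient of f lies between the slopes b at the two end points,
by the tangent inequality at each of them. *)
Lemma is_derive_tangent (f b : R -> R) (x : R) :
  (forall y z, f y + b y * (z - y) <= f z) -> {for x, continuous b} ->
  is_derive x 1 f (b x).
Proof.
move=> fb cb.
have C : (fun h => h^-1 *: ((f \o shift x) (h *: 1) - f x)) @ 0^' --> b x.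
  apply/cvgrPdist_le => e e0.
  have /cvgrPdist_le/(_ _ e0) := cb.
  move=> /nbhs_ballP[del /= del0 hb].
  exists del => //= h; rewrite /ball /= sub0r normrN => hd h0.
  have {}hb : `|b x - b (h + x)| <= e.
    by apply: hb; rewrite /ball /= opprD addrCA subrr addr0 normrN.
  rewrite /shift /= /GRing.scale /= mulr1.
  have h1 : b x * h <= f (h + x) - f x.
    by have := fb x (h + x); rewrite addrK; lra.
  have h2 : f (h + x) - f x <= b (h + x) * h.
    by have := fb (h + x) x; rewrite opprD addrCA subrr addr0; lra.
  apply: le_trans hb; set D := _ - f x in h1 h2 *.
  have [hp|hn|hz] := ltgtP 0 h; last by rewrite hz eqxx in h0.
  - have q1 : b x <= h^-1 * D by rewrite mulrC ler_pdivlMr.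
    have q2 : h^-1 * D <= b (h + x) by rewrite mulrC ler_pdivrMr.
    by rewrite !(distrC (b x)) !ger0_norm ?subr_ge0 ?lerD2r// (le_trans q1).
  - have q1 : h^-1 * D <= b x by rewrite mulrC ler_ndivrMr.
    have q2 : b (h + x) <= h^-1 * D by rewrite mulrC ler_ndivlMr.
    by rewrite !ger0_norm ?subr_ge0 ?lerD2l ?lerN2// (le_trans q2).
split; first by apply/cvg_ex; exists (b x).
by apply/cvg_lim.
Qed.

Lemma continuous_pos_part (x : R) : {for x, continuous (fun u : R => Num.max u 0)}.
Proof. by apply: continuous_max; [exact: cvg_id|exact: contC]. Qed.

Lemma is_derive_pos_part2 (x : R) :
  is_derive x 1 (fun u => Num.max u 0 ^+ 2) (2 * Num.max x 0).
Proof.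
apply: (is_derive_tangent (b := fun u => 2 * Num.max u 0)).
  move=> y z; have [y0|y0] := leP y 0; have [z0|z0] := leP z 0.
  - by rewrite expr0n /=; lra.
  - by rewrite expr0n mulr0 mul0r addr0 sqr_ge0.
  - by rewrite expr0n /=; have := sqr_ge0 y; nra.
  - by have := sqr_ge0 (y - z); nra.
by apply: contM; [exact: contC|exact: continuous_pos_part].
Qed.

Lemma is_derive_pos_part3 (x : R) :
  is_derive x 1 (fun u => Num.max u 0 ^+ 3) (3 * Num.max x 0 ^+ 2).
Proof.
apply: (is_derive_tangent (b := fun u => 3 * Num.max u 0 ^+ 2)).
  move=> y z; have [y0|y0] := leP y 0; have [z0|z0] := leP z 0.
  - by rewrite !expr0n /=; lra.
  - by rewrite !expr0n mulr0 mul0r addr0 exprn_ge0// ltW.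
  - rewrite expr0n /= (_ : _ + _ = y ^+ 2 * (3 * z - 2 * y)); last by ring.
    rewrite pmulr_rle0 ?exprn_gt0//; lra.
  - rewrite -subr_ge0 (_ : _ - _ = (z - y) ^+ 2 * (z + 2 * y)); last by ring.
    by rewrite mulr_ge0 ?sqr_ge0//; lra.
have -> : (fun u : R => 3 * Num.max u 0 ^+ 2) = (fun u => 3 * (Num.max u 0 * Num.max u 0)).
  by apply/funext => u; rewrite expr2.
apply: contM; first exact: contC.
by apply: contM; exact: continuous_pos_part.
Qed.

End tangent.

Section cutoff.
Context {R : realType} {d : nat}.
Implicit Types (x y z e : 'rV[R]_d) (N : R).

Definition level N x : R := 1 - ln (1 + sqr_enorm x) / N.
(** As x varies, ln (1 + |x|^2) changes by a bounded amount when |x| doubles, so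
(1 + |x|) |grad| is of order 1 / N everywhere, which absorbs a drift of linear
growth. The cube of a positive part is twice continuously differentiable. *)
Definition cutoff N x : R := Num.max (level N x) 0 ^+ 3.
Definition dlevel N i x : R := - (2 / N) * (x ord0 i / (1 + sqr_enorm x)).
Definition ddlevel N i x : R :=
  - (2 / N) * ((1 + sqr_enorm x)^-1 - 2 * (x ord0 i / (1 + sqr_enorm x)) ^+ 2).
Definition dcutoff N i x : R := 3 * Num.max (level N x) 0 ^+ 2 * dlevel N i x.
Definition ddcutoff N i x : R :=
  6 * Num.max (level N x) 0 * dlevel N i x ^+ 2 + 3 * Num.max (level N x) 0 ^+ 2 * ddlevel N i x.

Let n1 x : 0 < 1 + sqr_enorm x.
Proof. by rewrite ltr_wpDr ?sqr_enorm_ge0. Qed.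

Let is_derive_n1 x i : is_derive x (unit_vec i) (fun x => 1 + @sqr_enorm R d x) (2 * x ord0 i).
Proof.
apply: is_derive_eq (is_deriveD_fun (is_derive_cst_fun _ _ _) (is_derive_sqr_enorm _ _)) _.
by rewrite add0r dotp_unit.
Qed.

Lemma is_derive_level N x i : is_derive x (unit_vec i) (level N) (dlevel N i x).
Proof.
have D1 := @is_derive_comp_scalar R _ (@ln R) (fun x => 1 + @sqr_enorm R d x) x (unit_vec i) _ _
  (is_derive1_ln (n1 x)) (is_derive_n1 x i).
have D2 := is_deriveB_fun (is_derive_cst_fun 1 x (unit_vec i))
   (is_deriveM_fun D1 (is_derive_cst_fun N^-1 x (unit_vec i))).
by apply: is_derive_eq D2 _; rewrite /dlevel; ring.
Qed.

Lemma is_derive_dlevel N x i : is_derive x (unit_vec i) (dlevel N i) (ddlevel N i x).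
Proof.
have D1 := is_deriveM_fun (is_derive_coord x (unit_vec i) i)
  (@is_deriveV_fun R _ (fun x => 1 + @sqr_enorm R d x) x (unit_vec i) _
    (lt0r_neq0 (n1 x)) (is_derive_n1 x i)).
apply: is_derive_eq (is_deriveZ_fun (- (2 / N)) D1) _.
rewrite mxE !eqxx mulr1 /ddlevel; congr (_ * _).
by field; exact: lt0r_neq0.
Qed.

Lemma is_derive_cutoff N x i : is_derive x (unit_vec i) (cutoff N) (dcutoff N i x).
Proof.
exact: (@is_derive_comp_scalar R _ (fun u => Num.max u 0 ^+ 3) (level N) x _ _ _
  (is_derive_pos_part3 _) (is_derive_level N x i)).
Qed.

Lemma is_derive_dcutoff N x i : is_derive x (unit_vec i) (dcutoff N i) (ddcutoff N i x).
Proof.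
have D1 := @is_derive_comp_scalar R _ (fun u => Num.max u 0 ^+ 2) (level N) x _ _ _
  (is_derive_pos_part2 _) (is_derive_level N x i).
apply: is_derive_eq (is_deriveM_fun (is_deriveZ_fun 3 D1) (is_derive_dlevel N x i)) _.
by rewrite /ddcutoff; ring.
Qed.

Let n1_continuous : continuous (fun x => 1 + @sqr_enorm R d x).
Proof. by move=> x; apply: contD; [exact: contC|exact: continuous_sqr_enorm]. Qed.

Let level_continuous N : continuous (level N).
Proof.
rewrite /level => x; apply: contB; first exact: contC.
apply: contM; last exact: contC.
by apply: (@continuous_comp _ _ _ (fun y => 1 + @sqr_enorm R d y) (@ln R)); [exact: n1_continuous|apply: continuous_ln; exact: n1].
Qed.

Let pos_level_continuous N : continuous (fun x => Num.max (level N x) 0).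
Proof.
by move=> x; apply: (@continuous_comp _ _ _ (level N) (fun u : R => Num.max u 0)); [exact: level_continuous|exact: continuous_pos_part].
Qed.

Lemma continuous_exprn (f : 'rV[R]_d -> R) n : continuous f -> continuous (fun x => f x ^+ n).
Proof.
move=> cf x; elim: n => [|n IH].
  have -> : (fun x => f x ^+ 0) = cst 1 by apply/funext => y; rewrite expr0.
  exact: contC.
have -> : (fun x => f x ^+ n.+1) = (fun x => f x * f x ^+ n) by apply/funext => y; rewrite exprS.
by apply: contM => //; exact: cf.
Qed.

Lemma cutoff_continuous N : continuous (cutoff N).
Proof. by apply: continuous_exprn; exact: pos_level_continuous. Qed.

Let ratio_continuous i : continuous (fun x => x ord0 i / (1 + @sqr_enorm R d x)).
Proof.
move=> x; apply: contM; first exact: continuous_coord.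
by apply: contV; [rewrite gt_eqF|exact: n1_continuous].
Qed.

Lemma dlevel_continuous N i : continuous (dlevel N i).
Proof. by rewrite /dlevel => x; apply: contM; [exact: contC|exact: ratio_continuous]. Qed.

Lemma ddlevel_continuous N i : continuous (ddlevel N i).
Proof.
rewrite /ddlevel => x; apply: contM; first exact: contC.
apply: contB; first by apply: contV; [rewrite gt_eqF|exact: n1_continuous].
apply: contM; first exact: contC.
by apply: continuous_exprn; exact: ratio_continuous.
Qed.

Lemma dcutoff_continuous N i : continuous (dcutoff N i).
Proof.
rewrite /dcutoff => x; apply: contM; last exact: dlevel_continuous.
apply: contM; first exact: contC.
by apply: continuous_exprn; exact: pos_level_continuous.
Qed.

Lemma ddcutoff_continuous N i : continuous (ddcutoff N i).
Proof.
rewrite /ddcutoff => x; apply: contD; apply: contM.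
- by apply: contM; [exact: contC|exact: pos_level_continuous].
- by apply: continuous_exprn; exact: dlevel_continuous.
- apply: contM; first exact: contC.
  by apply: continuous_exprn; exact: pos_level_continuous.
- exact: ddlevel_continuous.
Qed.

Lemma cutoff_ge0 N x : 0 <= cutoff N x.
Proof. by rewrite exprn_ge0// le_max lexx orbT. Qed.

Lemma pos_level_bounds N x : 0 < N -> 0 <= Num.max (level N x) 0 <= 1.
Proof.
move=> N0; rewrite le_max lexx orbT /= ge_max ler01 andbT /level.
by rewrite gerBl divr_ge0 ?(ltW N0)// ln_ge0// lerDl sqr_enorm_ge0.
Qed.

Lemma cutoff_le1 N x : 0 < N -> cutoff N x <= 1.
Proof. by move=> N0; have /andP[? ?] := pos_level_bounds x N0; rewrite exprn_ile1. Qed.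

Lemma level_le0 N x : 1 <= N -> ~ cube (expR N) x -> Num.max (level N x) 0 = 0.
Proof.
move=> N1 nx; apply/max_idPr; rewrite /level subr_le0.
have N0 : 0 < N by rewrite (lt_le_trans ltr01).
rewrite ler_pdivlMr// mul1r -[leLHS]expRK ler_ln ?posrE ?expR_gt0//.
have [i hi] : exists i, ~ `|x ord0 i| <= expR N by apply/existsNP => h; apply: nx => i; exact: h.
move/negP: hi; rewrite -ltNge => hi.
apply: le_trans (_ : x ord0 i ^+ 2 <= _); last by rewrite (le_trans (sqr_coord_le x i))// lerDr.
rewrite -(real_normK (num_real (x ord0 i))).
have e1 : 1 <= expR N by rewrite -expR0 ler_expR ltW.
rewrite (@le_trans _ _ (expR N ^+ 2))//.
  by rewrite expr2 ler_peMr// expR_ge0.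
by rewrite lerXn2r ?nnegrE ?expR_ge0// ltW.
Qed.

Lemma cutoff_ccont N : 1 <= N -> ccont (expR N) (cutoff N).
Proof.
move=> N1; split; first exact: cutoff_continuous.
by move=> x nx; rewrite /cutoff level_le0// expr0n.
Qed.

Lemma dcutoff_ccont N i : 1 <= N -> ccont (expR N) (dcutoff N i).
Proof.
move=> N1; split; first exact: dcutoff_continuous.
by move=> x nx; rewrite /dcutoff level_le0// expr0n mulr0 mul0r.
Qed.

Lemma ddcutoff_ccont N i : 1 <= N -> ccont (expR N) (ddcutoff N i).
Proof.
move=> N1; split; first exact: ddcutoff_continuous.
by move=> x nx; rewrite /ddcutoff level_le0// expr0n !mulr0 !mul0r addr0.
Qed.

Let ratio_le x i : `|x ord0 i / (1 + sqr_enorm x)| <= 2^-1.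
Proof.
rewrite normrM normfV (gtr0_norm (n1 x)) ler_pdivrMr//.
have := sqr_coord_le x i; rewrite -(real_normK (num_real (x ord0 i))).
set a := `|_| => ha; have := sqr_ge0 (a - 1); rewrite sqrrB; lra.
Qed.

Lemma ddcutoff_bound N x i : 1 <= N -> `|ddcutoff N i x| <= 18 / N.
Proof.
move=> N1; have N0 : 0 < N by rewrite (lt_le_trans ltr01).
have /andP[p0 p1] := pos_level_bounds x N0.
rewrite /ddcutoff; set p := Num.max _ _ in p0 p1 *.
have r1 := ratio_le x i; set q := _ / _ in r1.
have Ni0 : 0 < N^-1 by rewrite invr_gt0.
have Ni1 : N^-1 <= 1 by rewrite invf_le1.
have q2 : q ^+ 2 <= 2^-1.
  rewrite -(real_normK (num_real q)); have := normr_ge0 q; nra.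
have m0 : 0 < (1 + sqr_enorm x)^-1 by rewrite invr_gt0.
have m1 : (1 + sqr_enorm x)^-1 <= 1 by rewrite invf_le1// lerDl sqr_enorm_ge0.
have pp : p ^+ 2 <= 1 by rewrite exprn_ile1.
have q0 := sqr_ge0 q.
rewrite /ddlevel /dlevel -/q; set m := (1 + sqr_enorm x)^-1 in m0 m1 *.
apply: le_trans (ler_normD _ _) _.
have -> : 18 / N = 12 * N^-1 + 6 * N^-1 by ring.
rewrite lerD//.
  have -> : 6 * p * (- (2 / N) * q) ^+ 2 = 24 * ((p * q ^+ 2) * N^-1 ^+ 2) by ring.
  rewrite ger0_norm; last first.
    by apply: mulr_ge0 => //; apply: mulr_ge0; [exact: mulr_ge0|exact: sqr_ge0].
  have a1 : N^-1 ^+ 2 <= N^-1 by rewrite expr2 ler_piMl// ltW.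
  have a2 : p * q ^+ 2 <= 2^-1 by rewrite (le_trans (ler_piMl q0 p1)).
  have a3 : 0 <= p * q ^+ 2 by rewrite mulr_ge0.
  have a4 : (p * q ^+ 2) * N^-1 ^+ 2 <= 2^-1 * N^-1 by rewrite ler_pM// sqr_ge0.
  lra.
have -> : 3 * p ^+ 2 * (- (2 / N) * (m - 2 * q ^+ 2)) = - (6 * (N^-1 * (p ^+ 2 * (m - 2 * q ^+ 2)))) by ring.
rewrite normrN !normrM normr_nat (gtr0_norm Ni0) ler_pM2l// -[leRHS]mulr1 ler_pM2l//.
rewrite ger0_norm ?sqr_ge0// mulr_ile1 ?sqr_ge0//.
by rewrite ler_norml; apply/andP; split; lra.
Qed.

(** The gradient of the cutoff is a multiple of x / (1 + |x|^2), of order 1 / N,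
and [2 |s . x| <= |s|^2 + |x|^2]. *)
Lemma dcutoff_dot_bound N (s : 'rV[R]_d) C x : 1 <= N ->
  \sum_i s ord0 i ^+ 2 <= C * (1 + sqr_enorm x) ->
  `|\sum_i s ord0 i * dcutoff N i x| <= 3 * (C + 1) / N.
Proof.
move=> N1 hs; have N0 : 0 < N by rewrite (lt_le_trans ltr01).
have /andP[p0 p1] := pos_level_bounds x N0.
have -> : \sum_i s ord0 i * dcutoff N i x =
  - (Num.max (level N x) 0 ^+ 2 * (6 / N * ((\sum_i s ord0 i * x ord0 i) / (1 + sqr_enorm x)))).
  rewrite mulr_suml !mulr_sumr -sumrN; apply: eq_bigr => i _.
  by rewrite /dcutoff /dlevel; ring.
set p := Num.max _ _ in p0 p1 *.
have pp : p ^+ 2 <= 1 by rewrite exprn_ile1.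
rewrite normrN normrM (ger0_norm (sqr_ge0 p)) normrM (gtr0_norm (divr_gt0 _ N0))//
  normrM normfV (gtr0_norm (n1 x)).
have H : `|\sum_i s ord0 i * x ord0 i| <= (C + 1) / 2 * (1 + sqr_enorm x).
  apply: le_trans (ler_norm_sum _ _ _) _.
  apply: (@le_trans _ _ (\sum_i (s ord0 i ^+ 2 + x ord0 i ^+ 2) / 2)).
    apply: ler_sum => i _; rewrite normrM.
    rewrite -(real_normK (num_real (s ord0 i))) -(real_normK (num_real (x ord0 i))).
    by have := sqr_ge0 (`|s ord0 i| - `|x ord0 i|); rewrite sqrrB; lra.
  rewrite -mulr_suml big_split /=; have : \sum_i x ord0 i ^+ 2 = sqr_enorm x by [].
  by move=> ->; lra.
apply: (@le_trans _ _ (1 * (6 / N * ((C + 1) / 2)))).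
  have Q : `|\sum_i s ord0 i * x ord0 i| / (1 + sqr_enorm x) <= (C + 1) / 2 by rewrite ler_pdivrMr.
  have Q0 : 0 <= `|\sum_i s ord0 i * x ord0 i| / (1 + sqr_enorm x) by rewrite divr_ge0// ltW.
  have N6 : 0 <= 6 / N by rewrite divr_ge0// ltW.
  by apply: ler_pM => //; [exact: sqr_ge0|exact: mulr_ge0|exact: ler_wpM2l].
by rewrite le_eqVlt; apply/orP; left; apply/eqP; field; rewrite gt_eqF.
Qed.

Lemma cutoff_cvg x : cutoff n.+1%:R x @[n --> \oo] --> (1 : R).
Proof.
have H : level n.+1%:R x @[n --> \oo] --> (1 : R).
  rewrite /level -[X in _ --> X]subr0; apply: cvgB; first exact: cvg_cst.
  rewrite -(mulr0 (ln (1 + sqr_enorm x))); apply: cvgM; first exact: cvg_cst.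
  exact: cvg_harmonic.
have C : {for (1 : R), continuous (fun u : R => Num.max u 0 ^+ 3)}.
  have D := is_derive_pos_part3 1.
  by apply/differentiable_continuous/derivable1_diffP; exact: ex_derive.
have := cvg_comp _ _ H C.
by rewrite /= max_l// expr1n.
Qed.

End cutoff.

(** * A truncated power and a mollifier *)

Section truncated_power.
Context {R : realType}.
Implicit Types (p K a c w : R).

(** Young's inequality applied to a and c^(p-1). *)
Lemma powR_tangent p a c : 1 <= p -> 0 <= a -> 0 <= c ->
  c `^ p + p * c `^ (p - 1) * (a - c) <= a `^ p.
Proof.
move=> p1 a0 c0; have p0 : 0 < p by rewrite (lt_le_trans ltr01).
move: p1; rewrite le_eqVlt => /predU1P[<-|p1].
  by rewrite subrr powRr0 !powRr1//; lra.
have q0 : 0 < p / (p - 1) by rewrite divr_gt0// subr_gt0.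
have pn : p != 0 by rewrite gt_eqF.
have p1n : p - 1 != 0 by rewrite gt_eqF// subr_gt0.
have := @conjugate_powR R a (c `^ (p - 1)) p (p / (p - 1)) a0 (powR_ge0 _ _) p0 q0.
have -> : (c `^ (p - 1)) `^ (p / (p - 1)) = c `^ p by rewrite -powRrM mulrC divfK.
have -> : p^-1 + (p / (p - 1))^-1 = 1 by field; rewrite p1n pn.
move=> /(_ erefl) H.
rewrite -(mulr_powRB1 c0 p0); set C := c `^ (p - 1) in H *.
have cC : c `^ p = c * C by rewrite mulr_powRB1.
move: H; rewrite cC; set A := a `^ p => H.
have := ler_wpM2l (ltW p0) H.
rewrite (_ : p * (A / p + c * C / (p / (p - 1))) = A + (p - 1) * (c * C)).
  by move=> {}H; nra.
by field; rewrite p1n pn.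
Qed.

Definition clamp K w : R := Num.max 0 (Num.min w K).

(** The power w^p on [0, K], extended by its tangent lines at 0 and K: it is convex
with slope [dtrunc_pow], which is bounded. *)
Definition trunc_pow p K w : R :=
  clamp K w `^ p + p * clamp K w `^ (p - 1) * (w - clamp K w).

Definition dtrunc_pow p K w : R := p * clamp K w `^ (p - 1).

Lemma clamp_cases K w : 0 < K ->
  [\/ w <= 0 /\ clamp K w = 0, 0 <= w <= K /\ clamp K w = w | K <= w /\ clamp K w = K].
Proof.
move=> K0; rewrite /clamp; have [w0|w0] := leP w 0.
  by constructor 1; split => //; apply/max_idPl; rewrite ge_min w0.
have [wK|wK] := leP w K.
  by constructor 2; split; [rewrite (ltW w0)|apply/max_idPr; exact: ltW].
by constructor 3; split; [exact: ltW|apply/max_idPr; exact: ltW].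
Qed.

Lemma clamp_ge0 K w : 0 <= clamp K w.
Proof. by rewrite le_max lexx. Qed.

Lemma clamp_le K w : 0 < K -> clamp K w <= K.
Proof. by move=> K0; rewrite ge_max (ltW K0) ge_min lexx orbT. Qed.

Lemma powR_mono p a c : 1 <= p -> 0 <= a -> a <= c -> a `^ (p - 1) <= c `^ (p - 1).
Proof.
move=> p1 a0 ac; apply: ge0_ler_powR; rewrite ?subr_ge0 ?nnegrE//.
exact: le_trans ac.
Qed.

Lemma trunc_pow_tangent p K x y : 1 <= p -> 0 < K ->
  trunc_pow p K x + dtrunc_pow p K x * (y - x) <= trunc_pow p K y.
Proof.
move=> p1 K0; have p0 : 0 < p by rewrite (lt_le_trans ltr01).
have c0 := clamp_ge0 K x; have cK := clamp_le x K0.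
have -> : trunc_pow p K x + dtrunc_pow p K x * (y - x) =
    clamp K x `^ p + p * clamp K x `^ (p - 1) * (y - clamp K x).
  by rewrite /trunc_pow /dtrunc_pow; ring.
set c := clamp K x in c0 cK *; rewrite /trunc_pow.
have [[y0 ->]|[/andP[y0 yK] ->]|[yK ->]] := clamp_cases y K0.
- have h1 := powR_tangent p1 (lexx 0) c0.
  have h2 := powR_mono p1 (lexx 0) c0.
  have := ler_wpM2l (ltW p0) h2; rewrite subr0; nra.
- by rewrite subrr mulr0 addr0 powR_tangent.
- have h1 := powR_tangent p1 (ltW K0) c0.
  have h2 := powR_mono p1 c0 cK.
  have := ler_wpM2l (ltW p0) h2; nra.
Qed.

Lemma dtrunc_pow_ge0 p K w : 1 <= p -> 0 <= dtrunc_pow p K w.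
Proof. by move=> p1; rewrite mulr_ge0 ?powR_ge0// (le_trans ler01). Qed.

Lemma dtrunc_pow_le p K w : 1 <= p -> 0 < K -> dtrunc_pow p K w <= p * K `^ (p - 1).
Proof.
move=> p1 K0; rewrite ler_wpM2l ?(le_trans ler01)// powR_mono//.
  exact: clamp_ge0.
exact: clamp_le.
Qed.

Lemma trunc_pow0 p K : 1 <= p -> 0 < K -> trunc_pow p K 0 = 0.
Proof.
move=> p1 K0; rewrite /trunc_pow (_ : clamp K 0 = 0); last first.
  by apply/max_idPl; rewrite ge_min lexx.
by rewrite powR0 ?subrr ?mulr0 ?addr0// gt_eqF// (lt_le_trans ltr01).
Qed.

Lemma trunc_pow_ge0 p K w : 1 <= p -> 0 < K -> 0 <= w -> 0 <= trunc_pow p K w.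
Proof.
move=> p1 K0 w0; have := trunc_pow_tangent 0 w p1 K0.
by rewrite trunc_pow0// add0r subr0; apply: le_trans; rewrite mulr_ge0// dtrunc_pow_ge0.
Qed.

Lemma trunc_pow_le_linear p K w : 1 <= p -> 0 < K -> 0 <= w -> trunc_pow p K w <= p * K `^ (p - 1) * w.
Proof.
move=> p1 K0 w0; have := trunc_pow_tangent w 0 p1 K0.
rewrite trunc_pow0// sub0r mulrN subr_le0 => h; apply: le_trans h _.
by rewrite ler_wpM2r// dtrunc_pow_le.
Qed.

(** An equality between 0 and K; beyond K the right-hand side exceeds the other one by
(p - 1) times the positive number p K^(p-1) (w - K). *)
Lemma dtrunc_powM_le p K w : 1 <= p -> 0 < K -> 0 <= w -> dtrunc_pow p K w * w <= p * trunc_pow p K w.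
Proof.
move=> p1 K0 w0; have p0 : 0 < p by rewrite (lt_le_trans ltr01).
have pow c : 0 <= c -> c `^ p = c * c `^ (p - 1) by move=> c0; rewrite mulr_powRB1.
rewrite /dtrunc_pow /trunc_pow; have [[h ->]|[_ ->]|[h ->]] := clamp_cases w K0.
- have -> : w = 0 by apply/eqP; rewrite eq_le h w0.
  by rewrite mulr0 subr0 mulr0 addr0 mulr_ge0 ?powR_ge0// ltW.
- by rewrite subrr mulr0 addr0 (pow w)// [w * _]mulrC mulrA.
- rewrite (pow K) ?(ltW K0)//; have := powR_ge0 K (p - 1); set C := K `^ _ => C0.
  rewrite -mulrA ler_pM2l//.
  have : 0 <= C * ((p - 1) * (w - K)) by rewrite mulr_ge0// mulr_ge0 ?subr_ge0.
  lra.
Qed.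

Lemma trunc_pow_le_powR p K w : 1 <= p -> 0 < K -> 0 <= w -> trunc_pow p K w <= w `^ p.
Proof. by move=> p1 K0 w0; apply: powR_tangent => //; exact: clamp_ge0. Qed.

Lemma trunc_pow_eq_powR p K w : 0 < K -> 0 <= w <= K -> trunc_pow p K w = w `^ p.
Proof.
move=> K0 /andP[w0 wK]; rewrite /trunc_pow (_ : clamp K w = w) ?subrr ?mulr0 ?addr0//.
by rewrite /clamp min_l// max_r.
Qed.

Lemma dtrunc_pow_continuous p K : 1 <= p -> 0 < K -> continuous (dtrunc_pow p K).
Proof.
move=> p1 K0 w; apply: contM; first exact: contC.
have cc : {for w, continuous (clamp K)}.
  apply: continuous_max; first exact: cst_continuous.
  by apply: continuous_min; [exact: cvg_id|exact: cst_continuous].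
move: p1; rewrite le_eqVlt => /predU1P[<-|p1].
  under [X in continuous_at _ X]eq_fun do rewrite subrr powRr0.
  exact: contC.
have s0 : 0 < p - 1 by rewrite subr_gt0.
have [c0|c0] := ltP 0 (clamp K w).
  apply: (@cont_comp _ _ _ (clamp K) (fun a => a `^ (p - 1))) => //.
  have D := is_derive1_powR (p - 1) c0.
  by apply/differentiable_continuous/derivable1_diffP; exact: ex_derive.
have {}c0 : clamp K w = 0 by apply/eqP; rewrite eq_le c0 clamp_ge0.
apply/cvgrPdist_lt => e e0; rewrite c0 powR0 ?gt_eqF//.
have e1 : 0 < e `^ (p - 1)^-1 by rewrite powR_gt0.
have /cvgrPdist_lt/(_ _ e1) := cc; apply: filterS => x.
rewrite c0 !sub0r !normrN (ger0_norm (clamp_ge0 _ _)) (ger0_norm (powR_ge0 _ _)) => h.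
have -> : e = (e `^ (p - 1)^-1) `^ (p - 1) by rewrite -powRrM mulVf ?gt_eqF// powRr1// ltW.
by rewrite gt0_ltr_powR// ?nnegrE ?clamp_ge0// ltW.
Qed.

End truncated_power.

Section mollifier.
Context {R : realType} {d : nat}.
Local Notation lam := (@lebesgue_rV R d).

Lemma Rintegral_ccont_gt0 r (f : 'rV[R]_d -> R) (x : 'rV[R]_d) :
  ccont r f -> (forall y, 0 <= f y) -> 0 < f 0 -> 0 < \int[lam]_y f y.
Proof.
move=> cf f0 fx.
have intf := ccont_integrable cf.
have f20 : 0 < f 0 / 2 by rewrite divr_gt0.
have /cvgrPdist_lt/(_ _ f20) := cf.1 0.
move=> /nbhs_ballP[e /= e0 he].
have e20 : 0 < e / 2 by rewrite divr_gt0.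
have ce y : cube (e / 2) y -> f 0 / 2 <= f y.
  move=> cy; have : `|f 0 - f y| < f 0 / 2.
    apply: he; rewrite -ball_normE /ball_ /= sub0r normrN.
    by apply: le_lt_trans (normrV_le_cube (ltW e20) cy) _; rewrite ltr_pdivrMr// ltr_pMr// ltr1n.
  by rewrite ltr_norml => /andP[_ h]; lra.
apply: (@lt_le_trans _ _ (\int[lam]_(y in cube (e / 2)) f y)).
  apply: (@lt_le_trans _ _ (\int[lam]_(y in cube (e / 2)) (f 0 / 2))).
    rewrite Rintegral_cst; last exact: measurable_cube.
    rewrite mulr_gt0// (lebesgue_rV_cube d (ltW e20)) /=.
    by rewrite exprn_gt0// mulr2n addr_gt0.
  apply: le_Rintegral.
  - exact: measurable_cube.
  - by apply: continuous_integrable_cube => y; exact: cst_continuous.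
  - by apply: continuous_integrable_cube; case: cf.
  - exact: ce.
rewrite Rintegral_mkcond; apply: le_Rintegral => //.
- rewrite -restrict_EFin; apply/(integrable_mkcond _ (@measurable_cube R d _)).
  by apply: continuous_integrable_cube; case: cf.
- by move=> y _; rewrite patchE; case: ifPn.
Qed.

Definition moll_mass : R := \int[lam]_z cutoff 1 z.
Definition moll (z : 'rV[R]_d) : R := cutoff 1 z / moll_mass.
Definition dmoll i (z : 'rV[R]_d) : R := dcutoff 1 i z / moll_mass.

Lemma moll_mass_gt0 : 0 < moll_mass.
Proof.
apply: (Rintegral_ccont_gt0 0 (cutoff_ccont (lexx 1))); first exact: cutoff_ge0.
rewrite /cutoff /level (_ : sqr_enorm 0 = 0); last first.
  by rewrite /sqr_enorm big1// => i _; rewrite mxE expr0n.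
by rewrite addr0 ln1 mul0r subr0 max_l// expr1n.
Qed.

Lemma moll_ccont : ccont (expR 1) moll.
Proof.
have [cc c0] := @cutoff_ccont R d 1 (lexx 1).
split; last by move=> x /c0 h; rewrite /moll h mul0r.
by rewrite /moll => x; apply: contM; [exact: cc|exact: contC].
Qed.

Lemma dmoll_ccont i : ccont (expR 1) (dmoll i).
Proof.
have [cc c0] := @dcutoff_ccont R d 1 i (lexx 1).
split; last by move=> x /c0 h; rewrite /dmoll h mul0r.
by rewrite /dmoll => x; apply: contM; [exact: cc|exact: contC].
Qed.

Lemma moll_ge0 z : 0 <= moll z.
Proof. by rewrite divr_ge0 ?cutoff_ge0// ltW// moll_mass_gt0. Qed.

Lemma moll_int1 : \int[lam]_z moll z = 1.
Proof.
rewrite /moll RintegralZr//; first by rewrite divff// gt_eqF// moll_mass_gt0.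
exact: ccont_integrable (cutoff_ccont (lexx 1)).
Qed.

Lemma is_derive_moll z i : is_derive z (unit_vec i) moll (dmoll i z).
Proof.
have D := is_deriveM_fun (is_derive_cutoff 1 z i) (is_derive_cst_fun moll_mass^-1 z (unit_vec i)).
by apply: is_derive_eq D _; rewrite mulr0 add0r mulrC.
Qed.

End mollifier.

(** * Mollification in space *)

Section joint_continuity.
Context {R : realType} {d : nat}.
Implicit Types (g : 'rV[R]_d -> R -> R).

Lemma cont_at_space g x r : cont_at g x r -> continuous_at x (g ^~ r).
Proof.
move=> cg; apply: (@cont_comp _ _ _ (fun y : 'rV[R]_d => (y, r)) (fun q : 'rV[R]_d * R => g q.1 q.2)) => //.
by apply: continuous_pairing; [exact: cvg_id|exact: cst_continuous].
Qed.

Lemma cont_at_comp (P : topologicalType) g (f : P -> 'rV[R]_d) (h : P -> R) p :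
  cont_at g (f p) (h p) -> continuous_at p f -> continuous_at p h ->
  continuous_at p (fun q => g (f q) (h q)).
Proof.
move=> cg cf ch; apply: (@cont_comp _ _ _ (fun q => (f q, h q)) (fun q : 'rV[R]_d * R => g q.1 q.2)) => //.
exact: continuous_pairing.
Qed.

Lemma near_time_itv (x : 'rV[R]_d) (r u v : R) : u < r < v ->
  \forall q \near (x, r), u < (q : 'rV[R]_d * R).2 < v.
Proof.
move=> ruv.
have : (fun q : 'rV[R]_d * R => q.2) @ (x, r) --> r by exact: cvg_snd.
move=> h; apply: (h [set s | u < s < v]).
by have := @near_in_itvoo R u v r; apply; rewrite in_itv.
Qed.

End joint_continuity.

Section convolution.
Context {R : realType} {d : nat}.
Local Notation lam := (@lebesgue_rV R d).
Context (T rad : R) (k : 'rV[R]_d -> R) (ck : ccont rad k) (dl : R).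
Implicit Types (g : 'rV[R]_d -> R -> R) (f : 'rV[R]_d -> R).

(** The scale acts on the shift and not on the kernel, so that the formula also
makes sense at dl = 0, the point near which small scales are studied. *)
Definition dconv f (x : 'rV[R]_d) : R := \int[lam]_z (k z * f (x - dl *: z)).

Definition cont_before g := forall (x : 'rV[R]_d) (r : R), 0 < r < T -> cont_at g x r.

Lemma continuous_affine_sub (P : topologicalType) (f z : P -> 'rV[R]_d) p :
  continuous_at p f -> continuous_at p z ->
  continuous_at p (fun q => f q - dl *: z q).
Proof.
by move=> cf cz; apply: vcontB => //; apply: vcontZ => //; exact: contC.
Qed.

Lemma dconv_integrand_ccont f x : continuous f -> ccont rad (fun z => k z * f (x - dl *: z)).
Proof.
move=> cf; have [ck1 ck0] := ck; split; last by move=> z /ck0 ->; rewrite mul0r.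
move=> z; apply: contM; first exact: ck1.
apply: (@cont_comp _ _ _ (fun z : 'rV[R]_d => x - dl *: z) f); last exact: cf.
by apply: (@continuous_affine_sub 'rV[R]_d (fun=> x) id); [exact: cst_continuous|exact: cvg_id].
Qed.

Lemma dconv_integrable f x : continuous f ->
  lam.-integrable setT (EFin \o (fun z => k z * f (x - dl *: z))).
Proof. by move=> cf; apply: ccont_integrable; exact: dconv_integrand_ccont. Qed.

Lemma dconvD f f' x : continuous f -> continuous f' ->
  dconv (fun y => f y + f' y) x = dconv f x + dconv f' x.
Proof.
move=> cf cf'; rewrite /dconv -RintegralD//; [|exact: dconv_integrable..].
by apply: eq_Rintegral => z _; rewrite mulrDr.
Qed.

Lemma dconvZ c f x : continuous f -> dconv (fun y => c * f y) x = c * dconv f x.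
Proof.
move=> cf; rewrite /dconv -RintegralZl//; last exact: dconv_integrable.
by apply: eq_Rintegral => z _; rewrite mulrCA.
Qed.

Lemma dconv_sum (I : Type) (s : seq I) (f : I -> 'rV[R]_d -> R) x : (forall i, continuous (f i)) ->
  dconv (fun y => \sum_(i <- s) f i y) x = \sum_(i <- s) dconv (f i) x.
Proof.
move=> cf; elim: s => [|i s IH].
  rewrite big_nil /dconv; under eq_Rintegral do rewrite big_nil mulr0.
  by rewrite /Rintegral integral0.
rewrite big_cons -IH -dconvD//; last by move=> y; apply: continuous_sum_fun => j; exact: cf.
by congr dconv; apply/funext => y; rewrite big_cons.
Qed.

Lemma cont_before_space g r : cont_before g -> 0 < r < T -> continuous (g ^~ r).
Proof. by move=> cg rT x; apply: cont_at_space; exact: cg. Qed.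

Lemma dconv_cont_before g : cont_before g -> cont_before (fun x r => dconv (g ^~ r) x).
Proof.
move=> cg x r rT; have [ck1 _] := ck.
apply: (@cvg_integral_param R d ('rV[R]_d * R)%type
  (fun q z => k z * g (q.1 - dl *: z) q.2) (x, r) rad).
  apply: filterS (near_time_itv x rT) => q qT.
  by apply: (@dconv_integrand_ccont (g ^~ q.2)); exact: cont_before_space.
move=> z cz; apply: contM.
  by apply: (@cont_comp _ _ _ snd k); [exact: cvg_snd|exact: ck1].
apply: (@cont_at_comp _ _ _ g (fun q : 'rV[R]_d * R * 'rV[R]_d => q.1.1 - dl *: q.2) (fun q => q.1.2)).
- exact: cg.
- apply: (@continuous_affine_sub _ (fun q : 'rV[R]_d * R * 'rV[R]_d => q.1.1) snd); last exact: cvg_snd.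
  by apply: (@cont_comp _ _ _ fst fst); [exact: cvg_fst|exact: cvg_fst].
- by apply: (@cont_comp _ _ _ fst snd); [exact: cvg_fst|exact: cvg_snd].
Qed.

Lemma is_derive_dconv f f' x e : continuous f -> continuous f' ->
  (forall y, is_derive y e f (f' y)) -> is_derive x e (dconv f) (dconv f' x).
Proof.
move=> cf cf' df; have [ck1 _] := ck; apply: is_derive_line0.
have D := @is_derive_integral_param R d (fun h z => k z * f (x + h *: e - dl *: z))
  (fun h z => k z * f' (x + h *: e - dl *: z)) (-1) 1 0 rad.
have -> : dconv f' x = \int[lam]_z (k z * f' (x + 0 *: e - dl *: z)).
  by rewrite scale0r addr0.
apply: D.
- by rewrite in_itv /= ltrN10 ltr01.
- by move=> h _; exact: dconv_integrand_ccont.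
- move=> h z _.
  have E (h' : R) : x + h' *: e - dl *: z = x - dl *: z + h' *: e by rewrite addrAC.
  have -> : (fun h' : R => k z * f (x + h' *: e - dl *: z)) = (fun h' => k z * f (x - dl *: z + h' *: e)).
    by apply/funext => h'; rewrite E.
  by rewrite E; apply: is_deriveZ_fun; apply: is_derive_line; exact: df.
- move=> z; apply: contM.
    by apply: (@cont_comp _ _ _ snd k); [exact: cvg_snd|exact: ck1].
  apply: (@cont_comp _ _ _ (fun q : R * 'rV[R]_d => x + q.1 *: e - dl *: q.2) f'); last exact: cf'.
  apply: (@continuous_affine_sub _ (fun q : R * 'rV[R]_d => x + q.1 *: e) snd); last exact: cvg_snd.
  apply: vcontD; first exact: vcontC.
  by apply: vcontZ; [exact: cvg_fst|exact: vcontC].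
Qed.

Lemma is_derive_dconv_time g g' x r : cont_before g -> cont_before g' ->
  (forall y r, 0 < r < T -> is_derive r 1 (g y) (g' y r)) -> 0 < r < T ->
  is_derive r 1 (fun r => dconv (g ^~ r) x) (dconv (g' ^~ r) x).
Proof.
move=> cg cg' dg rT; have [ck1 _] := ck.
apply: (@is_derive_integral_param R d (fun r z => k z * g (x - dl *: z) r)
  (fun r z => k z * g' (x - dl *: z) r) 0 T r rad).
- by rewrite in_itv.
- move=> h; rewrite in_itv /= => hT.
  by apply: (@dconv_integrand_ccont (g ^~ h)); exact: cont_before_space.
- by move=> h z; rewrite in_itv /= => hT; apply: is_deriveZ_fun; exact: dg.
- move=> z; apply: contM.
    by apply: (@cont_comp _ _ _ snd k); [exact: cvg_snd|exact: ck1].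
  apply: (@cont_at_comp _ _ _ g' (fun q : R * 'rV[R]_d => x - dl *: q.2) fst).
  + exact: cg'.
  + by apply: (@continuous_affine_sub _ (fun=> x) snd); [exact: cst_continuous|exact: cvg_snd].
  + exact: cvg_fst.
Qed.

Lemma dconv_ge0 f x : (forall z, 0 <= k z) -> (forall y, 0 <= f y) -> 0 <= dconv f x.
Proof. by move=> k0 f0; apply: Rintegral_ge0 => z _; exact: mulr_ge0. Qed.

Lemma le_dconv_cst f c x : continuous f -> (forall z, 0 <= k z) ->
  (forall z, cube rad z -> `|f (x - dl *: z)| <= c) ->
  `|dconv f x| <= c * \int[lam]_z k z.
Proof.
move=> cf k0 fc.
rewrite (le_trans (le_normr_Rintegral _ _))//; first exact: dconv_integrable.
rewrite -RintegralZl//; last exact: (ccont_integrable ck).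
have cc := dconv_integrand_ccont x cf.
apply: le_Rintegral => //.
- apply: (@ccont_integrable R d rad); split.
    by move=> z; apply: cont_norm; case: cc => + _; exact.
  by move=> z /(proj2 cc) ->; rewrite normr0.
- apply: (@ccont_integrable R d rad); split.
    by move=> z; apply: contM; [exact: contC|case: ck => + _; exact].
  by move=> z /(proj2 ck) ->; rewrite mulr0.
- move=> z _; rewrite normrM (ger0_norm (k0 z)) mulrC.
  have [cz|/(proj2 ck) ->] := pselect (cube rad z); last by rewrite !mulr0.
  by rewrite ler_wpM2r// fc.
Qed.

Lemma dconv_total_mass f m : continuous f -> (forall z, 0 <= k z) -> (forall y, 0 <= f y) ->
  (\int[lam]_y (f y)%:E = m%:E)%E ->
  lam.-integrable setT (EFin \o dconv f) /\ \int[lam]_x dconv f x = \int[lam]_z k z * m.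
Proof.
move=> cf k0 f0 hm.
have mk : measurable_fun setT k by apply: continuous_measurable_rV; case: ck.
have mf : measurable_fun setT f by exact: continuous_measurable_rV.
have intk := ccont_integrable ck.
have cE x : (dconv f x)%:E = (\int[lam]_z (k z * f (x - dl *: z))%:E)%E.
  by rewrite /dconv /Rintegral fineK//; exact: integrable_fin_num (dconv_integrable x cf).
have H : (\int[lam]_x (dconv f x)%:E = ((\int[lam]_z k z) * m)%:E)%E.
  under eq_integral do rewrite cE.
  rewrite tonelli_conv// hm EFinM; congr (_ * _)%E.
  by rewrite /Rintegral fineK//; exact: integrable_fin_num.
split; last by rewrite /Rintegral H.
have cconv : continuous (dconv f).
  move=> x.
  have H0 : \forall y \near x, ccont rad (fun z => k z * f (y - dl *: z)).
    exact: (@filterE _ (nbhs x) (nbhs_filter x) _ (fun y => dconv_integrand_ccont y cf)).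
  apply: (@cvg_integral_param R d 'rV[R]_d (fun x z => k z * f (x - dl *: z)) x rad H0).
  move=> z _; have [ck1 _] := ck; apply: contM.
    by apply: (@cont_comp _ _ _ snd k); [exact: cvg_snd|exact: ck1].
  apply: (@cont_comp _ _ _ (fun q : 'rV[R]_d * 'rV[R]_d => q.1 - dl *: q.2) f); last exact: cf.
  by apply: (@continuous_affine_sub _ fst snd); [exact: cvg_fst|exact: cvg_snd].
apply/integrableP; split.
  by apply/measurable_EFinP; exact: continuous_measurable_rV.
under eq_integral do rewrite /= ger0_norm ?dconv_ge0//.
by rewrite H ltry.
Qed.

End convolution.

(** * Convex profiles at a fixed time *)

Section second_derivative_test.
Context {R : realType}.

Lemma second_derivative_min (G G' : R -> R) (c : R) :
  (forall h : R, h \in `](-1), 1[ -> is_derive h 1 G (G' h)) ->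
  is_derive (0 : R) 1 G' c ->
  (forall h : R, h \in `](-1), 1[ -> G 0 <= G h) -> 0 <= c.
Proof.
move=> dG dG' mG.
have i0 : (0 : R) \in `](-1), 1[ by rewrite in_itv /= ltrN10 ltr01.
have G'0 : G' 0 = 0.
  have dr (t : R) : t \in `](-1), 1[ -> derivable G t 1.
    by move=> t11; have dt := dG t t11; exact: ex_derive.
  have le11 : -1 <= 1 :> R by lra.
  exact: is_derive_unique (dG 0 i0) (derive1_at_min le11 dr i0 mG).
rewrite leNgt; apply/negP => c0.
have [D Dc] : derivable G' 0 1 /\ 'D_1 G' 0 = c by case: dG' => D E; split.
have cv : (fun h => h^-1 *: ((G' \o shift 0) (h *: (1 : R)) - G' 0)) @ 0^' --> c.
  by rewrite -Dc; exact: D.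
have c20 : 0 < - c / 2 by rewrite divr_gt0// oppr_gt0.
have /cvgrPdist_lt/(_ _ c20)[e /= e0 he] := cv.
pose h0 := Num.min (e / 2) (1 / 2).
have h00 : 0 < h0 by rewrite lt_min !divr_gt0.
have h01 : h0 < 1 by rewrite gt_min; apply/orP; right; lra.
have h0e : h0 < e by rewrite gt_min; apply/orP; left; lra.
have neg (h : R) : 0 < h < e -> G' h < 0.
  move=> /andP[hp hl]; have := he h; rewrite /ball /= sub0r normrN gtr0_norm//.
  move=> /(_ hl) /(_ (lt0r_neq0 hp)).
  rewrite /shift /= addr0 G'0 subr0 /GRing.scale /= mulr1 ltr_norml => /andP[h1 h2].
  have : h^-1 * G' h < 0 by lra.
  by rewrite pmulr_rlt0// invr_gt0.
have dG01 (x : R) : x \in `]0, h0[ -> is_derive x 1 G (G' x).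
  rewrite in_itv /= => /andP[x0 xh]; apply: dG; rewrite in_itv /=; apply/andP; split; lra.
have cG : {within `[0, h0], continuous G}.
  apply: derivable_within_continuous => x; rewrite in_itv /= => /andP[x0 xh].
  have xi : x \in `](-1), 1[ by rewrite in_itv /=; apply/andP; split; lra.
  by have dx := dG x xi; exact: ex_derive.
have [x] := MVT h00 dG01 cG; rewrite in_itv /= => /andP[x0 xh] E.
have hi : h0 \in `](-1), 1[ by rewrite in_itv /=; apply/andP; split; lra.
have := mG h0 hi; rewrite -subr_ge0 E subr0 pmulr_lge0//.
by rewrite leNgt neg// x0 /= (lt_trans xh).
Qed.

End second_derivative_test.

Section profile.
Context {R : realType}.

(** What the energy argument uses of f = w^p and of its derivative b. The bound L on
the slope makes integrals of f finite as soon as the mass is; the exponent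
enters through [cp_homog] only. *)
Record convex_profile (p L : R) (f b : R -> R) : Prop := {
  cp_tangent : forall x y, f x + b x * (y - x) <= f y;
  cp_cont : continuous b;
  cp_ge0 : forall w, 0 <= b w;
  cp_le : forall w, b w <= L;
  cp_zero : f 0 = 0;
  cp_homog : forall w, 0 <= w -> b w * w <= p * f w }.

Context (p L : R) (f b : R -> R) (cp : convex_profile p L f b).

Lemma cp_derive (w : R) : is_derive w 1 f (b w).
Proof. by apply: is_derive_tangent; [exact: cp_tangent cp|exact: cp_cont cp w]. Qed.

Lemma cp_continuous : continuous f.
Proof.
move=> w; have D := cp_derive w.
by apply/differentiable_continuous/derivable1_diffP; exact: ex_derive.
Qed.

Lemma cp_f_ge0 w : 0 <= w -> 0 <= f w.
Proof.
move=> w0; have := cp_tangent cp 0 w; rewrite (cp_zero cp) add0r subr0.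
by apply: le_trans; rewrite mulr_ge0// (cp_ge0 cp).
Qed.

Lemma cp_f_le w : 0 <= w -> f w <= L * w.
Proof.
move=> w0; have := cp_tangent cp w 0; rewrite (cp_zero cp) sub0r mulrN subr_le0.
by move=> /le_trans; apply; rewrite ler_wpM2r// (cp_le cp).
Qed.

Lemma cp_L_ge0 : 0 <= L.
Proof. exact: le_trans (cp_ge0 cp 0) (cp_le cp 0). Qed.

Lemma cp_gap_ge0 w : 0 <= b w * w - f w.
Proof. by have := cp_tangent cp w 0; rewrite (cp_zero cp); lra. Qed.

End profile.

Section fixed_time.
Context {R : realType} {d : nat}.
Local Notation lam := (@lebesgue_rV R d).
Context (p L : R) (f b : R -> R) (cp : convex_profile p L f b).
Implicit Types (W phi S : 'rV[R]_d -> R) (e : 'rV[R]_d).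

Lemma is_deriveNdir W x e c : is_derive x e W c -> is_derive x (- e) W (- c).
Proof.
move=> dW; apply: is_derive_line0.
have -> : (fun k : R => W (x + k *: - e)) = (fun k => W (x + k *: e)) \o -%R.
  by apply/funext => k /=; rewrite scalerN scaleNr.
have d0 : is_derive (- 0 : R) 1 (fun k => W (x + k *: e)) c.
  by apply: is_derive_line; rewrite oppr0 scale0r addr0.
have := is_derive1_comp d0 (is_deriveNid (0 : R) 1).
by rewrite mulrN1.
Qed.

Lemma continuous_cpW W : continuous W -> continuous (fun x => f (W x)).
Proof. by move=> cW x; apply: (@cont_comp _ _ _ W f) (cW x) _; exact: (cp_continuous cp). Qed.

Lemma continuous_cpbW W : continuous W -> continuous (fun x => b (W x)).
Proof. by move=> cW x; apply: (@cont_comp _ _ _ W b) (cW x) _; exact: (cp_cont cp). Qed.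

Lemma continuous_shift (h : R) e (g : 'rV[R]_d -> R) : continuous g ->
  continuous (fun x : 'rV[R]_d => g (x + h *: e)).
Proof.
move=> cg x; apply: (@cont_comp _ _ _ (fun x : 'rV[R]_d => x + h *: e) g) _ (cg _).
by apply: vcontD; [exact: cvg_id|exact: vcontC].
Qed.

Lemma continuous_shift2 e (g : 'rV[R]_d -> R) (q : R * 'rV[R]_d) : continuous g ->
  continuous_at q (fun q : R * 'rV[R]_d => g (q.2 + q.1 *: e)).
Proof.
move=> cg; apply: (@cont_comp _ _ _ (fun q : R * 'rV[R]_d => q.2 + q.1 *: e) g) _ (cg _).
apply: vcontD; first exact: cvg_snd.
by apply: vcontZ; [exact: cvg_fst|exact: vcontC].
Qed.

Lemma ccontMr r (phi g : 'rV[R]_d -> R) : ccont r phi -> continuous g -> ccont r (fun x => phi x * g x).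
Proof.
move=> [cphi phi0] cg; split; last by move=> x /phi0 ->; rewrite mul0r.
by move=> x; apply: contM; [exact: cphi|exact: cg].
Qed.

Lemma ccontB r (g g' : 'rV[R]_d -> R) : ccont r g -> ccont r g' -> ccont r (fun x => g x - g' x).
Proof.
move=> [cg g0] [cg' g0']; split; last by move=> x nx; rewrite g0// g0'// subrr.
by move=> x; apply: contB; [exact: cg|exact: cg'].
Qed.

Lemma shift_bound (h : R) e : h \in `](-1), 1[ -> `|h *: e| <= `|e|.
Proof.
by rewrite in_itv /= => /andP[h1 h2]; rewrite normrZ ler_piMl// ler_norml !ltW.
Qed.

(** f need not have a second derivative, so the two integrations by parts that the
smooth case suggests are replaced by a comparison. Let
[J h = int phi(x - h e) f(W(x))], which equals [int phi(x) f(W(x + h e))], and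
[K h = int phi(x) b(W(x)) W(x + h e)]. By the tangent inequality J - K has a minimum
at h = 0, so its second derivative there is nonnegative. *)
Lemma convex_second_derivative r e phi phi1 phi2 W W1 W2 :
  ccont r phi -> ccont r phi1 -> ccont r phi2 -> (forall x, 0 <= phi x) ->
  (forall x, is_derive x e phi (phi1 x)) -> (forall x, is_derive x e phi1 (phi2 x)) ->
  continuous W -> continuous W1 -> continuous W2 ->
  (forall x, is_derive x e W (W1 x)) -> (forall x, is_derive x e W1 (W2 x)) ->
  \int[lam]_x (phi x * b (W x) * W2 x) <= \int[lam]_x (phi2 x * f (W x)).
Proof.
move=> cphi cphi1 cphi2 phi0 dphi dphi1 cW cW1 cW2 dW dW1.
have cfW := continuous_cpW cW; have cbW := continuous_cpbW cW.
pose s := r + `|- e|.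
have i0 : (0 : R) \in `](-1), 1[ by rewrite in_itv /= ltrN10 ltr01.
pose J (h : R) := \int[lam]_x (phi (x + h *: - e) * f (W x)).
pose J' (h : R) := \int[lam]_x (- phi1 (x + h *: - e) * f (W x)).
pose K (h : R) := \int[lam]_x (phi x * b (W x) * W (x + h *: e)).
pose K' (h : R) := \int[lam]_x (phi x * b (W x) * W1 (x + h *: e)).
have ccb : ccont r (fun x => phi x * b (W x)) by exact: ccontMr.
have Ncc (h : R) g : h \in `](-1), 1[ -> ccont r g -> ccont s (fun x : 'rV[R]_d => - g (x + h *: - e)).
  move=> hi cg; have [c1 c0] := ccont_translate cg (shift_bound (- e) hi).
  by split=> [x|x /c0 ->]; [apply: contN; exact: c1|rewrite oppr0].
have dJ (h : R) : h \in `](-1), 1[ -> is_derive h 1 J (J' h).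
  move=> hi; apply: (@is_derive_integral_param R d (fun h x => phi (x + h *: - e) * f (W x))
     (fun h x => - phi1 (x + h *: - e) * f (W x)) (-1) 1 h s) => //.
  - by move=> k ki; apply: ccontMr => //; apply: ccont_translate => //; exact: shift_bound.
  - move=> k z _; have D := is_derive_line (is_deriveNdir (dphi (z + k *: - e))).
    apply: is_derive_eq (is_deriveM_fun D (is_derive_cst_fun (f (W z)) k 1)) _.
    by rewrite mulr0 add0r mulrC.
  - move=> z; apply: contM; first by apply: contN; apply: continuous_shift2; case: cphi1.
    by apply: (@cont_comp _ _ _ snd (fun x => f (W x))); [exact: cvg_snd|exact: cfW].
have dJ' : is_derive (0 : R) 1 J' (\int[lam]_x (phi2 x * f (W x))).
  have -> : \int[lam]_x (phi2 x * f (W x)) = \int[lam]_x (phi2 (x + 0 *: - e) * f (W x)).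
    by apply: eq_Rintegral => x _; rewrite scale0r addr0.
  apply: (@is_derive_integral_param R d (fun h x => - phi1 (x + h *: - e) * f (W x))
     (fun h x => phi2 (x + h *: - e) * f (W x)) (-1) 1 0 s) => //.
  - by move=> k ki; apply: ccontMr => //; exact: Ncc.
  - move=> k z _; have D := is_derive_line (is_deriveNdir (dphi1 (z + k *: - e))).
    apply: is_derive_eq (is_deriveM_fun (is_deriveN_fun D) (is_derive_cst_fun (f (W z)) k 1)) _.
    by rewrite opprK mulr0 add0r mulrC.
  - move=> z; apply: contM; first by apply: continuous_shift2; case: cphi2.
    by apply: (@cont_comp _ _ _ snd (fun x => f (W x))); [exact: cvg_snd|exact: cfW].
have dK (h : R) : h \in `](-1), 1[ -> is_derive h 1 K (K' h).
  move=> hi; apply: (@is_derive_integral_param R d (fun h x => phi x * b (W x) * W (x + h *: e))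
     (fun h x => phi x * b (W x) * W1 (x + h *: e)) (-1) 1 h r) => //.
  - by move=> k ki; apply: ccontMr => //; exact: continuous_shift.
  - by move=> k z _; apply: is_deriveZ_fun; apply: is_derive_line; exact: dW.
  - move=> z; apply: contM; last exact: continuous_shift2.
    by apply: (@cont_comp _ _ _ snd (fun x => phi x * b (W x))); [exact: cvg_snd|case: ccb].
have dK' : is_derive (0 : R) 1 K' (\int[lam]_x (phi x * b (W x) * W2 x)).
  have -> : \int[lam]_x (phi x * b (W x) * W2 x) = \int[lam]_x (phi x * b (W x) * W2 (x + 0 *: e)).
    by apply: eq_Rintegral => x _; rewrite scale0r addr0.
  apply: (@is_derive_integral_param R d (fun h x => phi x * b (W x) * W1 (x + h *: e))
     (fun h x => phi x * b (W x) * W2 (x + h *: e)) (-1) 1 0 r) => //.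
  - by move=> k ki; apply: ccontMr => //; exact: continuous_shift.
  - by move=> k z _; apply: is_deriveZ_fun; apply: is_derive_line; exact: dW1.
  - move=> z; apply: contM; last exact: continuous_shift2.
    by apply: (@cont_comp _ _ _ snd (fun x => phi x * b (W x))); [exact: cvg_snd|case: ccb].
rewrite -subr_ge0.
apply: (@second_derivative_min R (fun h => J h - K h) (fun h => J' h - K' h)).
  by move=> h hi; exact: (is_deriveB_fun (dJ h hi) (dK h hi)).
move=> h hi.
have JE (k : R) : k \in `](-1), 1[ -> J k = \int[lam]_x (phi x * f (W (x + k *: e))).
  move=> ki; rewrite -(Rintegral_translate (k *: - e)); last first.
    exact: (continuous_measurable_rV (proj1 (ccontMr cphi (@continuous_shift k e _ cfW)))).
  by apply: eq_Rintegral => x _; rewrite -addrA scalerN addNr addr0.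
have cfWh k : continuous (fun x : 'rV[R]_d => f (W (x + k *: e))) := @continuous_shift k e _ cfW.
have cK k : ccont r (fun x : 'rV[R]_d => phi x * b (W x) * W (x + k *: e)).
  by apply: ccontMr => //; exact: continuous_shift.
have cJ k : ccont r (fun x : 'rV[R]_d => phi x * f (W (x + k *: e))) by exact: ccontMr.
(* translating back, the difference J - K is an integral of the tangent gap *)
have main : K h - K 0 <= J h - J 0.
  rewrite !JE// /K -!RintegralB//; try exact: (ccont_integrable (cJ _)); try exact: (ccont_integrable (cK _)).
  apply: le_Rintegral => //.
  - exact: (ccont_integrable (ccontB (cK h) (cK 0))).
  - exact: (ccont_integrable (ccontB (cJ h) (cJ 0))).
  - move=> x _; rewrite !scale0r !addr0.
    have := ler_wpM2l (phi0 x) (cp_tangent cp (W x) (W (x + h *: e))).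
    by rewrite mulrDr; lra.
by move: main; lra.
Qed.

(** The integral of the derivative of phi S f(W) along e vanishes. *)
Lemma transport_identity r e phi phi1 W W1 S S1 :
  ccont r phi -> ccont r phi1 -> (forall x, is_derive x e phi (phi1 x)) ->
  continuous W -> continuous W1 -> (forall x, is_derive x e W (W1 x)) ->
  continuous S -> continuous S1 -> (forall x, is_derive x e S (S1 x)) ->
  \int[lam]_x (phi x * (b (W x) * (S x * W1 x))) =
  - (\int[lam]_x (phi x * (S1 x * f (W x)))) - (\int[lam]_x (phi1 x * (S x * f (W x)))).
Proof.
move=> cphi cphi1 dphi cW cW1 dW cS cS1 dS.
have cfW := continuous_cpW cW; have cbW := continuous_cpbW cW.
have c1 : continuous (fun x => b (W x) * (S x * W1 x)).
  by move=> x; apply: contM; [exact: cbW|apply: contM; [exact: cS|exact: cW1]].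
have c2 : continuous (fun x => S1 x * f (W x)).
  by move=> x; apply: contM; [exact: cS1|exact: cfW].
have c3 : continuous (fun x => S x * f (W x)).
  by move=> x; apply: contM; [exact: cS|exact: cfW].
have I1 := ccont_integrable (ccontMr cphi c1).
have I2 := ccont_integrable (ccontMr cphi c2).
have I3 := ccont_integrable (ccontMr cphi1 c3).
have D x : is_derive x e (fun x => phi x * (S x * f (W x)))
   ((phi x * (b (W x) * (S x * W1 x)) + phi x * (S1 x * f (W x))) + phi1 x * (S x * f (W x))).
  have DW := @is_derive_comp_scalar R _ f W x e _ _ (cp_derive cp (W x)) (dW x).
  apply: is_derive_eq (is_deriveM_fun (dphi x) (is_deriveM_fun (dS x) DW)) _.
  ring.
have cD : continuous (fun x => phi x * (b (W x) * (S x * W1 x)) + phi x * (S1 x * f (W x)) + phi1 x * (S x * f (W x))).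
  have [cp0 _] := cphi; have [cp1 _] := cphi1.
  move=> x; apply: contD; last by apply: contM; [exact: cp1|exact: c3].
  by apply: contD; apply: contM; [exact: cp0|exact: c1|exact: cp0|exact: c2].
have := Rintegral_derive0 (ccontMr cphi c3) D cD.
have I12 : lam.-integrable setT (EFin \o (fun x => phi x * (b (W x) * (S x * W1 x)) + phi x * (S1 x * f (W x)))).
  by have := integrableD measurableT I1 I2.
rewrite RintegralD// RintegralD//.
by move=> /eqP; rewrite -addrA addr_eq0 opprD => /eqP.
Qed.

End fixed_time.

(** * The equation and its commutator with mollification *)

Section evolution.
Context {R : realType} {d : nat}.
Local Notation lam := (@lebesgue_rV R d).

(** The properties of the score on which the rest relies. [rd_div] fixes the exponent
of the final estimate, [rd_growth] matches the cutoff, [rd_lip] controls the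
commutator up to the terminal time. *)
Record regular_drift (s : 'I_d -> 'rV[R]_d -> R -> R) (ds : 'I_d -> 'I_d -> 'rV[R]_d -> R -> R) : Prop := {
  rd_derive : forall x r i j, 0 < r -> is_derive x (unit_vec j) (fun y => s i y r) (ds j i x r);
  rd_cont : forall i x r, 0 < r -> cont_at (s i) x r;
  rd_dcont : forall j i x r, 0 < r -> cont_at (ds j i) x r;
  rd_div : forall x r, 0 < r -> - (d%:R / 2) / r <= \sum_i ds i i x r;
  rd_growth : forall t, 0 < t -> exists2 C, 0 <= C & forall x r, t <= r ->
    \sum_i s i x r ^+ 2 <= C * (1 + sqr_enorm x);
  rd_lip : forall t T rad, 0 < t -> exists2 L, 0 <= L &
    forall x y r i, t <= r <= T -> cube rad x -> cube rad y ->
      `|s i y r - s i x r| <= L * `|y - x| }.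

(** The derivatives wt and wx and the diffusion term ell are parameters, so that
each is a function with its own continuity. For eps = 0 the density need not
have second derivatives, hence the alternative in [cs_lap]. *)
Record classical_solution (T eps : R) (s : 'I_d -> 'rV[R]_d -> R -> R)
    (ds : 'I_d -> 'I_d -> 'rV[R]_d -> R -> R)
    (w wt ell : 'rV[R]_d -> R -> R) (wx : 'I_d -> 'rV[R]_d -> R -> R) : Prop := {
  cs_ge0 : forall x r, 0 < r < T -> 0 <= w x r;
  cs_cont : cont_before T w;
  cs_tcont : cont_before T wt;
  cs_xcont : forall i, cont_before T (wx i);
  cs_lcont : cont_before T ell;
  cs_dt : forall x r, 0 < r < T -> is_derive r 1 (w x) (wt x r);
  cs_dx : forall i x r, 0 < r < T -> is_derive x (unit_vec i) (w ^~ r) (wx i x r);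
  cs_lap : (forall x r, 0 < r < T -> ell x r = 0) \/
    exists wxx : 'I_d -> 'rV[R]_d -> R -> R,
    [/\ forall i, cont_before T (wxx i),
        forall i x r, 0 < r < T -> is_derive x (unit_vec i) (wx i ^~ r) (wxx i x r) &
        forall x r, 0 < r < T -> ell x r = eps * \sum_i wxx i x r];
  cs_eq : forall x r, 0 < r < T ->
    wt x r = - ell x r + (1 + eps) * \sum_i (s i x r * wx i x r + ds i i x r * w x r) }.

Arguments cs_xcont {T eps s ds w wt ell wx} c i.

Context (T eps : R) (s : 'I_d -> 'rV[R]_d -> R -> R) (ds : 'I_d -> 'I_d -> 'rV[R]_d -> R -> R).
Context (w wt ell : 'rV[R]_d -> R -> R) (wx : 'I_d -> 'rV[R]_d -> R -> R).
Context (rd : regular_drift s ds) (cs : classical_solution T eps s ds w wt ell wx).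

Local Notation mollify dl g := (dconv (@moll R d) dl g).

Definition transport (x : 'rV[R]_d) (r : R) : R := \sum_i (s i x r * wx i x r + ds i i x r * w x r).

Definition commutator (dl : R) (x : 'rV[R]_d) (r : R) : R :=
  mollify dl (transport ^~ r) x -
  \sum_i (s i x r * mollify dl (wx i ^~ r) x + ds i i x r * mollify dl (w ^~ r) x).

(** The integrand of the commutator, with y the shifted point. *)
Definition increment (x y : 'rV[R]_d) (r : R) : R :=
  \sum_i ((s i y r - s i x r) * wx i y r + (ds i i y r - ds i i x r) * w y r).

Lemma s_continuous i r : 0 < r -> continuous (s i ^~ r).
Proof. by move=> r0 x; apply: cont_at_space; exact: (rd_cont rd). Qed.

Lemma ds_continuous i j r : 0 < r -> continuous (ds i j ^~ r).
Proof. by move=> r0 x; apply: cont_at_space; exact: (rd_dcont rd). Qed.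

Lemma w_continuous r : 0 < r < T -> continuous (w ^~ r).
Proof. by move=> rT; exact: (cont_before_space (cs_cont cs) rT). Qed.

Lemma wx_continuous i r : 0 < r < T -> continuous (wx i ^~ r).
Proof. by move=> rT; exact: (cont_before_space (cs_xcont cs i) rT). Qed.

Lemma transport_continuous r : 0 < r < T -> continuous (transport ^~ r).
Proof.
move=> rT x; have r0 : 0 < r by case/andP: rT.
apply: continuous_sum_fun => i; apply: contD; apply: contM.
- exact: s_continuous.
- exact: wx_continuous.
- exact: ds_continuous.
- exact: w_continuous.
Qed.

Lemma increment_continuous x r : 0 < r < T -> continuous ((increment x) ^~ r).
Proof.
move=> rT y; have r0 : 0 < r by case/andP: rT.
apply: continuous_sum_fun => i; apply: contD; apply: contM.
- by apply: contB; [exact: s_continuous|exact: contC].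
- exact: wx_continuous.
- by apply: contB; [exact: ds_continuous|exact: contC].
- exact: w_continuous.
Qed.

Lemma commutatorE dl x r : 0 < r < T ->
  commutator dl x r = mollify dl ((increment x) ^~ r) x.
Proof.
move=> rT; have bc := @moll_ccont R d.
rewrite /commutator.
have c1 (i : 'I_d) : continuous (fun y => s i x r * wx i y r + ds i i x r * w y r).
  move=> y; apply: contD; apply: contM; [exact: contC|exact: wx_continuous|exact: contC|exact: w_continuous].
have -> : \sum_i (s i x r * mollify dl (wx i ^~ r) x + ds i i x r * mollify dl (w ^~ r) x) =
   mollify dl (fun y => \sum_i (s i x r * wx i y r + ds i i x r * w y r)) x.
  rewrite (dconv_sum bc)//; apply: eq_bigr => i _.
  rewrite (dconvD bc) ?(dconvZ bc)//.
  - exact: w_continuous.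
  - exact: wx_continuous.
  - by move=> y; apply: contM; [exact: contC|exact: wx_continuous].
  - by move=> y; apply: contM; [exact: contC|exact: w_continuous].
apply/eqP; rewrite subr_eq -(dconvD bc); last 2 first.
- exact: increment_continuous.
- by move=> y; apply: continuous_sum_fun => i; exact: c1.
apply/eqP; congr (dconv _ _ _ _); apply/funext => y.
by rewrite /transport /increment -big_split /=; apply: eq_bigr => i _; ring.
Qed.

(** At dl = 0 the increment compares a point with itself and vanishes; it is jointly
continuous, so [near_uniform] applies on a compact set of (x, r, z). *)
Lemma commutator_small t t1 rad e : 0 < t -> t1 < T -> 0 < e ->
  \forall dl \near (0 : R), forall x r, cube rad x -> t <= r <= t1 -> `|commutator dl x r| <= e.
Proof.
move=> t0 t1T e0.
pose F (dl : R) (q : 'rV[R]_d * R * 'rV[R]_d) := increment q.1.1 (q.1.1 - dl *: q.2) q.1.2.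
pose K := (@cube R d rad `*` `[t, t1]%classic) `*` @cube R d (expR 1).
have cK : compact K.
  apply: compact_setX; last exact: compact_cube.
  by apply: compact_setX; [exact: compact_cube|exact: segment_compact].
have time_ok r : t <= r <= t1 -> 0 < r < T.
  by move=> /andP[h1 h2]; rewrite (lt_le_trans t0 h1) (le_lt_trans h2 t1T).
have cF z : K z -> {for (0, z), continuous (fun q : R * ('rV[R]_d * R * 'rV[R]_d) => F q.1 q.2)}.
  move: z => [[x r] z] [[/= cx]]; rewrite in_itv /= => /time_ok rT cz.
  have r0 : 0 < r by case/andP: rT.
  pose Q := (R * ('rV[R]_d * R * 'rV[R]_d))%type.
  have cX : continuous_at (0, (x, r, z)) (fun q : Q => q.2.1.1).
    by apply: (@cont_comp _ _ _ (fun q : Q => q.2.1) fst); [apply: (@cont_comp _ _ _ snd fst); [exact: cvg_snd|exact: cvg_fst]|exact: cvg_fst].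
  have cR : continuous_at (0, (x, r, z)) (fun q : Q => q.2.1.2).
    by apply: (@cont_comp _ _ _ (fun q : Q => q.2.1) snd); [apply: (@cont_comp _ _ _ snd fst); [exact: cvg_snd|exact: cvg_fst]|exact: cvg_snd].
  have cZ : continuous_at (0, (x, r, z)) (fun q : Q => q.2.2).
    by apply: (@cont_comp _ _ _ snd snd); [exact: cvg_snd|exact: cvg_snd].
  have cY : continuous_at (0, (x, r, z)) (fun q : Q => q.2.1.1 - q.1 *: q.2.2).
    by apply: vcontB => //; apply: vcontZ => //; exact: cvg_fst.
  apply: continuous_sum_fun => i; apply: contD; apply: contM.
  - apply: contB; apply: cont_at_comp => //; exact: (rd_cont rd).
  - by apply: cont_at_comp => //; exact: (cs_xcont cs).
  - apply: contB; apply: cont_at_comp => //; exact: (rd_dcont rd).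
  - by apply: cont_at_comp => //; exact: (cs_cont cs).
have := near_uniform cK cF e0; apply: filterS => dl H x r cx rt.
have rT := time_ok _ rt.
rewrite commutatorE// -[e]mulr1 -(@moll_int1 R d).
apply: (le_dconv_cst (@moll_ccont R d)) => //.
- exact: increment_continuous.
- exact: moll_ge0.
move=> z cz; have Kz : K (x, r, z) by split => //; split => //=; rewrite in_itv.
have := H _ Kz; rewrite /F /= scale0r subr0.
have -> : increment x x r = 0.
  by rewrite /increment big1// => i _; rewrite !subrr !mul0r addr0.
by rewrite subr0 => /ltW.
Qed.

(** Moves the derivative from w to the kernel: near the terminal time nothing is
known about the size of the derivatives of w. The factor 1 / dl is compensated
by the increment of the drift. *)
Lemma mollify_by_parts dl x r i : 0 < dl -> 0 < r < T ->
  mollify dl (fun y => (s i y r - s i x r) * wx i y r + ds i i y r * w y r) x =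
  dl^-1 * dconv (@dmoll R d i) dl (fun y => (s i y r - s i x r) * w y r) x.
Proof.
move=> dl0 rT; have r0 : 0 < r by case/andP: rT.
pose h y := (s i y r - s i x r) * w y r.
pose h' y := (s i y r - s i x r) * wx i y r + ds i i y r * w y r.
have ch : continuous h.
  by move=> y; apply: contM; [apply: contB; [exact: s_continuous|exact: contC]|exact: w_continuous].
have ch' : continuous h'.
  move=> y; apply: contD; apply: contM.
  - by apply: contB; [exact: s_continuous|exact: contC].
  - exact: wx_continuous.
  - exact: ds_continuous.
  - exact: w_continuous.
have dh y : is_derive y (unit_vec i) h (h' y).
  have D := is_deriveM_fun (is_deriveB_fun (rd_derive rd y i i r0) (is_derive_cst_fun (s i x r) _ _)) (cs_dx cs i y rT).
  by apply: is_derive_eq D _; rewrite /h' subr0; ring.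
have dc z : is_derive z (unit_vec i) (fun z => h (x - dl *: z)) (- dl * h' (x - dl *: z)).
  apply: is_derive_line0.
  have -> : (fun k : R => h (x - dl *: (z + k *: unit_vec i))) =
    (fun k => h (x - dl *: z + k *: unit_vec i)) \o (fun k => - dl * k).
    by apply/funext => k /=; rewrite scalerDr opprD addrA scalerA mulNr scaleNr.
  have d0 : is_derive (- dl * 0 : R) 1 (fun k => h (x - dl *: z + k *: unit_vec i)) (h' (x - dl *: z)).
    by apply: is_derive_line; rewrite mulr0 scale0r addr0.
  have := is_derive1_comp d0 (is_deriveZ_fun (- dl) (is_derive_id (0 : R) 1)).
  by rewrite mulr1 mulrC.
have D z : is_derive z (unit_vec i) (fun z => moll z * h (x - dl *: z))
   (- dl * (moll z * h' (x - dl *: z)) + dmoll i z * h (x - dl *: z)).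
  apply: is_derive_eq (is_deriveM_fun (is_derive_moll z i) (dc z)) _.
  ring.
have c1 := dconv_integrand_ccont (@moll_ccont R d) dl x ch.
have c2 := dconv_integrand_ccont (@moll_ccont R d) dl x ch'.
have c3 := dconv_integrand_ccont (@dmoll_ccont R d i) dl x ch.
have I2 := ccont_integrable c2; have I3 := ccont_integrable c3.
have I2' : lam.-integrable setT (EFin \o (fun z => - dl * (moll z * h' (x - dl *: z)))).
  by have := @integrableZl _ _ _ lam setT measurableT (- dl) _ I2.
have cD : continuous (fun z => - dl * (moll z * h' (x - dl *: z)) + dmoll i z * h (x - dl *: z)).
  move=> z; apply: contD; last exact: (proj1 c3).
  by apply: contM; [exact: contC|exact: (proj1 c2)].
have := Rintegral_derive0 c1 D cD.
rewrite RintegralD// RintegralZl// -/(dconv _ _ _ _) -/(dconv _ _ _ _) => /eqP.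
rewrite addrC addr_eq0 => /eqP E.
by rewrite -/h -/h' E mulNr opprK mulrA mulVf ?mul1r// gt_eqF.
Qed.

(** The drift is Lipschitz and the shift has length at most [e dl], so the bound
obtained from [mollify_by_parts] is uniform in dl and involves only w. *)
Lemma commutator_pointwise t rad : 0 < t -> exists2 M, 0 <= M &
  forall dl x r, 0 < dl <= 1 -> cube rad x -> t <= r -> r < T ->
  `|commutator dl x r| <= M * (\sum_i dconv (fun z => `|@dmoll R d i z|) dl (w ^~ r) x +
     mollify dl (w ^~ r) x).
Proof.
move=> t0; set e1 := expR 1 : R.
have [L L0 hL] := rd_lip rd T (rad + e1) t0.
pose B (q : 'rV[R]_d * R) := \sum_i ds i i q.1 q.2.
have [x r /andP[tr _]|D D0 hD] := @joint_bounded R d B rad t T.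
  apply: continuous_sum_fun => i.
  by apply: (rd_dcont rd); rewrite (lt_le_trans t0).
(* L e1 comes from the increment of the drift, D from its divergence at x *)
exists (L * e1 + D); first by rewrite addr_ge0// mulr_ge0// expR_ge0.
move=> dl x r /andP[dl0 dl1] cx tr rT'.
have r0 : 0 < r by rewrite (lt_le_trans t0).
have rT : 0 < r < T by rewrite r0.
have trT : t <= r <= T by rewrite tr ltW.
have cw := w_continuous rT.
have bc := @moll_ccont R d.
have ch i : continuous (fun y => (s i y r - s i x r) * w y r).
  by move=> y; apply: contM; [apply: contB; [exact: s_continuous|exact: contC]|exact: w_continuous].
have ch' i : continuous (fun y => (s i y r - s i x r) * wx i y r + ds i i y r * w y r).
  move=> y; apply: contD; apply: contM.
  - by apply: contB; [exact: s_continuous|exact: contC].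
  - exact: wx_continuous.
  - exact: ds_continuous.
  - exact: w_continuous.
have E : commutator dl x r =
   \sum_i dl^-1 * dconv (@dmoll R d i) dl (fun y => (s i y r - s i x r) * w y r) x
   - B (x, r) * mollify dl (w ^~ r) x.
  rewrite commutatorE//.
  have -> : increment x ^~ r = (fun y => (\sum_i ((s i y r - s i x r) * wx i y r + ds i i y r * w y r)) + (- B (x, r)) * w y r).
    apply/funext => y; rewrite /increment /B mulNr mulr_suml -sumrB.
    by apply: eq_bigr => i _; ring.
  rewrite (dconvD bc); last 2 first.
  - by move=> y; apply: continuous_sum_fun => i; exact: ch'.
  - by move=> y; apply: contM; [exact: contC|exact: cw].
  rewrite (dconvZ bc)// (dconv_sum bc)// mulNr; congr (_ - _).
  by apply: eq_bigr => i _; exact: mollify_by_parts.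
have W0 : 0 <= mollify dl (w ^~ r) x.
  by apply: dconv_ge0 => [z|y]; [exact: moll_ge0|exact: (cs_ge0 cs)].
have A0 i : 0 <= dconv (fun z => `|@dmoll R d i z|) dl (w ^~ r) x.
  by apply: dconv_ge0 => [//|y]; exact: (cs_ge0 cs).
have h1 i : `|dl^-1 * dconv (@dmoll R d i) dl (fun y => (s i y r - s i x r) * w y r) x| <=
    L * e1 * dconv (fun z => `|@dmoll R d i z|) dl (w ^~ r) x.
  have cdn : ccont e1 (fun z => `|@dmoll R d i z|).
    have [c1 c0] := @dmoll_ccont R d i.
    by split=> [z|z /c0 ->]; [apply: cont_norm; exact: c1|rewrite normr0].
  have ci := dconv_integrand_ccont (@dmoll_ccont R d i) dl x (ch i).
  rewrite normrM normfV (gtr0_norm dl0) ler_pdivrMl//.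
  rewrite (le_trans (le_normr_Rintegral _ _))//; first exact: ccont_integrable ci.
  rewrite mulrA -RintegralZl//; last exact: dconv_integrable cdn _ _ _ cw.
  have ci' := dconv_integrand_ccont cdn dl x cw.
  apply: le_Rintegral => //.
  - apply: (@ccont_integrable R d e1); split.
      by move=> z; apply: cont_norm; exact: (proj1 ci).
    by move=> z /(proj2 ci) ->; rewrite normr0.
  - apply: (@ccont_integrable R d e1); split.
      by move=> z; apply: contM; [exact: contC|exact: (proj1 ci')].
    by move=> z /(proj2 ci') ->; rewrite mulr0.
  move=> z _; have [cz|nz] := pselect (cube e1 z); last first.
    by rewrite (proj2 (@dmoll_ccont R d i) z nz) normr0 !mul0r normr0 mulr0.
  have wz0 : 0 <= w (x - dl *: z) r by exact: (cs_ge0 cs).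
  rewrite normrM [X in _ * X <= _]normrM (ger0_norm wz0).
  have zn : `|dl *: z| <= dl * e1.
    rewrite normrZ gtr0_norm// ler_pM2l//.
    by apply: normrV_le_cube => //; exact: expR_ge0.
  have cy : cube (rad + e1) (x - dl *: z).
    move=> k; rewrite !mxE; apply: le_trans (ler_normB _ _) _; apply: lerD; first exact: cx.
    rewrite normrM (gtr0_norm dl0) (le_trans _ (cz k))// ler_piMl//.
  have cx' : cube (rad + e1) x by apply: cube_le cx; rewrite lerDl expR_ge0.
  have := hL x (x - dl *: z) r i trT cx' cy.
  rewrite addrAC subrr add0r normrN => Lz.
  have {}Lz : `|s i (x - dl *: z) r - s i x r| <= dl * (L * e1).
    by apply: le_trans Lz _; rewrite mulrCA ler_wpM2l.
  have := ler_wpM2r (mulr_ge0 (normr_ge0 (@dmoll R d i z)) wz0) Lz.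
  by congr (_ <= _); ring.
rewrite E; apply: le_trans (ler_normB _ _) _.
rewrite mulrDr lerD//.
  apply: le_trans (ler_norm_sum _ _ _) _; rewrite mulr_sumr; apply: ler_sum => i _.
  by apply: le_trans (h1 i) _; rewrite ler_wpM2r// lerDl.
rewrite normrM (ger0_norm W0) ler_wpM2r//.
by rewrite (le_trans (hD _ _ cx trT))// lerDr mulr_ge0// expR_ge0.
Qed.

Lemma commutator_continuous dl r : 0 < r < T -> continuous (commutator dl ^~ r).
Proof.
move=> rT x; have r0 : 0 < r by case/andP: rT.
have bc := @moll_ccont R d.
have cc g : cont_before T g -> continuous_at x (mollify dl (g ^~ r)).
  by move=> cg; exact: (cont_at_space (@dconv_cont_before R d T (expR 1) (@moll R d) bc dl g cg x r rT)).
apply: contB.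
  apply: (cc transport) => y t tT; have t0 : 0 < t by case/andP: tT.
  rewrite /cont_at /transport; apply: continuous_sum_fun => i; apply: contD; apply: contM.
  - exact: (rd_cont rd).
  - exact: (cs_xcont cs).
  - exact: (rd_dcont rd).
  - exact: (cs_cont cs).
apply: continuous_sum_fun => i; apply: contD; apply: contM.
- exact: s_continuous.
- exact: (cc (wx i) (cs_xcont cs i)).
- exact: ds_continuous.
- exact: (cc w (cs_cont cs)).
Qed.

(** The right-hand side of [commutator_pointwise] consists of convolutions of w,
whose integrals are constants times the mass of w. *)
Lemma commutator_L1 t rad : 0 < t -> exists2 M, 0 <= M &
  forall dl r m (phi : 'rV[R]_d -> R), 0 < dl <= 1 -> t <= r -> r < T ->
  (\int[lam]_y (w y r)%:E = m%:E)%E -> ccont rad phi -> (forall x, 0 <= phi x <= 1) ->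
  \int[lam]_x (phi x * `|commutator dl x r|) <= M * m.
Proof.
move=> t0; have [M M0 hM] := @commutator_pointwise t rad t0.
have bc := @moll_ccont R d.
have cdn i : ccont (expR 1) (fun z => `|@dmoll R d i z|).
  have [c1 c0] := @dmoll_ccont R d i.
  by split=> [z|z /c0 ->]; [apply: cont_norm; exact: c1|rewrite normr0].
exists (M * (\sum_i \int[lam]_z `|@dmoll R d i z| + 1)).
  by rewrite mulr_ge0// addr_ge0// sumr_ge0// => i _; exact: Rintegral_ge0.
move=> dl r m phi dlb tr rT' wm cphi phib.
have r0 : 0 < r by rewrite (lt_le_trans t0).
have rT : 0 < r < T by rewrite r0.
have cw := w_continuous rT.
have w0 y : 0 <= w y r by exact: (cs_ge0 cs).
have [I1 E1] := dconv_total_mass bc dl cw (@moll_ge0 R d) w0 wm.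
have IE i := dconv_total_mass (cdn i) dl cw (fun z => normr_ge0 _) w0 wm.
pose H (x : 'rV[R]_d) := \sum_i dconv (fun z => `|@dmoll R d i z|) dl (w ^~ r) x.
have [I2 E2] : lam.-integrable setT (EFin \o H) /\ \int[lam]_x H x = \sum_i \int[lam]_z `|@dmoll R d i z| * m.
  rewrite /H; elim: (index_enum _) => [|i l [IH1 IH2]].
    split.
      rewrite (_ : EFin \o _ = (fun=> 0%E)); first exact: integrable0.
      by apply/funext => x; rewrite /= big_nil.
    under eq_Rintegral do rewrite big_nil.
    by rewrite big_nil /Rintegral integral0.
  split.
    rewrite (_ : EFin \o _ = ((EFin \o (dconv (fun z => `|@dmoll R d i z|) dl (w ^~ r))%R) \+
      (EFin \o (fun x => (\sum_(j <- l) dconv (fun z => `|@dmoll R d j z|) dl (w ^~ r) x)%R)))%E).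
      exact: (integrableD measurableT (proj1 (IE i)) IH1).
    by apply/funext => x; rewrite /= big_cons.
  under eq_Rintegral do rewrite big_cons.
  by rewrite big_cons -IH2 -(proj2 (IE i)) RintegralD//; case: (IE i).
have I3 : lam.-integrable setT (EFin \o (fun x => H x + mollify dl (w ^~ r) x)).
  by have := integrableD measurableT I2 I1.
have -> : M * (\sum_i \int[lam]_z `|@dmoll R d i z| + 1) * m =
   \int[lam]_x (M * (H x + mollify dl (w ^~ r) x)).
  rewrite RintegralZl// RintegralD// E1 E2 moll_int1 mul1r -mulr_suml; ring.
have ccm : continuous (fun x => `|commutator dl x r|).
  by move=> x; apply: cont_norm; exact: commutator_continuous.
apply: le_Rintegral => //.
- exact: (ccont_integrable (ccontMr cphi ccm)).
- by have := @integrableZl _ _ _ lam setT measurableT M _ I3.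
move=> x _; have /andP[p0 p1] := phib x.
have [cx|nx] := pselect (cube rad x); last first.
  rewrite (proj2 cphi x nx) mul0r mulr_ge0// addr_ge0//.
    by apply: sumr_ge0 => i _; apply: dconv_ge0.
  by apply: dconv_ge0 => //; exact: moll_ge0.
apply: le_trans (hM dl x r dlb cx tr rT').
by rewrite ler_piMl.
Qed.

End evolution.
Arguments cs_xcont {R d T eps s ds w wt ell wx} c i.

(** * The energy inequality *)

Section ccont_integrals.
Context {R : realType} {d : nat}.
Local Notation lam := (@lebesgue_rV R d).
Context (r : R).
Implicit Types (g h : 'rV[R]_d -> R).

Lemma ccontD g h : ccont r g -> ccont r h -> ccont r (fun x => g x + h x).
Proof.
move=> [cg g0] [ch h0]; split; last by move=> x nx; rewrite g0// h0// addr0.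
by move=> x; apply: contD; [exact: cg|exact: ch].
Qed.

Lemma ccontZ c g : ccont r g -> ccont r (fun x => c * g x).
Proof.
move=> [cg g0]; split; last by move=> x nx; rewrite g0// mulr0.
by move=> x; apply: contM; [exact: contC|exact: cg].
Qed.

Lemma ccont_sum (I : Type) (l : seq I) (g : I -> 'rV[R]_d -> R) :
  (forall i, ccont r (g i)) -> ccont r (fun x => \sum_(i <- l) g i x).
Proof.
move=> cg; split; first by move=> x; apply: continuous_sum_fun => i; case: (cg i) => + _; exact.
by move=> x nx; rewrite big1// => i _; case: (cg i) => _; exact.
Qed.

Lemma int_ccontD g h : ccont r g -> ccont r h ->
  \int[lam]_x (g x + h x) = \int[lam]_x g x + \int[lam]_x h x.
Proof. by move=> cg ch; rewrite RintegralD//; [exact: (ccont_integrable cg)|exact: (ccont_integrable ch)]. Qed.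

Lemma int_ccontZ c g : ccont r g -> \int[lam]_x (c * g x) = c * \int[lam]_x g x.
Proof. by move=> cg; rewrite RintegralZl//; exact: (ccont_integrable cg). Qed.

Lemma int_ccont_sum (I : Type) (l : seq I) (g : I -> 'rV[R]_d -> R) :
  (forall i, ccont r (g i)) ->
  \int[lam]_x (\sum_(i <- l) g i x) = \sum_(i <- l) \int[lam]_x g i x.
Proof.
move=> cg; elim: l => [|i l IH].
  by under eq_Rintegral do rewrite big_nil; rewrite big_nil /Rintegral integral0.
under eq_Rintegral do rewrite big_cons.
by rewrite int_ccontD ?IH ?big_cons//; exact: ccont_sum.
Qed.

Lemma le_int_ccont g h : ccont r g -> ccont r h -> (forall x, g x <= h x) ->
  \int[lam]_x g x <= \int[lam]_x h x.
Proof.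
by move=> cg ch gh; apply: le_Rintegral => //; [exact: (ccont_integrable cg)|exact: (ccont_integrable ch)].
Qed.

End ccont_integrals.

Section energy.
Context {R : realType} {d : nat}.
Local Notation lam := (@lebesgue_rV R d).
Context (T eps : R) (s : 'I_d -> 'rV[R]_d -> R -> R) (ds : 'I_d -> 'I_d -> 'rV[R]_d -> R -> R).
Context (w wt ell : 'rV[R]_d -> R -> R) (wx : 'I_d -> 'rV[R]_d -> R -> R).
Context (rd : regular_drift s ds) (cs : classical_solution T eps s ds w wt ell wx).
Context (eps0 : 0 <= eps).
Context (p L : R) (f b : R -> R) (cp : convex_profile p L f b) (p1 : 1 <= p).
Context (N : R) (N1 : 1 <= N).

Local Notation mollify dl g := (dconv (@moll R d) dl g).
Local Notation phi := (@cutoff R d N).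
Local Notation rad := (expR N).

Definition energy (dl r : R) : R := \int[lam]_x (phi x * f (mollify dl (w ^~ r) x)).

Definition energy_dt (dl r : R) : R :=
  \int[lam]_x (phi x * (b (mollify dl (w ^~ r) x) * mollify dl (wt ^~ r) x)).

Lemma mollify_continuous dl g r : cont_before T g -> 0 < r < T -> continuous (mollify dl (g ^~ r)).
Proof.
move=> cg rT x.
exact: (cont_at_space (@dconv_cont_before R d T (expR 1) (@moll R d) (@moll_ccont R d) dl g cg x r rT)).
Qed.

Lemma is_derive_energy dl r : 0 < r < T -> is_derive r 1 (energy dl) (energy_dt dl r).
Proof.
move=> rT; have mc := @moll_ccont R d; have cphi := cutoff_ccont (d := d) N1.
have cW g : cont_before T g -> cont_before T (fun x r => mollify dl (g ^~ r) x).
  by move=> cg x h hT; exact: (@dconv_cont_before R d T (expR 1) (@moll R d) mc dl g cg x h hT).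
apply: (@is_derive_integral_param R d (fun r x => phi x * f (mollify dl (w ^~ r) x))
  (fun r x => phi x * (b (mollify dl (w ^~ r) x) * mollify dl (wt ^~ r) x)) 0 T r rad).
- by rewrite in_itv.
- move=> h; rewrite in_itv /= => hT; apply: ccontMr => //.
  by apply: (continuous_cpW cp); exact: (mollify_continuous (cs_cont cs) hT).
- move=> h z; rewrite in_itv /= => hT; apply: is_deriveZ_fun.
  have D := is_derive_dconv_time mc dl z (cs_cont cs) (cs_tcont cs) (fun y r => @cs_dt _ _ _ _ _ _ _ _ _ _ cs y r) hT.
  exact: (@is_derive1_comp _ f (fun r => mollify dl (w ^~ r) z) h _ _ (cp_derive cp _) D).
- move=> z; apply: contM.
    by apply: (@cont_comp _ _ _ snd phi); [exact: cvg_snd|exact: cutoff_continuous].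
  have sw g : cont_before T g -> continuous_at (r, z) (fun q : R * 'rV[R]_d => mollify dl (g ^~ q.1) q.2).
    move=> cg; apply: (@cont_at_comp R d _ (fun x r => mollify dl (g ^~ r) x) snd fst (r, z)).
    - exact: cW.
    - exact: cvg_snd.
    - exact: cvg_fst.
  apply: contM; last exact: sw (cs_tcont cs).
  by apply: (@cont_comp _ _ _ (fun q : R * 'rV[R]_d => mollify dl (w ^~ q.1) q.2) b); [exact: sw (cs_cont cs)|exact: cp_cont cp _].
Qed.

Section at_time.
Context (dl r m : R) (rT : 0 < r < T).
Context (wm : (\int[lam]_y (w y r)%:E = m%:E)%E).

Let W := mollify dl (w ^~ r).
Let r0 : 0 < r. Proof. by case/andP: rT. Qed.
Let w0 y : 0 <= w y r. Proof. exact: (cs_ge0 cs). Qed.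
Let cW : continuous W. Proof. exact: (mollify_continuous (cs_cont cs) rT). Qed.
Let cfW : continuous (fun x => f (W x)). Proof. exact: (continuous_cpW cp). Qed.
Let cbW : continuous (fun x => b (W x)). Proof. exact: (continuous_cpbW cp). Qed.
Let cphi : ccont rad phi. Proof. exact: cutoff_ccont. Qed.

Lemma mollify_ge0 x : 0 <= W x.
Proof. by apply: dconv_ge0 => //; exact: moll_ge0. Qed.

(** f grows at most linearly with slope L, and mollifying preserves the mass m. *)
Lemma weight_bound (psi : 'rV[R]_d -> R) c : 0 <= c -> ccont rad psi ->
  (forall x, `|psi x| <= c) -> \int[lam]_x (psi x * f (W x)) <= c * L * m.
Proof.
move=> c0 cpsi psic.
have [I1 E1] := dconv_total_mass (@moll_ccont R d) dl (w_continuous cs rT) (@moll_ge0 R d) w0 wm.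
rewrite moll_int1 mul1r in E1.
rewrite -E1 -RintegralZl//; apply: le_Rintegral => //.
- exact: (ccont_integrable (ccontMr cpsi cfW)).
- by have := @integrableZl _ _ _ lam setT measurableT (c * L) _ I1.
move=> x _; have W0 := mollify_ge0 x.
have fW0 := cp_f_ge0 cp W0; have fWL := cp_f_le cp W0.
apply: (@le_trans _ _ (c * f (W x))).
  by rewrite ler_wpM2r// (le_trans (ler_norm _)).
by rewrite -mulrA ler_wpM2l.
Qed.

(** [convex_second_derivative] moves both derivatives onto the cutoff, whose second
derivatives are of order 1 / N. *)
Lemma laplacian_term_le :
  \int[lam]_x (phi x * (b (W x) * mollify dl (ell ^~ r) x)) <= eps * (d%:R * (18 / N * L * m)).
Proof.
have N0 : 0 < N by rewrite (lt_le_trans ltr01).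
have L0 := cp_L_ge0 cp.
have m0 : 0 <= m.
  by rewrite -lee_fin -wm; apply: integral_ge0 => y _; rewrite lee_fin.
case: (cs_lap cs) => [l0|[wxx [cxx dxx lE]]].
  have E0 x : mollify dl (ell ^~ r) x = 0.
    rewrite /dconv; under eq_Rintegral do rewrite l0// mulr0.
    by rewrite /Rintegral integral0.
  under eq_Rintegral do rewrite E0 !mulr0.
  rewrite /Rintegral integral0 /= mulr_ge0// mulr_ge0// mulr_ge0// mulr_ge0//.
  by rewrite divr_ge0// ltW.
have mc := @moll_ccont R d.
have cxx' i : continuous (wxx i ^~ r) by exact: (cont_before_space (cxx i) rT).
have cWxx i : continuous (mollify dl (wxx i ^~ r)) by exact: (mollify_continuous (cxx i) rT).
have E x : mollify dl (ell ^~ r) x = eps * \sum_i mollify dl (wxx i ^~ r) x.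
  have -> : ell ^~ r = (fun y => eps * \sum_i wxx i y r) by apply/funext => y; exact: lE.
  rewrite (dconvZ mc) ?(dconv_sum mc)//.
  by move=> y; apply: continuous_sum_fun => i; exact: cxx'.
have cc i : ccont rad (fun x => phi x * (b (W x) * mollify dl (wxx i ^~ r) x)).
  by apply: ccontMr => // x; apply: contM; [exact: cbW|exact: cWxx].
have -> : \int[lam]_x (phi x * (b (W x) * mollify dl (ell ^~ r) x)) =
   eps * \sum_i \int[lam]_x (phi x * (b (W x) * mollify dl (wxx i ^~ r) x)).
  rewrite -(int_ccont_sum _ cc) -(int_ccontZ _ (ccont_sum _ cc)).
  apply: eq_Rintegral => x _; rewrite E !mulr_sumr; apply: eq_bigr => i _; ring.
rewrite ler_wpM2l//.
have -> : d%:R * (18 / N * L * m) = \sum_(i < d) (18 / N * L * m).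
  by rewrite sumr_const card_ord mulr_natl.
apply: ler_sum => i _.
have cx := @wx_continuous R d T eps s ds w wt ell wx cs i r rT.
apply: (@le_trans _ _ (\int[lam]_x (ddcutoff N i x * f (W x)))).
  under eq_Rintegral do rewrite mulrA.
  apply: (@convex_second_derivative R d p L f b cp rad (unit_vec i) phi (dcutoff N i) (ddcutoff N i) W
     (mollify dl (wx i ^~ r)) (mollify dl (wxx i ^~ r))) => //.
  - exact: dcutoff_ccont.
  - exact: ddcutoff_ccont.
  - exact: cutoff_ge0.
  - by move=> x; exact: is_derive_cutoff.
  - by move=> x; exact: is_derive_dcutoff.
  - exact: (mollify_continuous (cs_xcont cs i) rT).
  - move=> x; apply: (is_derive_dconv mc dl x (w_continuous cs rT) cx) => y; exact: (cs_dx cs).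
  - by move=> x; apply: (is_derive_dconv mc dl x cx (cxx' i)) => y; exact: dxx.
apply: weight_bound.
- by rewrite divr_ge0// ltW.
- exact: ddcutoff_ccont.
- by move=> x; exact: ddcutoff_bound.
Qed.

(** Integrating by parts leaves [div s (b(W) W - f(W))] and a term with the gradient
of the cutoff. Convexity and [cp_homog] place [b(W) W - f(W)] between 0 and
[(p - 1) f(W)], so the lower bound on div s applies. *)
Lemma transport_term_ge C : 0 <= C ->
  (forall x, \sum_i s i x r ^+ 2 <= C * (1 + sqr_enorm x)) ->
  - ((p - 1) * (d%:R / 2) / r * energy dl r) - 3 * (C + 1) / N * L * m <=
  \int[lam]_x (phi x * (b (W x) *
    \sum_i (s i x r * mollify dl (wx i ^~ r) x + ds i i x r * W x))).
Proof.
move=> C0 hC; have N0 : 0 < N by rewrite (lt_le_trans ltr01).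
have mc := @moll_ccont R d.
have cWx i : continuous (mollify dl (wx i ^~ r)) by exact: (mollify_continuous (cs_xcont cs i) rT).
have cs' i := @s_continuous R d s ds rd i r r0.
have cds i := @ds_continuous R d s ds rd i i r r0.
have c1 i : ccont rad (fun x => phi x * (b (W x) * (s i x r * mollify dl (wx i ^~ r) x))).
  apply: ccontMr => // x; apply: contM; first exact: cbW.
  by apply: contM; [exact: cs'|exact: cWx].
have c2 i : ccont rad (fun x => phi x * (ds i i x r * f (W x))).
  by apply: ccontMr => // x; apply: contM; [exact: cds|exact: cfW].
have c3 i : ccont rad (fun x => dcutoff N i x * (s i x r * f (W x))).
  by apply: ccontMr; [exact: dcutoff_ccont|move=> x; apply: contM; [exact: cs'|exact: cfW]].
have c4 i : ccont rad (fun x => phi x * (b (W x) * (ds i i x r * W x))).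
  apply: ccontMr => // x; apply: contM; first exact: cbW.
  by apply: contM; [exact: cds|exact: cW].
have id i : \int[lam]_x (phi x * (b (W x) * (s i x r * mollify dl (wx i ^~ r) x))) =
  - (\int[lam]_x (phi x * (ds i i x r * f (W x)))) - (\int[lam]_x (dcutoff N i x * (s i x r * f (W x)))).
  apply: (transport_identity cp (e := unit_vec i) cphi (dcutoff_ccont i N1)) => //.
  - by move=> x; exact: is_derive_cutoff.
  - move=> x; apply: (is_derive_dconv mc dl x (w_continuous cs rT) (@wx_continuous R d T eps s ds w wt ell wx cs i r rT)) => y.
    exact: (cs_dx cs).
  - by move=> x; exact: (rd_derive rd).
pose g i x := phi x * (ds i i x r * (b (W x) * W x - f (W x))).
have cg i : ccont rad (g i).
  apply: ccontMr => // x; apply: contM; first exact: cds.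
  by apply: contB; [apply: contM; [exact: cbW|exact: cW]|exact: cfW].
have gE i : \int[lam]_x g i x =
   \int[lam]_x (phi x * (b (W x) * (ds i i x r * W x))) - \int[lam]_x (phi x * (ds i i x r * f (W x))).
  rewrite -RintegralB//; last 2 first.
  - exact: (ccont_integrable (c4 i)).
  - exact: (ccont_integrable (c2 i)).
  by apply: eq_Rintegral => x _; rewrite /g; ring.
have -> : \int[lam]_x (phi x * (b (W x) *
    \sum_i (s i x r * mollify dl (wx i ^~ r) x + ds i i x r * W x))) =
  \int[lam]_x (\sum_i g i x) - \int[lam]_x (\sum_i dcutoff N i x * (s i x r * f (W x))).
  rewrite (int_ccont_sum _ cg) (int_ccont_sum _ c3).
  transitivity (\int[lam]_x (\sum_i (phi x * (b (W x) * (s i x r * mollify dl (wx i ^~ r) x)) +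
      phi x * (b (W x) * (ds i i x r * W x))))).
    by apply: eq_Rintegral => x _; rewrite !mulr_sumr; apply: eq_bigr => i _; ring.
  rewrite (int_ccont_sum _ (fun i => ccontD (c1 i) (c4 i))) -sumrB; apply: eq_bigr => i _.
  by rewrite (int_ccontD (c1 i) (c4 i)) id gE; ring.
apply: lerB.
  have ce : ccont rad (fun x => - ((p - 1) * (d%:R / 2) / r) * (phi x * f (W x))).
    by apply: ccontZ; exact: ccontMr.
  rewrite -mulNr -(int_ccontZ _ (ccontMr cphi cfW)).
  apply: (le_int_ccont ce (ccont_sum _ cg)) => x.
  rewrite /g -mulr_sumr -mulr_suml mulrCA ler_wpM2l ?cutoff_ge0//.
  have W0 := mollify_ge0 x.
  have gap := cp_gap_ge0 cp (W x).
  apply: le_trans (ler_wpM2r gap (rd_div rd x r0)).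
  have hom := cp_homog cp W0.
  have k0 : 0 <= d%:R / 2 / r by rewrite divr_ge0 ?divr_ge0// ltW.
  have : d%:R / 2 / r * (b (W x) * W x - f (W x)) <= d%:R / 2 / r * ((p - 1) * f (W x)).
    by rewrite ler_wpM2l//; lra.
  rewrite -lerN2; congr (_ <= _); ring.
have cpsi : ccont rad (fun x => \sum_i s i x r * dcutoff N i x).
  apply: ccont_sum => i; apply: ccontM => //; exact: dcutoff_ccont.
have -> : \int[lam]_x (\sum_i dcutoff N i x * (s i x r * f (W x))) =
   \int[lam]_x ((\sum_i s i x r * dcutoff N i x) * f (W x)).
  by apply: eq_Rintegral => x _; rewrite mulr_suml; apply: eq_bigr => i _; ring.
apply: weight_bound => //.
- by rewrite divr_ge0 ?(ltW N0)// mulr_ge0// addr_ge0.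
- move=> x; have := @dcutoff_dot_bound R d N (\row_i s i x r) C x N1.
  under eq_bigr do rewrite mxE.
  move=> /(_ (hC x)); under eq_bigr do rewrite mxE.
  by [].
Qed.

(** The mollified equation has the diffusion term, the transport term for the
mollified density and the commutator; b(W) lies between 0 and L, which bounds
the last one. *)
Lemma energy_dt_ge C : 0 <= C ->
  (forall x, \sum_i s i x r ^+ 2 <= C * (1 + sqr_enorm x)) ->
  - ((1 + eps) * (p - 1) * (d%:R / 2) / r * energy dl r) -
   (eps * (d%:R * 18) + (1 + eps) * (3 * (C + 1))) * L * m / N -
   (1 + eps) * L * (\int[lam]_x (phi x * `|commutator s ds w wx dl x r|)) <= energy_dt dl r.
Proof.
move=> C0 hC; have N0 : 0 < N by rewrite (lt_le_trans ltr01).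
have mc := @moll_ccont R d.
have cWx i : continuous (mollify dl (wx i ^~ r)) by exact: (mollify_continuous (cs_xcont cs i) rT).
have cell : continuous (mollify dl (ell ^~ r)) by exact: (mollify_continuous (cs_lcont cs) rT).
have ccom := @commutator_continuous R d T eps s ds w wt ell wx rd cs dl r rT.
pose tr x := \sum_i (s i x r * mollify dl (wx i ^~ r) x + ds i i x r * W x).
have ctr : continuous tr.
  move=> x; apply: continuous_sum_fun => i; apply: contD; apply: contM.
  - exact: (s_continuous rd).
  - exact: cWx.
  - exact: (ds_continuous rd).
  - exact: cW.
have wtE x : mollify dl (wt ^~ r) x =
    - mollify dl (ell ^~ r) x + (1 + eps) * (tr x + commutator s ds w wx dl x r).
  have -> : wt ^~ r = (fun y => -1 * ell y r + (1 + eps) * transport s ds w wx y r).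
    by apply/funext => y; rewrite (cs_eq cs)// mulN1r.
  have ce := cont_before_space (cs_lcont cs) rT.
  have ct := transport_continuous rd cs rT.
  rewrite (dconvD mc); last 2 first.
  - by move=> y; apply: contM; [exact: contC|exact: ce].
  - by move=> y; apply: contM; [exact: contC|exact: ct].
  by rewrite !(dconvZ mc)// mulN1r /commutator /tr subrKC.
have k1 : ccont rad (fun x => phi x * (b (W x) * mollify dl (ell ^~ r) x)).
  by apply: ccontMr => // x; apply: contM; [exact: cbW|exact: cell].
have k2 : ccont rad (fun x => phi x * (b (W x) * tr x)).
  by apply: ccontMr => // x; apply: contM; [exact: cbW|exact: ctr].
have k3 : ccont rad (fun x => phi x * (b (W x) * commutator s ds w wx dl x r)).
  by apply: ccontMr => // x; apply: contM; [exact: cbW|exact: ccom].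
have k4 : ccont rad (fun x => phi x * `|commutator s ds w wx dl x r|).
  by apply: ccontMr => // x; apply: cont_norm; exact: ccom.
have -> : energy_dt dl r =
   -1 * \int[lam]_x (phi x * (b (W x) * mollify dl (ell ^~ r) x)) +
   (1 + eps) * (\int[lam]_x (phi x * (b (W x) * tr x)) +
     \int[lam]_x (phi x * (b (W x) * commutator s ds w wx dl x r))).
  rewrite -(int_ccontD k2 k3) -(int_ccontZ _ (ccontD k2 k3)) -(int_ccontZ _ k1).
  rewrite -(int_ccontD (ccontZ _ k1) (ccontZ _ (ccontD k2 k3))).
  by apply: eq_Rintegral => x _; rewrite wtE /W; ring.
have h1 := laplacian_term_le.
have h2 := transport_term_ge C0 hC.
have h3 : - (L * \int[lam]_x (phi x * `|commutator s ds w wx dl x r|)) <=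
   \int[lam]_x (phi x * (b (W x) * commutator s ds w wx dl x r)).
  rewrite -mulNr -(int_ccontZ _ k4); apply: (le_int_ccont (ccontZ _ k4) k3) => x.
  rewrite mulrCA ler_wpM2l ?cutoff_ge0//.
  have b0 := cp_ge0 cp (W x); have bL := cp_le cp (W x).
  rewrite mulNr lerNl -mulrN (@le_trans _ _ (b (W x) * `|commutator s ds w wx dl x r|))//.
    by rewrite ler_wpM2l// -normrN ler_norm.
  by rewrite ler_wpM2r.
have e1 : 0 < 1 + eps by rewrite ltr_wpDr.
have h23 := ler_wpM2l (ltW e1) (lerD h2 h3).
rewrite mulN1r.
set A := \int[lam]_x _ in h1 *; set B := \int[lam]_x _ + _ in h23 *.
have := lerD (etrans (lerN2 _ _) h1) h23.
congr (_ <= _); field; rewrite gt_eqF//= gt_eqF//.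
Qed.

End at_time.
End energy.

(** * From measure solutions to densities *)

Section from_solution.
Context {R : realType} {d : nat} (u0 : probability 'rV[R]_d R).
Local Notation lam := (@lebesgue_rV R d).
Local Notation s := (fun (i : 'I_d) x r => score (heat_solution u0) x r ord0 i).

Lemma score_regular_drift : regular_drift s (dscore u0).
Proof.
split.
- by move=> x r i j r0; exact: is_derive_score.
- by move=> i x r r0; exact: score_continuous.
- by move=> j i x r r0; exact: dscore_continuous.
- by move=> x r r0; exact: div_score_ge.
- by move=> t t0; exact: score_growth.
- by move=> t T rad t0; exact: score_lipschitz.
Qed.

Lemma classical_solution_of_bFP (T eps : R) (w : 'rV[R]_d -> R -> R) : 0 <= eps ->
  (forall x (t : R), 0 < t < T -> 0 <= w x t) -> C1_on T w -> (0 < eps -> C2_space_on T w) ->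
  (forall (x : 'rV[R]_d) (t : R), 0 < t < T ->
    derive1 (w x) t + eps * laplacian (w ^~ t) x
    - (1 + eps) * divergence (fun y => w y t *: score (heat_solution u0) y t) x = 0) ->
  classical_solution T eps s (dscore u0) w (fun x r => derive1 (w x) r)
    (fun x r => eps * laplacian (w ^~ r) x) (fun i x r => partial i (w ^~ r) x).
Proof.
move=> eps0 w0 w1 w2 pde.
have rd := score_regular_drift.
have dx i x r : 0 < r < T -> is_derive x (unit_vec i) (w ^~ r) (partial i (w ^~ r) x).
  by move=> rT; have [_ h _ _ _] := w1 x r rT; apply: derivableP; exact: h.
split => //.
- by move=> x r rT; have [_ _ h _ _] := w1 x r rT.
- by move=> x r rT; have [_ _ _ h _] := w1 x r rT.
- by move=> i x r rT; have [_ _ _ _ h] := w1 x r rT; exact: h.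
- move=> x r rT; rewrite /cont_at; move: eps0; rewrite le_eqVlt => /predU1P[<-|eps0].
    rewrite (_ : (fun z : 'rV[R]_d * R => 0 * laplacian (w ^~ z.2) z.1) = fun=> 0); first exact: contC.
    by apply/funext => z; rewrite mul0r.
  apply: contM; first exact: contC.
  rewrite /laplacian; apply: continuous_sum_fun => i.
  by have [_ h] := w2 eps0 x r rT i i; exact: h.
- move=> x r rT; have [h _ _ _ _] := w1 x r rT.
  by split => //; rewrite derive1E.
- move: (eps0); rewrite le_eqVlt => /predU1P[<-|epsp]; [left|right].
    by move=> x r rT; rewrite mul0r.
  exists (fun i x r => partial i (partial i (w ^~ r)) x); split => //.
  + by move=> i x r rT; have [_ h] := w2 epsp x r rT i i.
  + by move=> i x r rT; have [h _] := w2 epsp x r rT i i; exact: derivableP.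
- move=> x r rT; have r0 : 0 < r by case/andP: rT.
  have := pde x r rT.
  have -> : divergence (fun y => w y r *: score (heat_solution u0) y r) x =
     \sum_i (s i x r * partial i (w ^~ r) x + dscore u0 i i x r * w x r).
    rewrite /divergence; apply: eq_bigr => i _; rewrite /partial.
    have -> : (fun y => (w y r *: score (heat_solution u0) y r) ord0 i) = (fun y => w y r * s i y r).
      by apply/funext => y; rewrite mxE.
    have D := is_deriveM_fun (dx i x r rT) (rd_derive rd x i i r0).
    rewrite (derive_val (is_derive := D)) /partial; ring.
  by move=> h; lra.
Qed.

End from_solution.

Section densities_and_mass.
Context {R : realType} {d : nat}.
Local Notation lam := (@lebesgue_rV R d).
Implicit Types (mu nu : {finite_measure set 'rV[R]_d -> \bar R}).

Lemma density_mass mu f : has_density mu f ->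
  (\int[lam]_y (f y)%:E = (fine (mu setT))%:E)%E.
Proof.
move=> [_ _ h]; rewrite -h// fineK//; exact: fin_num_measure.
Qed.

(** As a function of y this is bounded and continuous, hence a test function for
narrow convergence, and its integral is the mollification of a measure. *)
Definition moll_kernel (dl : R) (x y : 'rV[R]_d) : R := dl ^- d * moll (dl^-1 *: (x - y)).

Lemma moll_kernel_ge0 dl x y : 0 < dl -> 0 <= moll_kernel dl x y.
Proof. by move=> dl0; rewrite mulr_ge0 ?moll_ge0// invr_ge0 exprn_ge0// ltW. Qed.

Lemma moll_kernel_continuous dl x : continuous (moll_kernel dl x).
Proof.
rewrite /moll_kernel => y; apply: contM; first exact: contC.
apply: (@cont_comp _ _ _ (fun y : 'rV[R]_d => dl^-1 *: (x - y)) moll).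
  by apply: vcontZ; [exact: contC|apply: vcontB; [exact: vcontC|exact: cvg_id]].
by case: (@moll_ccont R d) => + _; exact.
Qed.

Lemma moll_bounded : exists2 M : R, 0 <= M & forall z : 'rV[R]_d, moll z <= M.
Proof.
have [c0 h0] := @moll_ccont R d.
have [M [M0 hM]] := ccont_bounded (expR 1) c0.
exists M => // z; have [cz|nz] := pselect (cube (expR 1) z); last by rewrite h0.
by rewrite (le_trans (ler_norm _))// hM.
Qed.

Lemma moll_kernel_bounded dl x : 0 < dl -> exists M, forall y, `|moll_kernel dl x y| <= M.
Proof.
move=> dl0; have [M M0 hM] := moll_bounded.
exists (dl ^- d * M) => y; rewrite ger0_norm ?moll_kernel_ge0//.
by rewrite ler_wpM2l// invr_ge0 exprn_ge0// ltW.
Qed.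

Lemma integral_kernel_density mu f dl x : 0 < dl -> has_density mu f ->
  (\int[mu]_y (moll_kernel dl x y)%:E = \int[lam]_z (moll z * f (x - dl *: z))%:E)%E.
Proof.
move=> dl0 hf; have [mf f0 _] := hf.
have mk : measurable_fun setT (moll_kernel dl x) by apply: continuous_measurable_rV; exact: moll_kernel_continuous.
rewrite (ge0_integral_density hf); last 2 first.
- exact/measurable_EFinP.
- by move=> y; rewrite lee_fin moll_kernel_ge0.
have dln : - dl != 0 by rewrite oppr_eq0 gt_eqF.
pose F (y : 'rV[R]_d) : \bar R := (moll (dl^-1 *: (x - y)) * f y)%:E.
have mm : measurable_fun setT (fun y : 'rV[R]_d => moll (dl^-1 *: (x - y))).
  apply: continuous_measurable_rV => y.
  apply: (@cont_comp _ _ _ (fun y : 'rV[R]_d => dl^-1 *: (x - y)) moll).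
    by apply: vcontZ; [exact: contC|apply: vcontB; [exact: vcontC|exact: cvg_id]].
  by case: (@moll_ccont R d) => + _; exact.
have mF : measurable_fun setT F by apply/measurable_EFinP; exact: measurable_funM.
have F0 y : (0 <= F y)%E by rewrite lee_fin mulr_ge0 ?moll_ge0.
have E1 z : F (- dl *: z + x) = (moll z * f (x - dl *: z))%:E.
  have -> : - dl *: z + x = x - dl *: z by rewrite scaleNr addrC.
  by rewrite /F opprB addrCA subrr addr0 scalerA mulVf ?scale1r// gt_eqF.
under [RHS]eq_integral do rewrite -E1.
rewrite (ge0_integral_affine x dln mF F0) normrN gtr0_norm//.
rewrite -ge0_integralZl_EFin//; last by rewrite invr_ge0 exprn_ge0// ltW.
by apply: eq_integral => y _; rewrite /F /moll_kernel -!EFinM; congr EFin; ring.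
Qed.

Lemma Rintegral_kernel_density mu f dl x : 0 < dl -> has_density mu f ->
  \int[mu]_y moll_kernel dl x y = dconv moll dl f x.
Proof. by move=> dl0 hf; rewrite /Rintegral (integral_kernel_density x dl0 hf). Qed.

(** The tangent inequality of the power at the mollified value, integrated against
the probability density [moll]. *)
Lemma jensen_moll mu f dl x p : 0 < dl -> 1 <= p -> has_density mu f ->
  (((dconv moll dl f x) `^ p)%:E <= \int[lam]_z (moll z * f (x - dl *: z) `^ p)%:E)%E.
Proof.
move=> dl0 p1 hf; have [mf f0 _] := hf.
have p0 : 0 < p by rewrite (lt_le_trans ltr01).
set c := dconv moll dl f x.
have mm : measurable_fun setT (@moll R d) by apply: continuous_measurable_rV; case: (@moll_ccont R d).
have mfs : measurable_fun setT (fun z : 'rV[R]_d => f (x - dl *: z)).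
  apply: (measurableT_comp mf); have := @measurable_affine R d (- dl) x.
  by under eq_fun do rewrite scaleNr addrC.
have mfp : measurable_fun setT (fun z : 'rV[R]_d => moll z * f (x - dl *: z) `^ p).
  by apply: measurable_funM => //; exact: (measurableT_comp (measurable_powR p) mfs).
have [M hM] := @moll_kernel_bounded dl x dl0.
have fin1 : (\int[lam]_z (moll z * f (x - dl *: z))%:E)%E \is a fin_num.
  rewrite -(integral_kernel_density x dl0 hf).
  apply: (integrable_fin_num measurableT); apply: (@bounded_integrable _ _ _ mu (moll_kernel dl x) M) => //.
  by apply: continuous_measurable_rV; exact: moll_kernel_continuous.
have nn (z : 'rV[R]_d) : 0 <= moll z * f (x - dl *: z) := mulr_ge0 (moll_ge0 z) (f0 _).
have nnp (z : 'rV[R]_d) : 0 <= moll z * f (x - dl *: z) `^ p := mulr_ge0 (moll_ge0 z) (powR_ge0 _ _).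
have I1 : lam.-integrable setT (EFin \o (fun z : 'rV[R]_d => moll z * f (x - dl *: z))).
  apply/integrableP; split; first by apply/measurable_EFinP; exact: measurable_funM.
  under eq_integral do rewrite /= ger0_norm ?nn//.
  by rewrite -ge0_fin_numE// integral_ge0// => z _; rewrite lee_fin nn.
have c0 : 0 <= c by apply: Rintegral_ge0 => z _; exact: nn.
have [H|H] := ltP (\int[lam]_z (moll z * f (x - dl *: z) `^ p)%:E)%E +oo%E; last first.
  by apply: le_trans H; rewrite leey.
have I2 : lam.-integrable setT (EFin \o (fun z : 'rV[R]_d => moll z * f (x - dl *: z) `^ p)).
  apply/integrableP; split; first exact/measurable_EFinP.
  by under eq_integral do rewrite /= ger0_norm ?nnp//.
have Im : lam.-integrable setT (EFin \o @moll R d) by exact: (ccont_integrable (@moll_ccont R d)).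
rewrite -[leRHS]fineK; last exact: (integrable_fin_num measurableT I2).
rewrite lee_fin -/(Rintegral _ _ _).
pose a0 := c `^ p - p * c `^ (p - 1) * c; pose a1 := p * c `^ (p - 1).
have Ia : lam.-integrable setT (EFin \o (fun z : 'rV[R]_d => a0 * moll z)).
  by have := @integrableZl _ _ _ lam setT measurableT a0 _ Im.
have Ib : lam.-integrable setT (EFin \o (fun z : 'rV[R]_d => a1 * (moll z * f (x - dl *: z)))).
  by have := @integrableZl _ _ _ lam setT measurableT a1 _ I1.
have -> : c `^ p = \int[lam]_z (a0 * moll z + a1 * (moll z * f (x - dl *: z))).
  rewrite RintegralD// !RintegralZl// moll_int1 -/(dconv _ _ _ _) -/c /a0 /a1; ring.
apply: le_Rintegral => //.
  by have := integrableD measurableT Ia Ib.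
move=> z _; have := powR_tangent p1 (f0 (x - dl *: z)) c0.
move=> /(ler_wpM2l (moll_ge0 z)); congr (_ <= _); rewrite /a0 /a1; ring.
Qed.

End densities_and_mass.

(** * Integrating the energy inequality *)

Section elementary.
Context {R : realType}.

Lemma le_of_small (X Y Z k0 : R) : 0 < k0 ->
  (forall k, 0 < k < k0 -> X <= Y + k * Z) -> X <= Y.
Proof.
move=> k00 h; rewrite leNgt; apply/negP => YX.
have Z1 : 0 < `|Z| + 1 by rewrite ltr_wpDl.
pose k := Num.min (k0 / 2) ((X - Y) / (2 * (`|Z| + 1))).
have XY : 0 < X - Y by rewrite subr_gt0.
have kp : 0 < k by rewrite lt_min !divr_gt0// mulr_gt0.
have kk0 : k < k0 by rewrite gt_min; apply/orP; left; lra.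
have := h k; rewrite kp kk0 => /(_ isT).
have kZ : k * Z <= (X - Y) / 2.
  apply: (@le_trans _ _ (k * (`|Z| + 1))).
    by rewrite ler_pM2l// (le_trans (ler_norm _))// lerDl.
  apply: (@le_trans _ _ ((X - Y) / (2 * (`|Z| + 1)) * (`|Z| + 1))).
    by rewrite ler_pM2r// ge_min lexx orbT.
  by rewrite le_eqVlt; apply/orP; left; apply/eqP; field; rewrite gt_eqF.
lra.
Qed.

Lemma mvt_lower (G G' : R -> R) (u v c : R) : u <= v ->
  (forall r, u <= r <= v -> is_derive r 1 G (G' r)) ->
  (forall r, u <= r <= v -> - c <= G' r) -> G u <= G v + c * (v - u).
Proof.
move=> uv dG lG.
have dG' r : r \in `]u, v[ -> is_derive r 1 G (G' r).
  by rewrite in_itv /= => /andP[h1 h2]; apply: dG; rewrite !ltW.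
have cG : {within `[u, v], continuous G}.
  apply: derivable_within_continuous => r; rewrite in_itv /= => h.
  by have D := dG r h; exact: ex_derive.
have [r] := MVT_segment uv dG' cG; rewrite in_itv /= => h E.
have := ler_wpM2r (_ : 0 <= v - u) (lG r h); rewrite subr_ge0 => /(_ uv).
rewrite -E; lra.
Qed.

End elementary.

Section energy_estimate.
Context {R : realType} {d : nat}.
Local Notation lam := (@lebesgue_rV R d).
Context (T eps : R) (s : 'I_d -> 'rV[R]_d -> R -> R) (ds : 'I_d -> 'I_d -> 'rV[R]_d -> R -> R).
Context (w wt ell : 'rV[R]_d -> R -> R) (wx : 'I_d -> 'rV[R]_d -> R -> R).
Context (rd : regular_drift s ds) (cs : classical_solution T eps s ds w wt ell wx).
Context (eps0 : 0 <= eps).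
Local Notation mollify dl g := (dconv (@moll R d) dl g).

Lemma mollify_approx r rad k : 0 < r < T -> 0 < k ->
  \forall dl \near (0 : R), forall x, cube rad x -> `|mollify dl (w ^~ r) x - w x r| <= k.
Proof.
move=> rT k0; have mc := @moll_ccont R d.
have cw := w_continuous cs rT.
pose F (dl : R) (q : 'rV[R]_d * 'rV[R]_d) := w (q.1 - dl *: q.2) r.
pose K := @cube R d rad `*` @cube R d (expR 1).
have cK : compact K by apply: compact_setX; exact: compact_cube.
have cF z : K z -> {for (0, z), continuous (fun q : R * ('rV[R]_d * 'rV[R]_d) => F q.1 q.2)}.
  move=> _; pose Q := (R * ('rV[R]_d * 'rV[R]_d))%type.
  apply: (@cont_comp _ _ _ (fun q : Q => q.2.1 - q.1 *: q.2.2) (w ^~ r)); last exact: cw.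
  apply: vcontB.
    by apply: (@cont_comp _ _ _ snd fst); [exact: cvg_snd|exact: cvg_fst].
  apply: vcontZ; first exact: cvg_fst.
  by apply: (@cont_comp _ _ _ snd snd); [exact: cvg_snd|exact: cvg_snd].
have := near_uniform cK cF k0; apply: filterS => dl H x cx.
have -> : mollify dl (w ^~ r) x - w x r = mollify dl (fun y => w y r + - w x r) x.
  rewrite (dconvD mc)//; last by move=> y; exact: contC.
  congr (_ + _); rewrite /dconv.
  under eq_Rintegral do rewrite mulrC.
  by rewrite (int_ccontZ _ mc) moll_int1 mulr1.
rewrite -[k]mulr1 -(@moll_int1 R d); apply: (le_dconv_cst mc).
- by move=> y; apply: contD; [exact: cw|exact: contC].
- exact: moll_ge0.
- move=> z cz; have := H (x, z) (conj cx cz).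
  by rewrite /F /= scale0r subr0 => /ltW.
Qed.

Context (t m0 : R) (tT : 0 < t < T).
Context (mass_le : forall r, t <= r -> r < T ->
  exists2 m, m <= m0 & (\int[lam]_y (w y r)%:E = m%:E)%E).

(** Since [E' >= - (a / r) E - errors] by [energy_dt_ge], the product r^a E is
nondecreasing up to the errors. All of them but the one of order 1 / N can be
made as small as a parameter k: on [t, T - k] the scale dl is chosen so that the
commutator is at most k; the remaining interval has length at most k and there
[commutator_L1] applies; the energy at its right end is at most A + k. *)
Lemma energy_estimate : exists2 c, 0 <= c & forall (p L : R) f b (N A : R),
  1 <= p -> convex_profile p L f b -> 1 <= N -> 0 <= A ->
  (forall dl r1 e : R, 0 < dl <= 1 -> t <= r1 -> r1 < T -> 0 < e ->
    exists2 r0, r1 <= r0 < T & energy w f N dl r0 <= A + e) ->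
  t `^ ((1 + eps) * (p - 1) * (d%:R / 2)) * (\int[lam]_x (cutoff N x * f (w x t))) <=
  T `^ ((1 + eps) * (p - 1) * (d%:R / 2)) * (A + c * L / N).
Proof.
have [t0 ltT] := andP tT.
have T0 : 0 < T := lt_trans t0 ltT.
have [C C0 hC] := rd_growth rd t0.
have m00 : 0 <= m0.
  have [m mm0 hm] := mass_le (lexx t) ltT.
  apply: le_trans mm0; rewrite -lee_fin -hm; apply: integral_ge0 => y _.
  by rewrite lee_fin; exact: (cs_ge0 cs).
have e1 : 0 <= 1 + eps by rewrite addr_ge0.
(* the constant of the cutoff errors in [energy_dt_ge] *)
pose D0 := eps * (d%:R * 18) + (1 + eps) * (3 * (C + 1)).
have D00 : 0 <= D0 by rewrite addr_ge0// !mulr_ge0// addr_ge0.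
exists (D0 * m0 * T); first by rewrite !mulr_ge0// ltW.
move=> p L f b N A p1 cp N1 A0 term.
set a := (1 + eps) * (p - 1) * (d%:R / 2).
have N0 : 0 < N by rewrite (lt_le_trans ltr01).
have L0 := cp_L_ge0 cp.
have a0 : 0 <= a by rewrite !mulr_ge0// subr_ge0.
have cphi := cutoff_ccont (d := d) N1.
have phi01 (x : 'rV[R]_d) : 0 <= cutoff N x <= 1 by rewrite cutoff_ge0 cutoff_le1.
pose Phi := \int[lam]_x cutoff N x.
have Phi0 : 0 <= Phi by apply: Rintegral_ge0 => x _; exact: cutoff_ge0.
have [M M0 hM] := commutator_L1 rd cs (expR N) t0.
pose D := D0 * L * m0 / N.
have Dp : 0 <= D by rewrite divr_ge0 ?(ltW N0)// !mulr_ge0.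
(* collects what multiplies k in the chain of inequalities below *)
pose Z := T `^ a + T `^ a * ((1 + eps) * L * Phi) * T + T `^ a * (D + (1 + eps) * L * (M * m0)) + t `^ a * (L * Phi).
have Tt : 0 < T - t by rewrite subr_gt0.
apply: (@le_of_small _ _ _ Z _ Tt) => k /andP[k0 kT].
pose t1 := T - k.
have tt1 : t <= t1 by rewrite /t1; lra.
have t1T : t1 < T by rewrite /t1; lra.
have S1 := commutator_small rd cs (expR N) t0 t1T k0.
have S2 := mollify_approx (expR N) tT k0.
have [e /= ep he] : exists2 e : R, 0 < e & forall dl, `|dl| < e ->
   (forall x r, cube (expR N) x -> t <= r <= t1 -> `|commutator s ds w wx dl x r| <= k) /\
   (forall x, cube (expR N) x -> `|mollify dl (w ^~ t) x - w x t| <= k).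
  have S : \forall dl \near (0 : R), (forall x r, cube (expR N) x -> t <= r <= t1 ->
      `|commutator s ds w wx dl x r| <= k) /\
      (forall x, cube (expR N) x -> `|mollify dl (w ^~ t) x - w x t| <= k).
    by apply: filterS2 S1 S2.
  have [e he] := nbhs_ex S; exists e%:num => // dl dle.
  by apply: he; rewrite /ball /= sub0r normrN.
pose dl := Num.min (e / 2) 1.
have dl0 : 0 < dl by rewrite lt_min divr_gt0// ltr01.
have dl1 : 0 < dl <= 1 by rewrite dl0 ge_min lexx orbT.
have dle : `|dl| < e by rewrite gtr0_norm// gt_min; apply/orP; left; lra.
have {he} [hcom happ] := he dl dle.
have [r0 /andP[t1r0 r0T] hr0] := term dl t1 k dl1 tt1 t1T k0.
pose E := energy w f N dl.
pose G r := r `^ a * E r.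
pose G' r := a * r `^ (a - 1) * E r + r `^ a * energy_dt w wt b N dl r.
have E0 r : 0 < r < T -> 0 <= E r.
  move=> rT; apply: Rintegral_ge0 => x _; rewrite mulr_ge0 ?cutoff_ge0//.
  by apply: (cp_f_ge0 cp); exact: (mollify_ge0 cs dl rT).
have dG r : 0 < r < T -> is_derive r 1 G (G' r).
  move=> rT; have rp : 0 < r by case/andP: rT.
  have DE := is_derive_energy cs cp N1 dl rT.
  have DP := is_derive1_powR a rp.
  apply: is_derive_eq (is_deriveM_fun DP DE) _.
  rewrite /G' /E /energy; ring.
have lower r c : t <= r -> r < T ->
    \int[lam]_x (cutoff N x * `|commutator s ds w wx dl x r|) <= c -> 0 <= c ->
    - (T `^ a * (D + (1 + eps) * L * c)) <= G' r.
  move=> tr rT hc c0.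
  have rp : 0 < r by rewrite (lt_le_trans t0).
  have rT' : 0 < r < T by rewrite rp.
  have [m mm0 hm] := mass_le tr rT.
  have H := energy_dt_ge rd cs eps0 cp N1 dl rT' hm C0 (fun x => hC x r tr).
  have powE : r `^ a = r * r `^ (a - 1).
    have := @powRD _ r 1 (a - 1); rewrite (gt_eqF rp) implybT powRr1 ?ltW// => <-//.
    by rewrite addrC subrK.
  have ra0 : 0 <= r `^ a by exact: powR_ge0.
  have raT : r `^ a <= T `^ a.
    by apply: ge0_ler_powR => //; rewrite ?nnegrE ltW.
  have E1 : - (a / r * E r) - D - (1 + eps) * L * c <= energy_dt w wt b N dl r.
    apply: le_trans H; rewrite -/E -/D0.
    have h1 : D0 * L * m / N <= D.
      by rewrite ler_wpM2r ?invr_ge0 ?(ltW N0)// ler_wpM2l// mulr_ge0.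
    have h2 : (1 + eps) * L * (\int[lam]_x (cutoff N x * `|commutator s ds w wx dl x r|)) <= (1 + eps) * L * c.
      by rewrite ler_wpM2l// mulr_ge0.
    by rewrite -/a; exact: lerB (lerB (lexx _) h1) h2.
  apply: (@le_trans _ _ (a * r `^ (a - 1) * E r + r `^ a * (- (a / r * E r) - D - (1 + eps) * L * c))).
    have -> : a * r `^ (a - 1) * E r + r `^ a * (- (a / r * E r) - D - (1 + eps) * L * c) =
      - (r `^ a * (D + (1 + eps) * L * c)).
      by rewrite powE; field; rewrite gt_eqF.
    have q : 0 <= D + (1 + eps) * L * c by rewrite addr_ge0// mulr_ge0// mulr_ge0.
    by rewrite lerN2 ler_wpM2r.
  by rewrite lerD2l ler_wpM2l.
have time1 r : t <= r <= t1 -> 0 < r < T.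
  by move=> /andP[h1 h2]; rewrite (lt_le_trans t0 h1) (le_lt_trans h2 t1T).
have time2 r : t1 <= r <= r0 -> 0 < r < T.
  by move=> /andP[h1 h2]; rewrite (lt_le_trans t0 (le_trans tt1 h1)) (le_lt_trans h2 r0T).
have step1 : G t <= G t1 + T `^ a * (D + (1 + eps) * L * (k * Phi)) * (t1 - t).
  apply: (mvt_lower (G' := G') tt1) => r hr; first exact: dG (time1 r hr).
  have rT := time1 r hr; have /andP[h1 h2] := hr.
  apply: lower => //; [by case/andP: rT| |by rewrite mulr_ge0// ltW].
  have ccom := @commutator_continuous R d T eps s ds w wt ell wx rd cs dl r rT.
  rewrite /Phi -(int_ccontZ _ cphi); apply: (le_int_ccont (ccontMr cphi (g := fun x => `|commutator s ds w wx dl x r|) _) (ccontZ k cphi)).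
    by move=> x; apply: cont_norm; exact: ccom.
  move=> x; have [cx|nx] := pselect (cube (expR N) x); last by rewrite (proj2 cphi x nx) mul0r mulr0.
  by rewrite mulrC ler_wpM2r ?cutoff_ge0// hcom.
have step2 : G t1 <= G r0 + T `^ a * (D + (1 + eps) * L * (M * m0)) * (r0 - t1).
  apply: (mvt_lower (G' := G') t1r0) => r hr; first exact: dG (time2 r hr).
  have rT := time2 r hr; have /andP[h1 h2] := hr.
  have tr : t <= r := le_trans tt1 h1.
  have rT2 : r < T by case/andP: rT.
  apply: lower => //; last by rewrite mulr_ge0.
  have [m mm0 hm] := mass_le tr rT2.
  apply: le_trans (hM dl r m (cutoff N) dl1 tr rT2 hm cphi phi01) _.
  by rewrite ler_wpM2l.
have step3 : G r0 <= T `^ a * (A + k).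
  have r0T' : 0 < r0 < T by apply: time2; rewrite t1r0 lexx.
  have raT : r0 `^ a <= T `^ a.
    by apply: ge0_ler_powR => //; rewrite ?nnegrE ltW//; case/andP: r0T'.
  apply: (@le_trans _ _ (T `^ a * E r0)); first by rewrite ler_wpM2r// E0.
  by rewrite ler_wpM2l// powR_ge0.
have step0 : \int[lam]_x (cutoff N x * f (w x t)) <= E t + L * k * Phi.
  have cw := w_continuous cs tT.
  have cW := mollify_continuous (dl := dl) (cs_cont cs) tT.
  have c1 := ccontMr cphi (continuous_cpW cp cw).
  have c2 := ccontMr cphi (continuous_cpW cp cW).
  have c3 := ccontZ (L * k) cphi.
  rewrite /E /energy /Phi -(int_ccontZ _ cphi) -(int_ccontD c2 c3).
  apply: (le_int_ccont c1 (ccontD c2 c3)) => x.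
  have [cx|nx] := pselect (cube (expR N) x); last by rewrite (proj2 cphi x nx) !mul0r mulr0 addr0.
  rewrite [L * k * _]mulrC -mulrDr ler_wpM2l ?cutoff_ge0//.
  have tg := cp_tangent cp (w x t) (mollify dl (w ^~ t) x).
  have bd := happ x cx.
  have b0 := cp_ge0 cp (w x t); have bL := cp_le cp (w x t).
  have h : b (w x t) * (w x t - mollify dl (w ^~ t) x) <= L * k.
    apply: (@le_trans _ _ (b (w x t) * k)); last by rewrite ler_wpM2r// ltW.
    by rewrite ler_wpM2l// (le_trans (ler_norm _))// distrC.
  by have := lerD tg h; rewrite -addrA -mulrDr addrA subrK subrr mulr0 addr0.
have ta0 : 0 <= t `^ a by exact: powR_ge0.
have Ta0 : 0 <= T `^ a by exact: powR_ge0.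
have X0 := ler_wpM2l ta0 step0.
have GtE : t `^ a * E t = G t by [].
have Y1 : T `^ a * (D + (1 + eps) * L * (k * Phi)) * (t1 - t) <= T `^ a * (D + (1 + eps) * L * (k * Phi)) * T.
  apply: ler_wpM2l; first by rewrite mulr_ge0// addr_ge0// !mulr_ge0// ltW.
  by rewrite lerBlDr (le_trans (ltW t1T))// lerDl ltW.
have Y2 : T `^ a * (D + (1 + eps) * L * (M * m0)) * (r0 - t1) <= T `^ a * (D + (1 + eps) * L * (M * m0)) * k.
  apply: ler_wpM2l; first by rewrite mulr_ge0// addr_ge0// !mulr_ge0.
  by rewrite lerBlDr /t1 addrC subrK ltW.
have -> : T `^ a * (A + D0 * m0 * T * L / N) + k * Z =
   (T `^ a * (A + k)) + T `^ a * (D + (1 + eps) * L * (M * m0)) * k +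
   T `^ a * (D + (1 + eps) * L * (k * Phi)) * T + t `^ a * (L * k * Phi).
  by rewrite /Z /D; ring.
apply: le_trans X0 _; rewrite mulrDr GtE lerD2r; apply: le_trans step1 _.
by apply: lerD Y1; apply: le_trans step2 _; exact: lerD step3 Y2.
Qed.

End energy_estimate.

(** * The terminal time *)

Section unmeasurable_monotonicity.
Context {disp} {Y : measurableType disp} {R : realType} (mu : {measure set Y -> \bar R}).
Local Open Scope ereal_scope.

(** The integral of a nonnegative function is a supremum over the simple functions
below it, and more of them lie below a larger function. *)
Lemma le_integral_ge0 (f g : Y -> \bar R) : (forall x, 0 <= f x) ->
  (forall x, f x <= g x) -> \int[mu]_x f x <= \int[mu]_x g x.
Proof.
move=> f0 fg; have g0 x : 0 <= g x by exact: le_trans (f0 x) (fg x).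
rewrite (@ge0_integralE _ _ _ mu setT)// [leRHS](@ge0_integralE _ _ _ mu setT)// !patch_setT.
apply: le_ereal_sup => _ [h /= hf <-]; exists h => // x /=.
exact: le_trans (hf x) (fg x).
Qed.

End unmeasurable_monotonicity.

Section truncated_power.
Context {R : realType}.

Lemma trunc_pow_profile (p K : R) : 1 <= p -> 0 < K ->
  convex_profile p (p * K `^ (p - 1)) (trunc_pow p K) (dtrunc_pow p K).
Proof.
move=> p1 K0; split.
- by move=> x y; exact: trunc_pow_tangent.
- exact: dtrunc_pow_continuous.
- by move=> w; exact: dtrunc_pow_ge0.
- by move=> w; exact: dtrunc_pow_le.
- exact: trunc_pow0.
- by move=> w w0; exact: dtrunc_powM_le.
Qed.

End truncated_power.

Section terminal_time.
Context {R : realType} {d : nat} (T : R) (T0 : 0 < T).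
Local Notation lam := (@lebesgue_rV R d).
Context (v : R -> {finite_measure set 'rV[R]_d -> \bar R}) (w : 'rV[R]_d -> R -> R).
Context (narrow : forall phi : 'rV[R]_d -> R,
    continuous phi -> (exists M, forall x, `|phi x| <= M) ->
    {within `]0, T], continuous (fun t => \int[v t]_x phi x)}).
Context (dens : forall t : R, 0 < t < T -> has_density (v t) (w ^~ t)).
Context (wcont : cont_before T w).

(** Narrow continuity with the test function 1 makes the mass continuous on the
compact interval [t, T]. *)
Lemma mass_bounded (t : R) : 0 < t < T -> exists m0, forall r, t <= r -> r < T ->
  exists2 m, m <= m0 & (\int[lam]_y (w y r)%:E = m%:E)%E.
Proof.
move=> /andP[t0 tT].
have c1 : {within `]0, T], continuous (fun r => \int[v r]_x (1 : R))}.
  apply: (@narrow (fun=> 1)); first by move=> x; exact: contC.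
  by exists 1 => x; rewrite normr1.
have c2 : {within `[t, T], continuous (fun r => \int[v r]_x (1 : R))}.
  apply: continuous_subspaceW c1 => r /=; rewrite !in_itv /= => /andP[h1 ->].
  by rewrite (lt_le_trans t0).
have [c _ hc] := EVT_max (ltW tT) c2.
exists (\int[v c]_x 1) => r tr rT; exists (fine (v r setT)).
  have := hc r; rewrite in_itv /= tr ltW// => /(_ isT).
  by rewrite {1}/Rintegral integral_cst// mul1e.
by apply: density_mass; apply: dens; rewrite (lt_le_trans t0).
Qed.

(** An explicit sequence increasing to T, as dominated convergence is sequential. *)
Definition approach (r1 : R) (n : nat) : R := T - (T - r1) / n.+1%:R.

Lemma approach_bounds r1 n : r1 < T -> r1 <= approach r1 n < T.
Proof.
move=> r1T; have h : 0 < T - r1 by rewrite subr_gt0.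
rewrite /approach gtrBl divr_gt0// andbT lerBrDl -lerBrDr ler_pdivrMr//.
by rewrite ler_peMr ?(ltW h)// ler1n.
Qed.

Lemma approach_cvg r1 : approach r1 n @[n --> \oo] --> T.
Proof.
rewrite -[X in _ --> X]subr0 /approach; apply: cvgB; first exact: cvg_cst.
rewrite -(mulr0 (T - r1)); apply: cvgM; first exact: cvg_cst.
exact: cvg_harmonic.
Qed.

Lemma narrow_cvg r1 (phi : 'rV[R]_d -> R) : 0 < r1 < T -> continuous phi ->
  (exists M, forall x, `|phi x| <= M) ->
  \int[v (approach r1 n)]_x phi x @[n --> \oo] --> \int[v T]_x phi x.
Proof.
move=> /andP[r10 r1T] cphi bphi.
have nphi := narrow cphi bphi; have /subspace_continuousP/(_ T) := nphi.
rewrite /= in_itv /= T0 lexx => /(_ isT) h.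
apply: (cvg_comp (approach r1) (fun t => \int[v t]_x phi x) _ h).
move=> B /= hB.
have H : \forall n \near \oo, `]0, T]%classic (approach r1 n) -> B (approach r1 n).
  exact: (@approach_cvg r1 _ hB).
suff : \forall n \near \oo, B (approach r1 n) by [].
apply: filterS H => n; apply.
have /andP[h1 h2] := approach_bounds n r1T.
by rewrite /= in_itv /= ltW// andbT (lt_le_trans r10).
Qed.

Context (f : 'rV[R]_d -> R) (df : has_density (v T) f) (p K : R) (p1 : 1 <= p) (K0 : 0 < K).

(** The truncated power is below the power, then [jensen_moll] and Tonelli. *)
Lemma terminal_energy_le (N dl : R) : 1 <= N -> 0 < dl ->
  ((\int[lam]_x (cutoff N x * trunc_pow p K (dconv moll dl f x)))%:E <=
   \int[lam]_x (f x `^ p)%:E)%E.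
Proof.
move=> N1 dl0; have N0 : 0 < N by rewrite (lt_le_trans ltr01).
have [mf f0 _] := df; have cp := trunc_pow_profile p1 K0.
have V0 x : 0 <= dconv moll dl f x.
  by apply: dconv_ge0 => //; exact: moll_ge0.
have mm : measurable_fun setT (@moll R d).
  by apply: continuous_measurable_rV; case: (@moll_ccont R d).
have mp : measurable_fun setT (fun x => f x `^ p) by exact: (measurableT_comp (measurable_powR p) mf).
have E := tonelli_conv dl mm mp (@moll_ge0 R d) (fun x => powR_ge0 (f x) p).
have Im := ccont_integrable (@moll_ccont R d).
have E1 : (\int[lam]_z (moll z)%:E = 1)%E.
  by rewrite -[LHS]fineK ?(integrable_fin_num measurableT Im)// -[RHS]/(1%:E) -(@moll_int1 R d).
rewrite E1 mul1e in E; rewrite -E.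
have h : (\int[lam]_x (cutoff N x * trunc_pow p K (dconv moll dl f x))%:E <=
  \int[lam]_x \int[lam]_z (moll z * f (x - dl *: z) `^ p)%:E)%E.
  apply: le_integral_ge0 => x.
    by rewrite lee_fin mulr_ge0 ?cutoff_ge0// trunc_pow_ge0.
  apply: le_trans (jensen_moll x dl0 p1 df); rewrite lee_fin.
  apply: le_trans (trunc_pow_le_powR p1 K0 (V0 x)).
  by rewrite ler_piMl ?cutoff_le1// trunc_pow_ge0.
have h0 : (0 <= \int[lam]_x (cutoff N x * trunc_pow p K (dconv moll dl f x))%:E)%E.
  by apply: integral_ge0 => x _; rewrite lee_fin mulr_ge0 ?cutoff_ge0// trunc_pow_ge0.
have [hfin|] := boolP ((\int[lam]_x (cutoff N x * trunc_pow p K (dconv moll dl f x))%:E)%E \is a fin_num).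
  by rewrite /Rintegral fineK.
move=> hn; move: h; rewrite ge0_fin_numE// -leNgt in hn => /(le_trans hn).
by rewrite leye_eq => /eqP ->; exact: leey.
Qed.

(** The mollified densities converge pointwise by narrow convergence, and they are
bounded by a multiple of the mass, so the truncated power of them times the
cutoff is dominated by a multiple of the cutoff. *)
Lemma energy_terminal_cvg (N dl r1 : R) : 1 <= N -> 0 < dl -> 0 < r1 < T ->
  energy w (trunc_pow p K) N dl (approach r1 n) @[n --> \oo] -->
  \int[lam]_x (cutoff N x * trunc_pow p K (dconv moll dl f x)).
Proof.
move=> N1 dl0 r1T; have cp := trunc_pow_profile p1 K0.
have [r10 r1lT] := andP r1T.
have cphi := cutoff_ccont (d := d) N1.
have [m0 hm0] := mass_bounded r1T.
have [M M0 hM] := @moll_bounded R d.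
set L := p * K `^ (p - 1); have L0 : 0 <= L := cp_L_ge0 cp.
have an n : 0 < approach r1 n < T.
  by have /andP[h1 ->] := approach_bounds n r1lT; rewrite (lt_le_trans r10).
pose W (n : nat) (x : 'rV[R]_d) := dconv moll dl (w ^~ (approach r1 n)) x.
have WE n x : \int[v (approach r1 n)]_y moll_kernel dl x y = W n x.
  by apply: Rintegral_kernel_density => //; exact: dens.
have kM (x y : 'rV[R]_d) : moll_kernel dl x y <= dl ^- d * M.
  by rewrite ler_wpM2l// invr_ge0 exprn_ge0// ltW.
have kc (x : 'rV[R]_d) : measurable_fun setT (moll_kernel dl x).
  by apply: continuous_measurable_rV; exact: moll_kernel_continuous.
have D0 : 0 <= dl ^- d * M by rewrite mulr_ge0// invr_ge0 exprn_ge0// ltW.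
have W0 n x : 0 <= W n x.
  by rewrite -WE; apply: Rintegral_ge0 => y _; exact: moll_kernel_ge0.
have Wle n x : W n x <= dl ^- d * M * m0.
  rewrite -WE; apply: (@le_trans _ _ (\int[v (approach r1 n)]_y (dl ^- d * M))).
    apply: le_Rintegral => //.
    - apply: (@bounded_integrable _ _ _ _ (moll_kernel dl x) (dl ^- d * M)) => // y.
      by rewrite ger0_norm ?moll_kernel_ge0.
    - by apply: (@bounded_integrable _ _ _ _ (fun=> dl ^- d * M) (dl ^- d * M)) => // y; rewrite ger0_norm.
  have /andP[h1 h2] := approach_bounds n r1lT.
  have [m mm0 hm] := hm0 _ h1 h2.
  have := density_mass (dens (an n)); rewrite hm => -[mE].
  rewrite Rintegral_cst// ler_wpM2l//; apply: le_trans mm0.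
  by rewrite mE.
have Wcvg x : W n x @[n --> \oo] --> dconv moll dl f x.
  rewrite -(Rintegral_kernel_density x dl0 df).
  under eq_fun do rewrite -WE.
  apply: narrow_cvg => //; first exact: moll_kernel_continuous.
  exact: moll_kernel_bounded.
have cW n : continuous (W n) := @mollify_continuous _ _ _ dl w _ wcont (an n).
pose B := L * (dl ^- d * M * m0).
have Wbound n x : `|cutoff N x * trunc_pow p K (W n x)| <= B * cutoff N x.
  have bW0 : 0 <= trunc_pow p K (W n x) by exact: trunc_pow_ge0.
  rewrite ger0_norm; last by rewrite mulr_ge0// cutoff_ge0.
  rewrite mulrC ler_wpM2r ?cutoff_ge0//.
  apply: le_trans (trunc_pow_le_linear p1 K0 (W0 n x)) _.
  by rewrite ler_wpM2l.
have Ig : lam.-integrable setT (EFin \o (fun x : 'rV[R]_d => B * cutoff N x)).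
  exact: ccont_integrable (ccontZ B cphi).
have cvgx (x : 'rV[R]_d) : cutoff N x * trunc_pow p K (W n x) @[n --> \oo] -->
    cutoff N x * trunc_pow p K (dconv moll dl f x).
  apply: cvgM; first exact: cvg_cst.
  apply: (cvg_comp (W ^~ x) (trunc_pow p K) (Wcvg x)); exact: (cp_continuous cp).
have Fbound x : `|cutoff N x * trunc_pow p K (dconv moll dl f x)| <= B * cutoff N x.
  have h : `|cutoff N x * trunc_pow p K (W n x)| @[n --> \oo] --> `|cutoff N x * trunc_pow p K (dconv moll dl f x)|.
    exact: cvg_norm (cvgx x).
  rewrite -(cvg_lim _ h)//; apply: limr_le; first by apply/cvg_ex; eexists; exact: h.
  by apply: nearW => n; exact: Wbound.
have mF : measurable_fun setT (fun x => cutoff N x * trunc_pow p K (dconv moll dl f x)).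
  apply: (measurable_fun_cvg (h := fun n x => cutoff N x * trunc_pow p K (W n x))).
    by move=> n; apply: continuous_measurable_rV => x; apply: contM; [exact: cutoff_continuous|exact: (continuous_cpW cp (cW n))].
  by move=> x _; exact: cvgx.
apply: fine_cvg; rewrite fineK; last first.
  apply: (integrable_fin_num measurableT); apply: (le_integrable measurableT _ _ Ig).
    exact/measurable_EFinP.
  move=> x _; rewrite /= lee_fin; apply: le_trans (Fbound x) _; exact: ler_norm.
apply: (@dominated_cvg _ _ _ lam setT measurableT
   (fun n x => (cutoff N x * trunc_pow p K (W n x))%:E) _ (EFin \o (fun x => B * cutoff N x))) => //.
- move=> n; apply/measurable_EFinP; apply: continuous_measurable_rV => x.
  by apply: contM; [exact: cutoff_continuous|exact: (continuous_cpW cp (cW n))].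
- by move=> x _; apply: cvg_EFin; [exact: nearW|exact: cvgx].
- by move=> n x _; rewrite lee_fin; exact: Wbound.
Qed.

Lemma energy_near_terminal (N dl r1 e A : R) : 1 <= N -> 0 < dl <= 1 -> 0 < r1 -> r1 < T -> 0 < e ->
  (\int[lam]_x (f x `^ p)%:E = A%:E)%E ->
  exists2 r0, r1 <= r0 < T & energy w (trunc_pow p K) N dl r0 <= A + e.
Proof.
move=> N1 /andP[dl0 _] r10 r1T e0 hA.
have h1 := terminal_energy_le N1 dl0; rewrite hA lee_fin in h1.
have h2 := @energy_terminal_cvg N dl r1 N1 dl0; rewrite r10 r1T in h2.
have H : \forall n \near \oo, energy w (trunc_pow p K) N dl (approach r1 n) <= A + e.
  have /cvgrPdist_lt/(_ e e0) := h2 isT; apply: filterS => n.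
  by rewrite distrC => /ltW/ler_normlW; lra.
have [n _ /(_ n (leqnn n)) hn] := H.
by exists (approach r1 n) => //; exact: approach_bounds.
Qed.

End terminal_time.

(** * Removing the cutoff and the truncation *)

Section limits.
Context {R : realType} {d : nat}.
Local Notation lam := (@lebesgue_rV R d).

Lemma fatou_bound (g : nat -> 'rV[R]_d -> R) (h : 'rV[R]_d -> R) (B : nat -> R) (b : R) :
  (forall n, measurable_fun setT (g n)) -> (forall n x, 0 <= g n x) ->
  (forall x, g n x @[n --> \oo] --> h x) -> B n @[n --> \oo] --> b ->
  (forall n, (\int[lam]_x (g n x)%:E <= (B n)%:E)%E) -> (\int[lam]_x (h x)%:E <= b%:E)%E.
Proof.
move=> mg g0 gh Bb gB.
have -> : (\int[lam]_x (h x)%:E = \int[lam]_x limn_einf (fun n => (g n x)%:E))%E.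
  apply: eq_integral => x _; apply/esym.
  have hx : (fun n => (g n x)%:E) @ \oo --> (h x)%:E by apply: cvg_EFin; [exact: nearW|exact: gh].
  by rewrite (cvg_limn_einf_sup hx).1.
apply: le_trans (fatou lam measurableT (f := fun n x => (g n x)%:E) _ _) _.
- by move=> n; exact/measurable_EFinP.
- by move=> n x _; rewrite lee_fin.
have Bb' : (fun n => (B n)%:E) @ \oo --> b%:E by apply: cvg_EFin; [exact: nearW|exact: Bb].
rewrite -(cvg_limn_einf_sup Bb').1.
rewrite !limn_einf_lim; apply: lee_lim.
- exact: is_cvg_einfs.
- exact: is_cvg_einfs.
apply: nearW => n; apply: le_ereal_inf_tmp => _ [k /= nk <-].
apply: le_trans (gB k); apply: ereal_inf_lbound; by exists k.
Qed.

Lemma trunc_pow_cvg (p x : R) : 0 <= x -> trunc_pow p n.+1%:R x @[n --> \oo] --> x `^ p.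
Proof.
move=> x0; apply: cvg_near_cst; exists (Num.truncn x) => // n /= hn.
rewrite trunc_pow_eq_powR// x0 (le_trans (ltW (truncnS_gt x)))// ler_nat; exact: hn.
Qed.

Context (T eps : R) (s : 'I_d -> 'rV[R]_d -> R -> R) (ds : 'I_d -> 'I_d -> 'rV[R]_d -> R -> R).
Context (w wt ell : 'rV[R]_d -> R -> R) (wx : 'I_d -> 'rV[R]_d -> R -> R).
Context (rd : regular_drift s ds) (cs : classical_solution T eps s ds w wt ell wx).
Context (T0 : 0 < T) (eps0 : 0 <= eps) (v : R -> {finite_measure set 'rV[R]_d -> \bar R}).
Context (narrow : forall phi : 'rV[R]_d -> R,
    continuous phi -> (exists M, forall x, `|phi x| <= M) ->
    {within `]0, T], continuous (fun t => \int[v t]_x phi x)}).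
Context (dens : forall t : R, 0 < t < T -> has_density (v t) (w ^~ t)).
Context (f : 'rV[R]_d -> R) (df : has_density (v T) f) (p : R) (p1 : 1 <= p).

(** [fatou_bound] twice: first N tends to infinity in [energy_estimate], which
removes the cutoff together with the error c L / N, then K, on which L
depends. *)
Lemma power_integral_le (t A : R) : 0 < t < T -> (\int[lam]_x (f x `^ p)%:E = A%:E)%E ->
  (\int[lam]_x (w x t `^ p)%:E <= ((T / t) `^ ((1 + eps) * (p - 1) * (d%:R / 2)) * A)%:E)%E.
Proof.
move=> tT hA; have /andP[t0 ltT] := tT.
set a := (1 + eps) * (p - 1) * (d%:R / 2).
have [m0 hm0] := mass_bounded narrow dens tT.
have [c c0 hc] := energy_estimate rd cs eps0 tT hm0.
have wc := cs_cont cs.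
have cw := w_continuous cs tT.
have A0 : 0 <= A.
  by rewrite -lee_fin -hA; apply: integral_ge0 => x _; rewrite lee_fin powR_ge0.
have w0 x : 0 <= w x t by exact: (cs_ge0 cs).
have ta0 : 0 < t `^ a by exact: powR_gt0.
have ratio : (T / t) `^ a = T `^ a / t `^ a.
  have {2}-> : T = T / t * t by rewrite divfK// gt_eqF.
  by rewrite (powRM a (divr_ge0 (ltW T0) (ltW t0)) (ltW t0)) mulfK// gt_eqF// powR_gt0.
have bound K : 0 < K -> (\int[lam]_x (trunc_pow p K (w x t))%:E <= ((T / t) `^ a * A)%:E)%E.
  move=> K0; have cp := trunc_pow_profile p1 K0; set L := p * K `^ (p - 1).
  apply: (@fatou_bound (fun n x => cutoff n.+1%:R x * trunc_pow p K (w x t)) _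
    (fun n => (T / t) `^ a * (A + c * L / n.+1%:R))).
  - move=> n; apply: continuous_measurable_rV => x.
    by apply: contM; [exact: cutoff_continuous|exact: (continuous_cpW cp cw)].
  - by move=> n x; rewrite mulr_ge0 ?cutoff_ge0 ?trunc_pow_ge0.
  - move=> x; rewrite -[X in _ --> X]mul1r; apply: cvgM; last exact: cvg_cst.
    exact: cutoff_cvg.
  - apply: cvgM; first exact: cvg_cst.
    rewrite -[X in _ --> X]addr0; apply: cvgD; first exact: cvg_cst.
    rewrite -(mulr0 (c * L)); apply: cvgM; first exact: cvg_cst.
    exact: cvg_harmonic.
  - move=> n; have N1 : 1 <= n.+1%:R :> R by rewrite ler1n.
    have cphi := cutoff_ccont (d := d) N1.
    have Iw := ccont_integrable (ccontMr cphi (continuous_cpW cp cw)).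
    rewrite -[leLHS]fineK ?(integrable_fin_num measurableT Iw)// lee_fin.
    have := hc p L _ _ n.+1%:R A p1 cp N1 A0.
    move=> H; have {H} : t `^ a * (\int[lam]_x (cutoff n.+1%:R x * trunc_pow p K (w x t))) <= T `^ a * (A + c * L / n.+1%:R).
      apply: H => dl r1 e dl01 tr1 r1T e0.
      have r10 : 0 < r1 by exact: lt_le_trans tr1.
      exact: (energy_near_terminal T0 narrow dens wc df p1 K0 N1 dl01 r10 r1T e0 hA).
    by rewrite -ler_pdivlMl// mulrA [_^-1 * _]mulrC -ratio.
apply: (@fatou_bound (fun n x => trunc_pow p n.+1%:R (w x t)) _ (fun=> (T / t) `^ a * A)).
- move=> n; apply: continuous_measurable_rV.
  exact: (continuous_cpW (trunc_pow_profile p1 (ltr0Sn R n)) cw).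
- by move=> n x; rewrite trunc_pow_ge0// ltr0Sn.
- by move=> x; exact: trunc_pow_cvg.
- exact: cvg_cst.
- by move=> n; apply: bound; exact: ltr0Sn.
Qed.

End limits.

(** * The L^p estimate *)

Section Lnorm_density.
Context {R : realType} {d : nat}.
Local Notation lam := (@lebesgue_rV R d).

Lemma Lnorm_nonneg (p : R) (f : 'rV[R]_d -> R) : (forall x, 0 <= f x) ->
  'N[lam]_p%:E[EFin \o f]%E = ((\int[lam]_x (f x `^ p)%:E) `^ p^-1)%E.
Proof.
move=> f0; rewrite unlock; congr (_ `^ _)%E; apply: eq_integral => x _.
by rewrite /= ger0_norm.
Qed.

End Lnorm_density.

Theorem theorem3p1 (R : realType) (d : nat) (hd : (0 < d)%N) (T : R)
    (hT : 0 < T) (eps : R) (heps : 0 <= eps)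
    (u0 vT : probability 'rV[R]_d R)
    (v : R -> {finite_measure set 'rV[R]_d -> \bar R})
    (hv : backward_FP_solution eps T (score (heat_solution u0)) vT v)
    (p : R) (hp : 1 <= p) (t : R) (ht : 0 < t <= T) :
  (measure_Lnorm p (v t) <=
     ((T / t) `^ (d%:R * (1 + eps) * (p - 1) / (2 * p)))%:E *
       measure_Lnorm p vT)%E.
Proof.
have [[w [dens wC1 wC2 pde]] narrow terminal] := hv.
have /andP[t0 tT] := ht.
have p0 : 0 < p by rewrite (lt_le_trans ltr01).
set k := (T / t) `^ _.
have k0 : 0 < k by rewrite powR_gt0// divr_gt0.
(* dividing by k first: the right-hand side is then a bare infimum, which may be
   that of the empty set *)
rewrite muleC -lee_pdivrMr//; apply: le_ereal_inf_tmp => _ [f df <-].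
rewrite lee_pdivrMr// muleC.
have dvT : has_density (v T) f.
  by case: df => mf f0 h; split => // A mA; rewrite terminal// h.
have f0 : forall x, 0 <= f x by case: df.
move: tT; rewrite le_eqVlt => /predU1P[tE|tT].
  have -> : k = 1 by rewrite /k tE divff ?powR1// gt_eqF.
  by rewrite mul1e tE; apply: ereal_inf_lbound; exists f.
have tT' : 0 < t < T by rewrite t0.
have w0 (x : 'rV[R]_d) (r : R) : 0 < r < T -> 0 <= w x r by move=> /dens[].
apply: (@le_trans _ _ 'N[lebesgue_rV d]_p%:E[EFin \o (w ^~ t)])%E.
  by apply: ereal_inf_lbound; exists (w ^~ t) => //; exact: dens.
rewrite !Lnorm_nonneg//; last by move=> x; exact: w0.
have I0 : (0 <= \int[lebesgue_rV d]_x (f x `^ p)%:E)%E.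
  by apply: integral_ge0 => x _; rewrite lee_fin powR_ge0.
move: I0; case IE : (\int[lebesgue_rV d]_x (f x `^ p)%:E)%E => [A||]// A0; last first.
  by rewrite poweRyr ?invr_eq0 ?gt_eqF// gt0_muley ?lte_fin// leey.
rewrite lee_fin in A0.
have cs := classical_solution_of_bFP heps w0 wC1 wC2 pde.
have H := power_integral_le (score_regular_drift u0) cs hT heps narrow dens dvT hp tT' IE.
apply: (@le_trans _ _ ((((T / t) `^ ((1 + eps) * (p - 1) * (d%:R / 2)) * A)%:E) `^ p^-1)%E).
  apply: gt0_ler_poweR => //; first by rewrite invr_ge0 ltW.
  - by rewrite in_itv /= leey andbT integral_ge0// => x _; rewrite lee_fin powR_ge0.
  - by rewrite in_itv /= leey andbT lee_fin mulr_ge0 ?powR_ge0.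
rewrite !poweR_EFin -EFinM lee_fin powRM ?powR_ge0// -powRrM /k.
rewrite (_ : (1 + eps) * (p - 1) * (d%:R / 2) / p = d%:R * (1 + eps) * (p - 1) / (2 * p))//.
by field; rewrite gt_eqF.
Qed.
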